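(* Assume that: $\mathcal{B}$ has full rank $r$; $\mathcal{D}$ is positive semi-definite; $g_k>0$ for $k=1,\dots,q$; there are constants $a>0$, $\gamma>0$ with $\|\mathcal{F}(t)\|\le a\exp(-\gamma t)$ for all $t\ge 0$; $\det(\mathcal{B}_2^T\mathcal{D}\mathcal{B}_2)\ne 0$; the pair $(A_1,\bar B)$ is stabilizable; the pair $(A_1,F_1)$ is detectable. Then there exists $\hat\varepsilon>0$ such that for every $\varepsilon\in(0,\hat\varepsilon]$ the state-feedback controls $u_{\varepsilon,1}(z,t)$ and $u_{\varepsilon,2}(z,t)$ belong to $M_u$, and for every sequence $\{\varepsilon_k\}$ with $0<\varepsilon_k\le\hat\varepsilon$ $(k=1,2,\dots)$ and $\lim_{k\to\infty}\varepsilon_k=0$, $$\lim_{k\to+\infty}J\big(u_{\varepsilon_k,i}(z,t)\big)=J^{*},\qquad i=1,2,$$ where $J^*=\inf_{u\in M_u}J(u)$; that is, both sequences $\{u_{\varepsilon_k,1}\}$ and $\{u_{\varepsilon_k,2}\}$ are minimizing for the problem with dynamics $\dot z=Az+Bu+f(t)$, $z(0)=z_0$, and cost $J$.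
   Context: Data: integers $n\ge r\ge 1$, $0\le q<r$ (blocks of zero size are empty); real matrices $\mathcal{A}$ ($n\times n$), $\mathcal{B}$ ($n\times r$), symmetric $\mathcal{D}$ ($n\times n$); $G=\mathrm{diag}(g_1,\dots,g_q,0,\dots,0)$ ($r\times r$); $Z_0\in\mathbb{R}^n$; a measurable function $\mathcal{F}:[0,\infty)\to\mathbb{R}^n$. Transformation: write $\mathcal{B}=(\mathcal{B}_1,\mathcal{B}_2)$ with $\mathcal{B}_1$ of size $n\times q$, $\mathcal{B}_2$ of size $n\times(r-q)$. Let $\mathcal{B}_c$ be an $n\times(n-r)$ matrix such that $(\mathcal{B}_c,\mathcal{B})$ is nonsingular, $\widetilde{\mathcal{B}}_c=(\mathcal{B}_c,\mathcal{B}_1)$, $\mathcal{H}=(\mathcal{B}_2^T\mathcal{D}\mathcal{B}_2)^{-1}\mathcal{B}_2^T\mathcal{D}\widetilde{\mathcal{B}}_c$, $\mathcal{L}=\widetilde{\mathcal{B}}_c-\mathcal{B}_2\mathcal{H}$; the matrix $T=(\mathcal{L},\mathcal{B}_2)$ is nonsingular. Set $A=T^{-1}\mathcal{A}T$, $B=T^{-1}\mathcal{B}$, $D=T^T\mathcal{D}T=\mathrm{blockdiag}(D_1,D_2)$ with $D_1=\mathcal{L}^T\mathcal{D}\mathcal{L}\ge0$, $D_2=\mathcal{B}_2^T\mathcal{D}\mathcal{B}_2>0$, $f(t)=T^{-1}\mathcal{F}(t)$, $z_0=T^{-1}Z_0$. Partition with block sizes $n-r+q$ and $r-q$: $A=\begin{pmatrix}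 A_1 & A_2 \\ A_3 & A_4 \end{pmatrix}$, $f=\mathrm{col}(f_1,f_2)$, $z=\mathrm{col}(x,y)$, $z_0=\mathrm{col}(x_0,y_0)$. Problem: $\dot z(t)=Az(t)+Bu(t)+f(t)$, $t\ge0$, $z(0)=z_0$, cost $J(u)=\int_0^{\infty}[z^T(t)Dz(t)+u^T(t)Gu(t)]dt$. The set $M_u$ of admissible state-feedback controls consists of functions $u(z,t):\mathbb{R}^n\times[0,\infty)\to\mathbb{R}^r$, measurable in $t$ for each fixed $z$ and locally Lipschitz in $z$ uniformly in $t\ge0$, such that the initial-value problem with $u(t)=u(z(t),t)$ has a unique locally absolutely continuous solution $z(t)$ on $[0,\infty)$, $z(\cdot)\in L^2[0,\infty;\mathbb{R}^n]$ and $u(z(\cdot),\cdot)\in L^2[0,\infty;\mathbb{R}^r]$. $J(u(z,t))$ is the cost along this solution. Further notation: $\widetilde G=\mathrm{diag}(g_1,\dots,g_q)$; $S_1=\begin{pmatrix}0&0\\0&\widetilde G^{-1}\end{pmatrix}$ (size $n-r+q$, with lower right block $q\times q$); $S_0=A_2D_2^{-1}A_2^T+S_1$; $\widetilde B=\begin{pmatrix}O_{(n-r)\times q}\\ I_q\end{pmatrix}$; $\bar B=(\widetilde B,A_2)$; $F_1$ is a matrix with $D_1=F_1^TF_1$. Under the hypotheses of the claim, $P_{10}A_1+A_1^TP_{10}-P_{10}S_0P_{10}+D_1=0$ has a unique symmetric positive semi-definite solution $P_{10}^{*}$, and $\mathcal{A}_0=A_1-S_0P_{10}^{*}$ is Hurwitz.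 Define $P_{30}^*=D_2^{1/2}$ (positive definite square root), $P_{20}^*=P_{10}^*A_2D_2^{-1/2}$, $h_{10}(t)=\int_0^{\infty}\exp(\mathcal{A}_0^T\zeta)P_{10}^{*}f_1(\zeta+t)\,d\zeta$, $\ h_{20}(t)=D_2^{-1/2}A_2^Th_{10}(t)$. For $\varepsilon>0$ let $\mathcal{E}=\mathrm{diag}(0,\dots,0,\varepsilon^2,\dots,\varepsilon^2)$ ($q$ zeros, $r-q$ entries $\varepsilon^2$), $P_0^*(\varepsilon)=\begin{pmatrix}P_{10}^*&\varepsilon P_{20}^*\\ \varepsilon (P_{20}^* )^T&\varepsilon P_{30}^*\end{pmatrix}$, $h_0(t,\varepsilon)=\begin{pmatrix}h_{10}(t)\\ \varepsilon h_{20}(t)\end{pmatrix}$. The two controls are $$u_{\varepsilon,1}(z,t)=-(G+\mathcal{E})^{-1}B^TP_0^*(\varepsilon)z-(G+\mathcal{E})^{-1}B^Th_0(t,\varepsilon),$$ $$u_{\varepsilon,2}(z,t)=\begin{pmatrix}-\widetilde G^{-1}\widetilde B^T\big(P_{10}^*x+h_{10}(t)\big)\\ -\frac1\varepsilon\big[(P_{20}^* )^Tx+P_{30}^*y+h_{20}(t)\big]\end{pmatrix}.$$ *)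

(* Defs.v *)
From HB Require Import structures.
From mathcomp Require Import all_boot all_order all_algebra.
From mathcomp Require Import all_classical all_reals all_analysis.
From mathcomp Require Import complex.

Set Implicit Arguments.
Unset Strict Implicit.
Unset Printing Implicit Defensive.
Import Order.TTheory GRing.Theory Num.Theory.
Import numFieldNormedType.Exports.

Local Open Scope classical_set_scope.
Local Open Scope ring_scope.

Definition enorm (R : realType) (n : nat) (x : 'cV[R]_n) : R :=
  Num.sqrt (\sum_i x i 0 ^+ 2).

Definition quad (R : realType) (n : nat) (M : 'M[R]_n) (x : 'cV[R]_n) : R :=
  (x^T *m M *m x) 0 0.

Definition symmetric_mx (R : realType) (n : nat) (M : 'M[R]_n) : Prop := M^T = M.

Definition psd_mx (R : realType) (n : nat) (M : 'M[R]_n) : Prop :=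
  symmetric_mx M /\ forall x : 'cV[R]_n, 0 <= quad M x.

Definition pd_mx (R : realType) (n : nat) (M : 'M[R]_n) : Prop :=
  symmetric_mx M /\ forall x : 'cV[R]_n, x != 0 -> 0 < quad M x.

Definition hurwitz (R : realType) (n : nat) (M : 'M[R]_n) : Prop :=
  forall l : R[i],
    eigenvalue (map_mx (real_complex R) M) l -> complex.Re l < 0.

Definition stabilizable (R : realType) (n m : nat)
    (A : 'M[R]_n) (B : 'M[R]_(n, m)) : Prop :=
  exists K : 'M[R]_(m, n), hurwitz (A + B *m K).

Definition detectable (R : realType) (n m : nat)
    (A : 'M[R]_n) (C : 'M[R]_(m, n)) : Prop :=
  exists L : 'M[R]_(n, m), hurwitz (A + L *m C).

Definition expmx (R : realType) (n : nat) (M : 'M[R]_n) : 'M[R]_n :=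
  limn (series (fun k : nat => k`!%:R^-1 *: M ^+ k)).

(* "Measurable" and "almost everywhere" are meant in the sense of Lebesgue, not
   of Borel: [Leb R] is the real line with the Lebesgue sigma-algebra, and
   [leb] the (complete) Lebesgue measure on it. *)
Notation Leb R := (caratheodory_type ((wlength (@idfun R))^*)%mu).
Notation leb R := (@completed_lebesgue_measure R).

Definition halfline (R : realType) : set R := `[0, +oo[%classic.

Definition meas_vec (R : realType) (n : nat) (v : R -> 'cV[R]_n) : Prop :=
  forall i, measurable_fun (@halfline R : set (Leb R))
    ((fun t : R => v t i 0) : Leb R -> R).

Definition in_L2 (R : realType) (n : nat) (v : R -> 'cV[R]_n) : Prop :=
  meas_vec v /\
  (\int[leb R]_(t in halfline (R:=R)) (enorm (v t) ^+ 2)%:E < +oo)%E.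

(* The family s consists of non-overlapping subintervals [I.1, I.2] of [a, b]. *)
Definition abs_continuous (R : realType) (n : nat) (a b : R)
    (v : R -> 'cV[R]_n) : Prop :=
  forall e : R, 0 < e -> exists2 d : R, 0 < d &
    forall s : seq (R * R),
      all (fun I => (a <= I.1) && (I.1 <= I.2) && (I.2 <= b)) s ->
      pairwise (fun I J => (I.2 <= J.1) || (J.2 <= I.1)) s ->
      \sum_(I <- s) (I.2 - I.1) < d ->
      \sum_(I <- s) enorm (v I.2 - v I.1) < e.

Definition loc_abs_continuous (R : realType) (n : nat)
    (v : R -> 'cV[R]_n) : Prop :=
  forall b : R, 0 < b -> abs_continuous 0 b v.

(* A state feedback u(z, t).  Feedbacks and trajectories are functions on the
   whole time line, but only their values at times t >= 0 are ever used. *)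
Definition feedback (R : realType) (n r : nat) : Type :=
  'cV[R]_n -> R -> 'cV[R]_r.

Definition loc_lipschitz (R : realType) (n r : nat)
    (u : feedback R n r) : Prop :=
  forall z0 : 'cV[R]_n, exists2 rho : R, 0 < rho & exists L : R,
    forall z1 z2 : 'cV[R]_n, enorm (z1 - z0) < rho -> enorm (z2 - z0) < rho ->
    forall t : R, 0 <= t -> enorm (u z1 t - u z2 t) <= L * enorm (z1 - z2).

Definition closed_loop_sol (R : realType) (n r : nat) (A : 'M[R]_n)
    (B : 'M[R]_(n, r)) (f : R -> 'cV[R]_n) (z0 : 'cV[R]_n)
    (u : feedback R n r) (z : R -> 'cV[R]_n) : Prop :=
  [/\ loc_abs_continuous z,
      z 0 = z0 &
      {ae leb R, forall t : R, 0 <= t ->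
         is_derive t 1 z (A *m z t + B *m u (z t) t + f t)}].

(* M_u; trajectories being compared on [0, +oo[ only, uniqueness is uniqueness
   there. *)
Definition admissible (R : realType) (n r : nat) (A : 'M[R]_n)
    (B : 'M[R]_(n, r)) (f : R -> 'cV[R]_n) (z0 : 'cV[R]_n) :
    set (feedback R n r) :=
  [set u | [/\ forall z, meas_vec (u z),
               loc_lipschitz u &
               exists z : R -> 'cV[R]_n,
                 [/\ closed_loop_sol A B f z0 u z,
                     (forall z', closed_loop_sol A B f z0 u z' ->
                        forall t, 0 <= t -> z' t = z t),
                     in_L2 z &
                     in_L2 (fun t => u (z t) t)]]].

(* For admissible u all choices agree on [0, +oo[, hence give the same cost. *)
Definition trajectory (R : realType) (n r : nat) (A : 'M[R]_n)
    (B : 'M[R]_(n, r)) (f : R -> 'cV[R]_n) (z0 : 'cV[R]_n)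
    (u : feedback R n r) : R -> 'cV[R]_n :=
  xget (fun=> 0) (closed_loop_sol A B f z0 u).

Definition cost (R : realType) (n r : nat) (A : 'M[R]_n)
    (B : 'M[R]_(n, r)) (D : 'M[R]_n) (G : 'M[R]_r) (f : R -> 'cV[R]_n)
    (z0 : 'cV[R]_n) (u : feedback R n r) : \bar R :=
  let z := trajectory A B f z0 u in
  (\int[leb R]_(t in halfline (R:=R)) (quad D (z t) + quad G (u (z t) t))%:E)%E.

Definition min_cost (R : realType) (n r : nat) (A : 'M[R]_n)
    (B : 'M[R]_(n, r)) (D : 'M[R]_n) (G : 'M[R]_r) (f : R -> 'cV[R]_n)
    (z0 : 'cV[R]_n) : \bar R :=
  ereal_inf [set cost A B D G f z0 u | u in admissible A B f z0].

(* Block sizes, throughout: p = n - r, q, and s = r - q; thus n = p + q + s and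
   r = q + s, and the fast block y has size s. *)

(* The columns of B split as (B1, B2), with B1 = lsubmx B of width q and
   B2 = rsubmx B of width s. *)
Definition Bctilde (R : realType) (p q s : nat) (Bc : 'M[R]_(p + q + s, p))
    (B : 'M[R]_(p + q + s, q + s)) : 'M[R]_(p + q + s, p + q) :=
  row_mx Bc (lsubmx B).

Definition calH (R : realType) (p q s : nat) (Bc : 'M[R]_(p + q + s, p))
    (B : 'M[R]_(p + q + s, q + s)) (D : 'M[R]_(p + q + s)) :
    'M[R]_(s, p + q) :=
  let B2 := rsubmx B in
  invmx (B2^T *m D *m B2) *m B2^T *m D *m Bctilde Bc B.

Definition calL (R : realType) (p q s : nat) (Bc : 'M[R]_(p + q + s, p))
    (B : 'M[R]_(p + q + s, q + s)) (D : 'M[R]_(p + q + s)) :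
    'M[R]_(p + q + s, p + q) :=
  Bctilde Bc B - rsubmx B *m calH Bc B D.

Definition transfo (R : realType) (p q s : nat) (Bc : 'M[R]_(p + q + s, p))
    (B : 'M[R]_(p + q + s, q + s)) (D : 'M[R]_(p + q + s)) :
    'M[R]_(p + q + s) :=
  row_mx (calL Bc B D) (rsubmx B).

Definition Gmx (R : realType) (q s : nat) (g : 'rV[R]_q) : 'M[R]_(q + s) :=
  block_mx (diag_mx g) 0 0 0.

Definition Emx (R : realType) (q s : nat) (eps : R) : 'M[R]_(q + s) :=
  block_mx 0 0 0 (eps ^+ 2)%:M.

Definition Btilde (R : realType) (p q : nat) : 'M[R]_(p + q, q) :=
  col_mx 0 1%:M.

Definition S1mx (R : realType) (p q : nat) (g : 'rV[R]_q) : 'M[R]_(p + q) :=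
  block_mx 0 0 0 (invmx (diag_mx g)).

Definition S0mx (R : realType) (p q s : nat) (g : 'rV[R]_q)
    (A2 : 'M[R]_(p + q, s)) (D2 : 'M[R]_s) : 'M[R]_(p + q) :=
  A2 *m invmx D2 *m A2^T + S1mx p g.

Definition riccati_sol (R : realType) (m : nat) (A1 S0 D1 P : 'M[R]_m) : Prop :=
  psd_mx P /\ P *m A1 + A1^T *m P - P *m S0 *m P + D1 = 0.

Definition h10 (R : realType) (m : nat) (A0 P10 : 'M[R]_m)
    (f1 : R -> 'cV[R]_m) (t : R) : 'cV[R]_m :=
  \col_i Rintegral (leb R) (halfline (R:=R))
    (fun x : R => (expmx (x *: A0^T) *m P10 *m f1 (x + t)) i 0).

Definition u1 (R : realType) (p q s : nat) (g : 'rV[R]_q)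
    (B : 'M[R]_(p + q + s, q + s)) (P10 : 'M[R]_(p + q))
    (P20 : 'M[R]_(p + q, s)) (P30 : 'M[R]_s) (h1 : R -> 'cV[R]_(p + q))
    (h2 : R -> 'cV[R]_s) (eps : R) : feedback R (p + q + s) (q + s) :=
  let GE := Gmx s g + Emx q s eps in
  let P0 := block_mx P10 (eps *: P20) (eps *: P20^T) (eps *: P30) in
  fun z t =>
    - (invmx GE *m B^T *m P0 *m z)
    - invmx GE *m B^T *m col_mx (h1 t) (eps *: h2 t).

Definition u2 (R : realType) (p q s : nat) (g : 'rV[R]_q)
    (P10 : 'M[R]_(p + q)) (P20 : 'M[R]_(p + q, s)) (P30 : 'M[R]_s)
    (h1 : R -> 'cV[R]_(p + q)) (h2 : R -> 'cV[R]_s) (eps : R) :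
    feedback R (p + q + s) (q + s) :=
  fun z t =>
    let x := usubmx z in
    let y := dsubmx z in
    col_mx (- (invmx (diag_mx g) *m (Btilde R p q)^T *m (P10 *m x + h1 t)))
           (- (eps^-1 *: (P20^T *m x + P30 *m y + h2 t))).

(* Main.v *)
(** Write [k = P10 x + h10] (half the gradient of the value function
    [V = x^T P10 x + 2 h10^T x]) and [w = y + D2^-1 A2^T k].  Along any trajectory
    of the reduced system, the Riccati equation and the adjoint equation for
    [h10] turn the running cost into
      [- V' + (w^T D2 w + v^T Gt v) + c(t)],   [v = u_1 + Gt^-1 Btilde^T k],
    where [c] depends on the data only.  Since square-integrable trajectories
    come arbitrarily close to 0, this bounds every admissible cost from below by
    [J0 = V(0) + int c].  Under either control, [w] obeys
    [w' = - eps^-1 P30 w + O(|x| + |w| + |h10| + |f|)] and [v = O(eps)], while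
    [x] is driven by the Hurwitz matrix [A0]; the Lyapunov function
    [x^T Q x + w^T w] then gives exponential decay and [int |w|^2 = O(eps)], so
    the cost is at most [J0 + O(eps)].  In particular the infimum is [J0]. *)

Require Import Defs.
From HB Require Import structures.
From mathcomp Require Import all_boot all_order all_algebra.
From mathcomp Require Import all_classical all_reals all_analysis.
From mathcomp Require Import complex.
From mathcomp Require Import measurable_realfun spectral ring lra.

Set Implicit Arguments.
Unset Strict Implicit.
Unset Printing Implicit Defensive.
Import Order.TTheory GRing.Theory Num.Theory.
Import numFieldNormedType.Exports.

Local Open Scope classical_set_scope.
Local Open Scope ring_scope.

(** * Absolute continuity and almost everywhere derivatives *)

(** Trajectories are differentiable only almost everywhere, and no function is ever recovered as the
    integral of its derivative. The analytic tool is one-sided: an absolutely continuous function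
    whose derivative is almost everywhere nonpositive does not increase ([ac1_ae_le],
    [acd_nonincreasing]). Uniqueness, exponential decay, convergence of the primitive of [c] and
    both cost estimates are monotonicity statements about well-chosen auxiliary functions. For an
    arbitrary admissible control the running cost is merely integrable, so [ac1_ae_le] tolerates one
    summand that is only monotone. The same matrix [Q] bounds the exponential in [h10] and controls
    [x] in the energy. It is obtained from detectability: a Lyapunov matrix of [A1 + L F1], itself
    built from a Schur form, is corrected by a multiple of [P10]. Both controls belong to one family
    [block_feedback N1 N2 eps], whose members differ by a term of order [eps] in the slow component,
    so each estimate is proved once, with constants independent of [eps]. *)

Definition ac1 (R : realType) (b : R) (v : R -> R) : Prop :=
  forall e : R, 0 < e -> exists2 d : R, 0 < d &
    forall s : seq (R * R),
      all (fun I => (0 <= I.1) && (I.1 <= I.2) && (I.2 <= b)) s ->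
      pairwise (fun I J => (I.2 <= J.1) || (J.2 <= I.1)) s ->
      \sum_(I <- s) (I.2 - I.1) < d ->
      \sum_(I <- s) `|v I.2 - v I.1| < e.

(** Only t > 0 is asked for: a two-sided derivative at 0 would involve values at negative times, and
    a single instant is null. All [b] are allowed because [ac1 b] holds trivially for negative
    [b]. *)
Definition acd (R : realType) (v w : R -> R) : Prop :=
  (forall b : R, ac1 b v) /\
  {ae leb R, forall t : R, 0 < t -> is_derive t (1 : R) v (w t)}.

Section ac1_theory.
Variable R : realType.
Implicit Types (b : R) (u v w : R -> R).

Lemma ac1_lipschitz b v (k : R) :
  (forall x y, 0 <= x -> x <= y -> y <= b -> `|v y - v x| <= k * (y - x)) -> ac1 b v.
Proof.
move=> vk e e0.
exists (e / (`|k| + 1)); first by rewrite divr_gt0// ltr_wpDl.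
move=> s sb _; rewrite ltr_pdivlMr ?ltr_wpDl// => se.
apply: le_lt_trans se; rewrite mulr_suml !big_seq; apply: ler_sum => I Is.
have /andP[/andP[I0 I12] Ib] := allP sb _ Is.
apply: le_trans (vk _ _ I0 I12 Ib) _.
rewrite mulrC ler_wpM2l ?subr_ge0//.
by rewrite (le_trans (ler_norm _))// lerDl.
Qed.

Lemma ac1_cst b (c : R) : ac1 b (fun=> c).
Proof. by apply: (@ac1_lipschitz _ _ 0) => x y *; rewrite subrr normr0 mul0r. Qed.

Lemma ac1D b u v : ac1 b u -> ac1 b v -> ac1 b (fun t => u t + v t).
Proof.
move=> bu bv e e0; have e20 : 0 < e / 2 by rewrite divr_gt0.
have [d1 d10 H1] := bu _ e20; have [d2 d20 H2] := bv _ e20.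
exists (Num.min d1 d2); first by rewrite lt_min d10.
move=> s sb sp; rewrite lt_min => /andP[sd1 sd2].
rewrite [ltRHS]splitr.
apply: le_lt_trans (ltrD (H1 s sb sp sd1) (H2 s sb sp sd2)).
rewrite -big_split/=; apply: ler_sum => I _.
by rewrite opprD addrACA ler_normD.
Qed.

Lemma ac1_continuous b v (x : R) : ac1 b v -> 0 <= x <= b ->
  forall e, 0 < e -> exists2 d : R, 0 < d &
    forall y, 0 <= y <= b -> `|y - x| < d -> `|v y - v x| < e.
Proof.
move=> bv /andP[x0 xb] e e0; have [d d0 H] := bv _ e0; exists d => // y /andP[y0 yb].
case: (leP x y) => [xy yd|/ltW yx yd].
  have := H [:: (x, y)]; rewrite !big_seq1/= x0 xy yb/=; apply => //.
  by apply: le_lt_trans yd; rewrite ler_norm.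
have := H [:: (y, x)]; rewrite !big_seq1/= y0 yx xb/= distrC; apply => //.
by apply: le_lt_trans yd; rewrite distrC ler_norm.
Qed.

(** Absolute continuity with [e = 1] keeps the oscillation below 1 on intervals shorter than [d];
    walking from 0 in steps of [d / 2] bounds [v] by [|v 0|] plus the number of steps. *)
Lemma ac1_bounded b v : ac1 b v -> exists2 M : R, 0 <= M &
  forall x, 0 <= x <= b -> `|v x| <= M.
Proof.
move=> bv; have [b0|b0] := leP 0 b; last first.
  by exists 0 => // x /andP[x0 xb]; move: (le_trans x0 xb); rewrite leNgt b0.
have [d d0 H] := bv 1 ltr01.
have step x y : 0 <= x <= b -> 0 <= y <= b -> `|y - x| < d -> `|v y - v x| < 1.
  move=> /andP[x0 xb] /andP[y0 yb].
  case: (leP x y) => [xy yd|/ltW yx yd].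
    have := H [:: (x, y)]; rewrite !big_seq1/= x0 xy yb/=; apply => //.
    by apply: le_lt_trans yd; rewrite ler_norm.
  have := H [:: (y, x)]; rewrite !big_seq1/= y0 yx xb/= distrC; apply => //.
  by apply: le_lt_trans yd; rewrite distrC ler_norm.
have d20 : 0 < d / 2 by rewrite divr_gt0.
have key (n : nat) x : 0 <= x <= b -> x <= n%:R * (d / 2) -> `|v x| <= `|v 0| + n%:R.
  elim: n x => [|n IHn] x /andP[x0 xb] xn.
    have -> : x = 0 by apply/eqP; rewrite eq_le x0 andbT; move: xn; rewrite mul0r.
    by rewrite addr0.
  have [xn'|xn'] := leP x (n%:R * (d / 2)).
    by apply: le_trans (IHn _ _ xn') _; rewrite ?x0// lerD2l ler_nat.
  have hn : 0 <= n%:R * (d / 2) :> R by rewrite mulr_ge0// ltW.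
  have hb : 0 <= n%:R * (d / 2) <= b by rewrite hn (le_trans (ltW xn')).
  have := IHn _ hb (lexx _).
  have : `|v x - v (n%:R * (d / 2))| < 1.
    apply: step => //; first by rewrite x0.
    rewrite gtr0_norm ?subr_gt0//.
    move: xn; rewrite -natr1; lra.
  have := ler_normD (v x - v (n%:R * (d / 2))) (v (n%:R * (d / 2))).
  rewrite subrK -natr1; lra.
exists (`|v 0| + (Num.bound (b / (d / 2)))%:R); first by rewrite addr_ge0.
move=> x /andP[x0 xb]; apply: key; rewrite ?x0//.
rewrite -ler_pdivrMr//; apply: le_trans (ltW (archi_boundP _)); last by rewrite divr_ge0// ltW.
by rewrite ler_pM2r// invr_gt0.
Qed.

Lemma ac1M b u v : ac1 b u -> ac1 b v -> ac1 b (fun t => u t * v t).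
Proof.
move=> bu bv e e0.
have [M M0 uM] := ac1_bounded bu; have [N N0 vN] := ac1_bounded bv.
have eM0 : 0 < e / 2 / (M + 1) by rewrite !divr_gt0// ltr_wpDl.
have eN0 : 0 < e / 2 / (N + 1) by rewrite !divr_gt0// ltr_wpDl.
have [d1 d10 H1] := bu _ eN0; have [d2 d20 H2] := bv _ eM0.
exists (Num.min d1 d2); first by rewrite lt_min d10.
move=> s sb sp; rewrite lt_min => /andP[sd1 sd2].
have h1 := H1 s sb sp sd1; have h2 := H2 s sb sp sd2.
rewrite ltr_pdivlMr ?ltr_wpDl// in h1; rewrite ltr_pdivlMr ?ltr_wpDl// in h2.
rewrite [ltRHS]splitr; apply: le_lt_trans (ltrD h1 h2).
rewrite !mulr_suml -big_split/= !big_seq; apply: ler_sum => I Is.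
have /andP[/andP[I0 I12] Ib] := allP sb _ Is.
have uI : `|u I.2| <= M by apply: uM; rewrite (le_trans I0).
have vI : `|v I.1| <= N by apply: vN; rewrite I0 (le_trans I12).
rewrite (_ : _ - _ = (u I.2 - u I.1) * v I.1 + (v I.2 - v I.1) * u I.2); last by ring.
apply: (le_trans (ler_normD _ _)); rewrite !normrM lerD// ler_wpM2l//.
  by rewrite (le_trans vI)// lerDl.
by rewrite (le_trans uI)// lerDl.
Qed.

End ac1_theory.

(** * Monotonicity from the sign of an almost everywhere derivative *)

Section monotone.
Variable R : realType.
Implicit Types (v w : R -> R).

Lemma leb_negligible_open (N : set R) (d : R) : (leb R).-negligible N -> 0 < d ->
  exists U : set R, [/\ open U, N `<=` U & (lebesgue_measure U < d%:E)%E].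
Proof.
move=> [A [mA A0 NA]] d0.
have d20 : 0 < d / 2 by rewrite divr_gt0.
have [U [oU AU Ud]] := outer_measure_open_le A d20.
exists U; split => //; first exact: subset_trans AU.
apply: le_lt_trans Ud _.
have -> : ((wlength idfun)^*)%mu A = 0%E by exact: A0.
by rewrite add0e lte_fin ltr_pdivrMr// ltr_pMr// ltr1n.
Qed.

Lemma leb_negligible_set1 (x : R) : (leb R).-negligible [set x].
Proof.
exists [set x]; split => //; last exact: (lebesgue_measure_set1 x).
by apply: sub_caratheodory; exact: measurable_set1.
Qed.

(** Cousin's lemma as an induction over tagged intervals: [r] is a gauge, and short intervals
    containing the tag [t] satisfy [P]. At the supremum [c] of the points reached, the gauge of [c]
    allows one more interval, from a reached point just below [c] to a point beyond [c], unless [c]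
    is [b]. *)
Lemma cousin_induction (P : R -> R -> Prop) (Q : R -> Prop) (a b : R) : a <= b -> Q a ->
  (forall t, a <= t <= b -> exists2 r : R, 0 < r &
     forall x y, a <= x -> x <= t -> t <= y -> y <= b -> y - x < r -> P x y) ->
  (forall x y, a <= x -> x <= y -> y <= b -> Q x -> P x y -> Q y) ->
  Q b.
Proof.
move=> ab Qa loc step.
pose S := [set c | a <= c <= b /\ Q c].
have Sa : S a by rewrite /S/= lexx ab.
have hS : has_sup S by split; [exists a | exists b => c [/andP[]]].
set c := sup S.
have ac : a <= c by apply: (sup_upper_bound hS).
have cb : c <= b by apply: ge_sup; [exists a | move=> x [/andP[]]].
have [|r r0 Hr] := loc c; first by rewrite ac.
have r20 : 0 < r / 2 by rewrite divr_gt0.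
have [x [/andP[ax xb] Qx] cx] := sup_adherent r20 hS.
have xc : x <= c by apply: (sup_upper_bound hS); rewrite /S/= ax.
(* [x] is less than [r / 2] below [c] and [y] at most [r / 4] above it, so [[x, y]] is shorter than
   [r]. The cap at [b] makes [y <= c] force [y = b]. *)
pose y := Num.min b (c + r / 4).
have cy : c <= y by rewrite le_min cb lerDl divr_ge0// ltW.
have yb : y <= b by rewrite ge_min lexx.
have Qy : Q y.
  apply: (step x) => //; first exact: le_trans cy.
  apply: Hr => //.
  have : y <= c + r / 4 by rewrite ge_min lexx orbT.
  move: cx; rewrite -/c; lra.
have yc : y <= c by apply: (sup_upper_bound hS); rewrite /S/= (le_trans ac cy) yb.
have : y = b.
  move: yc; rewrite /y; case: (leP b (c + r / 4)) => //.
  rewrite gerDl; lra.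
by move=> <-.
Qed.

(** Straddle lemma: the interval is cut at [t], and on each side the slope is at most [w + e], hence
    at most [e]. *)
Lemma derive_straddle (f : R -> R) (t w e : R) :
  is_derive t (1 : R) f w -> w <= 0 -> 0 < e ->
  exists2 r : R, 0 < r &
    forall x y, x <= t -> t <= y -> y - x < r -> f y - f x <= e * (y - x).
Proof.
move=> [dv vw] w0 e0.
have : (fun h : R => h^-1 *: (f (h *: 1 + t) - f t)) @ 0^' --> w.
  by rewrite -vw; exact: dv.
move=> /cvgrPdist_lt/(_ _ e0)[r /= r0 Hr].
have H y : `|y - t| < r -> y != t -> `|w - (y - t)^-1 * (f y - f t)| < e.
  move=> yr yt; have := Hr (y - t).
  rewrite /ball_/= sub0r normrN => /(_ yr).
  by rewrite subr_eq0 => /(_ yt); rewrite scaler1 subrK.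
exists r => // x y xt ty yx.
have h1 : f y - f t <= e * (y - t).
  have [->|yt] := eqVneq y t; first by rewrite !subrr mulr0.
  have ypos : 0 < y - t by rewrite subr_gt0 lt_neqAle eq_sym yt.
  have := H y; rewrite gtr0_norm// => /(_ _ yt).
  have /[swap]/[apply] : y - t < r by lra.
  rewrite ltr_norml => /andP[+ _].
  rewrite ltrBrDl -[_ + - e]/(_ - e) => /ltW h.
  rewrite -ler_pdivrMr// mulrC; lra.
have h2 : f t - f x <= e * (t - x).
  have [->|xt'] := eqVneq x t; first by rewrite !subrr mulr0.
  have xpos : 0 < t - x by rewrite subr_gt0 lt_neqAle xt'.
  have := H x; rewrite distrC gtr0_norm// => /(_ _ xt').
  have /[swap]/[apply] : t - x < r by lra.
  rewrite (_ : (x - t)^-1 * (f x - f t) = (t - x)^-1 * (f t - f x)); last first.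
    by rewrite -(opprB t x) -(opprB (f t)) invrN mulrNN.
  rewrite ltr_norml => /andP[+ _] => h.
  rewrite -ler_pdivrMr// mulrC; lra.
lra.
Qed.

(* The exceptional null set is covered by an open set so small that absolute
   continuity controls the increments of [v] on it; elsewhere the sign of the
   derivative does.  [Psi] is only monotone: on the open set its increments have
   the right sign anyway. *)
Lemma ac1_ae_le (v Psi w : R -> R) (b : R) :
  ac1 b v -> (forall x y, 0 <= x -> x <= y -> y <= b -> Psi x <= Psi y) ->
  {ae leb R, forall t : R, 0 < t ->
     is_derive t (1 : R) (fun t => v t - Psi t) (w t) /\ w t <= 0} ->
  forall a, 0 <= a -> a <= b -> v b - Psi b <= v a - Psi a.
Proof.
move=> acv ndPsi; set f := fun t => v t - Psi t => aev a a0 ab.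
change (f b <= f a).
have key : forall e : R, 0 < e -> f b <= f a + (e * (b - a) + e).
  move=> e e0.
  have [d d0 Hd] := acv _ e0.
  (* The derivative is known at positive times only, so the point 0 joins the exceptional set. *)
  have N0' := negligibleU aev (leb_negligible_set1 0).
  set N := _ `|` _ in N0'.
  have subN t : 0 <= t -> ~ N t -> is_derive t (1:R) f (w t) /\ w t <= 0.
    move=> t0 Nt; apply: contrapT => h; apply: Nt.
    by have [->|t0'] := eqVneq t 0; [right | left => /=; apply: contra_not h; apply; rewrite lt_neqAle eq_sym t0'].
  have [U [oU NU Ud]] := leb_negligible_open N0' d0.
  have mU : measurable U by exact: open_measurable.
  pose mu := @lebesgue_measure R.
  (* The invariant collects the intervals on which the derivative gives no control. Their total
     length is compared with the measure of [U] up to [c], a quantity that is additive when an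
     interval inside [U] is appended and that stays below [d]. *)
  pose Q (c : R) := exists s : seq (R * R),
    [/\ all (fun I => (0 <= I.1) && (I.1 <= I.2) && (I.2 <= c)) s,
      pairwise (fun I J => (I.2 <= J.1) || (J.2 <= I.1)) s,
      ((\sum_(I <- s) (I.2 - I.1))%:E <= mu (U `&` `]a, c]))%E &
      f c - f a <= e * (c - a) + \sum_(I <- s) `|v I.2 - v I.1|].
  (* The first alternative serves a tag outside [N], by [derive_straddle]; the second a tag in [N],
     which is interior to [U]. *)
  pose P (x y : R) := f y - f x <= e * (y - x) \/ `]x, y] `<=` U.
  have Qb : Q b.
    apply: (@cousin_induction P Q a b) => //.
      - by exists [::]; rewrite !big_nil; split => //; rewrite !subrr mulr0 addr0.
      - move=> t /andP[at_ tb].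
        have [Nt|Nt] := pselect (N t).
          have /nbhs_ballP[r /= r0 Br] : nbhs t U by apply: oU; apply: NU.
          exists r => // x y ax xt ty yb yx; right => u /=; rewrite in_itv/= => /andP[xu uy].
          by apply: Br; rewrite /ball/= ltr_norml; apply/andP; split; lra.
        have [dv w0] := subN _ (le_trans a0 at_) Nt.
        have [r r0 Hr] := derive_straddle dv w0 e0.
        by exists r => // x y ax xt ty yb yx; left; exact: Hr.
      - move=> x y ax xy yb [s [s1 s2 s3 s4]] [h|h].
          exists s; split => //.
          + by apply: sub_all s1 => I /andP[-> I2]/=; exact: le_trans xy.
          + apply: le_trans s3 _; apply: le_measure; rewrite ?inE//=.
            * by apply: measurableI => //; exact: measurable_itv.
            * by apply: measurableI => //; exact: measurable_itv.
            * by apply: setIS => u /=; rewrite !in_itv/= => /andP[-> h']; exact: le_trans xy.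
          + lra.
        exists ((x, y) :: s); rewrite !big_cons; split => /=.
        + rewrite xy lexx !andbT (le_trans a0 ax)/=.
          by apply: sub_all s1 => I /andP[-> I2]/=; exact: le_trans xy.
        + rewrite s2 andbT; apply/allP => I Is.
          by have /andP[_ ->] := allP s1 _ Is; rewrite orbT.
        + have -> : U `&` `]a, y] = `]x, y] `|` (U `&` `]a, x]).
            apply/seteqP; split => u /=; rewrite !in_itv/=.
              by move=> [Uu /andP[au uy]]; have [ux|ux] := leP u x;
                [right; split => //; rewrite au | left; rewrite uy].
            case=> [/andP[xu uy]|[Uu /andP[au ux]]].
              by split; [apply: h; rewrite /= in_itv/= xu | rewrite uy (le_lt_trans ax)].
            by split => //; rewrite au (le_trans ux).
          rewrite /mu (measureU lebesgue_measure)//=.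
          * rewrite EFinD leeD// lebesgue_measure_itv/= lte_fin.
            by case: ltP => // yx; rewrite lee_fin subr_le0.
          * by apply: measurableI => //; exact: measurable_itv.
          * apply/seteqP; split => // u /= []; rewrite !in_itv/= => /andP[xu _] [_ /andP[_]].
            by rewrite leNgt xu.
        + have := ler_norm (v y - v x).
          have := ndPsi x y (le_trans a0 ax) xy yb.
          have -> : f y - f a = (v y - v x) - (Psi y - Psi x) + (f x - f a).
            by rewrite /f; ring.
          have : 0 <= e * (y - x) by rewrite mulr_ge0 ?subr_ge0// ltW.
          lra.
  have [s [s1 s2 s3 s4]] := Qb.
  have : \sum_(I <- s) `|v I.2 - v I.1| < e.
    apply: Hd => //.
    rewrite -lte_fin; apply: le_lt_trans s3 _; apply: le_lt_trans Ud.
    by apply: le_measure; rewrite ?inE//=; apply: measurableI => //; exact: measurable_itv.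
  lra.
apply/ler_addgt0Pl => e e0.
have k0 : 0 < b - a + 1 by rewrite ltr_wpDl// subr_ge0.
have := key (e / (b - a + 1)); rewrite divr_gt0// => /(_ isT).
rewrite -[X in _ * _ + X]mulr1 -mulrDr divfK ?gt_eqF//; lra.
Qed.
Lemma acd_nonincreasing (v w : R -> R) (a b : R) : acd v w ->
  (forall t, 0 < t -> w t <= 0) -> 0 <= a -> a <= b -> v b <= v a.
Proof.
move=> [acv [N [mN N0 subN]]] w0 a0 ab.
have := @ac1_ae_le v (cst 0) w b (acv b) (fun _ _ _ _ _ => lexx _) _ a a0 ab.
rewrite /cst !subr0; apply.
exists N; split => // t /= h; apply: subN => /= h'; apply: h => t0.
split; last exact: w0.
by under eq_fun do rewrite subr0; exact: h'.
Qed.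

End monotone.

(** * Lebesgue versus Borel measurability *)

Section leb_borel.
Variable R : realType.
Notation mu := (@lebesgue_measure R).

Lemma borel_leb (A : set R) : measurable A -> measurable (A : set (Leb R)).
Proof. by move=> mA; apply: sub_caratheodory. Qed.

Lemma leb_borel (A : set R) : measurable (A : set (Leb R)) ->
  exists B N : set R, [/\ measurable B, mu.-negligible N, B `<=` A & A `<=` B `|` N].
Proof.
rewrite -(@completed_caratheodory_measurable R) g_sigma_completed_algebra_genE.
by move=> [B mB [N nN <-]]; exists B, N; split.
Qed.

Lemma borel_leb_fun (D : set R) (f : R -> R) : measurable D ->
  measurable_fun D f -> measurable_fun (D : set (Leb R)) (f : Leb R -> R).
Proof.
by move=> mD mf _ A mA; apply: borel_leb; exact: mf.
Qed.

Lemma leb_borel_negligible (N : set R) : (leb R).-negligible N -> mu.-negligible N.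
Proof.
move=> [A [mA A0 NA]]; have nA : mu.-negligible A by apply/negligible_outer_measure; exact: A0.
by case: nA => B [mB B0 AB]; exists B; split => //; exact: subset_trans AB.
Qed.

Lemma measurable_halfline : measurable (@halfline R : set R).
Proof. exact: measurable_itv. Qed.

(** Each rational sublevel set is Borel up to a null set, and these countably many null sets fit
    into one Borel null set [M]. Setting [f] to 0 on [M] and at negative times leaves sublevel sets
    built from countably many Borel ones. The last clause lets [g] inherit every nonnegative
    pointwise bound on [|f|]. *)
Lemma leb_fun_borel (f : R -> R) :
  measurable_fun (@halfline R : set (Leb R)) (f : Leb R -> R) ->
  exists g : R -> R, [/\ measurable_fun [set: R] g,
    {ae leb R, forall t : R, 0 <= t -> f t = g t} &
    forall t, g t = 0 \/ (0 <= t /\ g t = f t)].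
Proof.
move=> mf.
pose A (q : rat) : set R := @halfline R `&` f @^-1` `]-oo, ratr q[.
have mA q : measurable (A q : set (Leb R)).
  by apply: mf; [exact: borel_leb measurable_halfline | exact: measurable_itv].
have [B HB] := choice (fun q => leb_borel (mA q)).
have [N BN] := choice HB.
pose F n := if unpickle n is Some q then N q else set0.
have nF : mu.-negligible (\bigcup_n F n).
  apply: negligible_bigcup => n; rewrite /F; case: unpickle => [q|]; last exact: negligible_set0.
  by have [] := BN q.
have [M [mM M0 FM]] := nF.
have NM q : N q `<=` M.
  apply: subset_trans FM => x Nx; exists (pickle q); first exact: I.
  by rewrite /F pickleK.
pose H : set R := @halfline R `\` M.
have mH : measurable H by apply: measurableD => //; exact: measurable_halfline.
exists (f \_ H); split.
- apply: (measurability (@RGenInftyO.G R)); first exact: RGenInftyO.measurableE.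
  move=> _ [_ [a ->] <-]; rewrite setTI.
  rewrite (_ : _ @^-1` _ = \bigcup_(q in [set q : rat | ratr q < a]) (B q `&` H) `|`
      (if 0 < a then ~` H else set0)); last first.
    apply/seteqP; split => t /=; rewrite patchE in_itv/=.
      case: ifPn => [|]; rewrite ?notin_setE ?inE => Ht.
        move=> /rat_in_itvoo[q]; rewrite in_itv/= => /andP[fq qa]; left; exists q => //.
        split => //; have [_ _ _ sub] := BN q.
        have : A q t by split; [case: Ht | rewrite /= in_itv].
        by move=> /sub[//|/NM Mt]; case: Ht.
      by rewrite /point/= => ->; right.
    case=> [[q qa [Bt Ht]]|].
      rewrite mem_set//; have [_ _ sub _] := BN q.
      by have [_ /=] := sub _ Bt; rewrite in_itv/= => /lt_trans; apply.
    by case: ifPn => // a0 nH; rewrite memNset.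
  apply: measurableU; last by case: ifP => // _; exact: measurableC.
  rewrite bigcup_mkcond; apply: bigcupT_measurable_rat => q; case: ifPn => // _.
  by apply: measurableI => //; have [] := BN q.
- exists M; split; [exact: borel_leb|exact: M0|move=> t /= h].
  apply: contrapT => nM; apply: h => t0; rewrite patchE mem_set//; split => //.
  by rewrite /= /halfline/= in_itv/= t0.
- move=> t; rewrite patchE; case: ifPn => [|_]; last by left.
  by rewrite inE => -[]; rewrite /halfline/= in_itv/= andbT; right.
Qed.

(** The identity, from the Lebesgue to the Borel sigma-algebra, is measurable and pushes [leb]
    forward to the Borel Lebesgue measure; the change of variables formula is applied to the
    positive and negative parts. *)
Lemma integral_leb (D : set R) (f : R -> \bar R) : measurable D -> measurable_fun D f ->
  (\int[leb R]_(x in D) f x = \int[mu]_(x in D) f x)%E.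
Proof.
move=> mD mf.
have mid : measurable_fun [set: Leb R] (idfun : Leb R -> measurableTypeR R).
  by move=> _ A mA; rewrite setTI; exact: borel_leb.
have H (h : R -> \bar R) : measurable_fun D h -> (forall x, (0 <= h x)%E) ->
    (\int[leb R]_(x in D) h x = \int[mu]_(x in D) h x)%E.
  move=> mh h0; have := @ge0_integral_pushforward _ _ _ _ R _ mid (leb R) D h mD mh.
  rewrite preimage_id => <-; last by move=> ? _.
  by apply: eq_measure_integral => A mA AD.
rewrite integralE [RHS]integralE !H//.
- exact: measurable_funeneg.
- exact: measurable_funepos.
Qed.

End leb_borel.

Lemma leb_aeS (R : realType) (P Q : R -> Prop) : (forall t, P t -> Q t) ->
  {ae leb R, forall t, P t} -> {ae leb R, forall t, Q t}.
Proof. by move=> PQ; apply: (@filterS _ _ (ae_filter_ringOfSetsType (leb R))) => t; exact: PQ. Qed.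

Lemma leb_aeS2 (R : realType) (P Q S : R -> Prop) : (forall t, P t -> Q t -> S t) ->
  {ae leb R, forall t, P t} -> {ae leb R, forall t, Q t} -> {ae leb R, forall t, S t}.
Proof. by move=> PQ; apply: (@filterS2 _ _ (ae_filter_ringOfSetsType (leb R))) => t; exact: PQ. Qed.

(** * Primitives with respect to the completed Lebesgue measure *)

Section primitive.
Variable R : realType.
Notation mu := (@lebesgue_measure R).

(** The differentiation theorem [FTC1] concerns Borel functions. It is applied to the Borel
    representative [g] of [psi], which has the same primitive [Psi]. *)
Lemma leb_primitive_derive (psi : R -> R) :
  measurable_fun (@halfline R : set (Leb R)) (psi : Leb R -> R) ->
  (forall b : R, (leb R).-integrable `[0, b]%classic (EFin \o psi)) ->
  {ae leb R, forall t : R, 0 < t ->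
    is_derive t (1 : R) (fun t => \int[leb R]_(s in `[0, t]) psi s) (psi t)}.
Proof.
move=> mpsi bpsi; have [g [mg aeg g0]] := leb_fun_borel mpsi.
pose Psi (t : R) := \int[leb R]_(s in `[0, t]) psi s.
change {ae leb R, forall t : R, 0 < t -> is_derive t (1 : R) Psi (psi t)}.
have mh b : measurable (`[0, b]%classic : set (Leb R)).
  by apply: borel_leb; exact: measurable_itv.
have mpsib b : measurable_fun (`[0, b]%classic : set (Leb R)) (psi : Leb R -> R).
  apply: measurable_funS mpsi; first by apply: borel_leb; exact: measurable_halfline.
  by move=> s /=; rewrite /halfline/= !in_itv/= andbT => /andP[].
have PsiE t : Psi t = \int[mu]_(s in `[0, t]) g s.
  rewrite /Psi /Rintegral -(@integral_leb _ _ (EFin \o g)); last 2 first.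
  - exact: measurable_itv.
  - by apply/measurable_EFinP; exact: measurable_funTS.
  congr fine; apply: ae_eq_integral; first exact: mh.
  - exact/measurable_EFinP.
  - apply/measurable_EFinP; apply: borel_leb_fun; first exact: measurable_itv.
    exact: measurable_funTS.
  - apply: leb_aeS aeg => s /= + /[!in_itv]/= /andP[s0 _].
    by move=> /(_ s0) ->.
have ig b : mu.-integrable `[0, b] (EFin \o g).
  apply/integrableP; split; first by apply/measurable_EFinP; exact: measurable_funTS.
  rewrite -integral_leb; last 2 first.
  - exact: measurable_itv.
  - by apply: measurableT_comp => //; apply/measurable_EFinP; exact: measurable_funTS.
  have /integrableP[_] := bpsi b; apply: le_lt_trans.
  apply: ge0_le_integral; first exact: mh.
  - by move=> x _; rewrite lee_fin.
  - apply: measurableT_comp => //; apply/measurable_EFinP; apply: borel_leb_fun; first exact: measurable_itv.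
    exact: measurable_funTS.
  - by apply: measurableT_comp => //; exact/measurable_EFinP.
  - by move=> t _ /=; rewrite lee_fin; case: (g0 t) => [->|[_ ->]//]; rewrite normr0.
have PsiF : (fun x => \int[mu]_(t in [set` Interval (BLeft 0) (BRight x)]) g t) = Psi.
  by apply/funext => t; rewrite PsiE.
(* Integrability of [g] on each [[0, b]] extends to all compact sets because [g] vanishes at
   negative times. *)
have gN x : x < 0 -> g x = 0.
  by move=> x0; case: (g0 x) => // -[]; rewrite leNgt x0.
have locg : locally_integrable [set: R] g.
  split; [exact: measurable_funTS | exact: openT|].
  move=> K _ cK.
  have [c [_ Kc]] := compact_bounded cK.
  have mK : measurable (K : set (measurableTypeR R)) by exact: compact_measurable.
  have mg' (D : set R) : measurable_fun (D : set (measurableTypeR R)) (fun x => `|g x|%:E).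
    by apply/measurable_EFinP; apply: measurableT_comp => //; exact: measurable_funTS.
  have /integrableP[_] := ig (c + 1); apply: le_lt_trans.
  rewrite integral_mkcond [leRHS]integral_mkcond; apply: ge0_le_integral => //.
  - by move=> x _; apply: erestrict_ge0 => y _; rewrite lee_fin.
  - exact/(measurable_restrictT _ _).1.
  - by apply/(measurable_restrictT _ _).1 => //; exact: measurable_itv.
  - move=> x _; rewrite !patchE; case: ifPn => [|_]; last by case: ifPn => // _; rewrite lee_fin.
    rewrite inE => Kx; case: ifPn => //; rewrite notin_setE => h.
    rewrite lee_fin gN ?normr0// ltNge; apply/negP => x0; apply: h.
    rewrite /= in_itv/= x0/= (le_trans (ler_norm _))//; apply: Kc => //.
    by rewrite ltrDl.
have [A [mA A0 sA]] := FTC1 ig locg.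
rewrite PsiF in sA.
have aeF : {ae leb R, forall x, 0 < x -> derivable Psi x 1 /\ Psi^`()%classic x = g x}.
  exists A; split; [exact: borel_leb|exact: A0|].
  move=> x /= h; apply: sA => /= h'; apply: h => x0; apply: h'.
  by rewrite lte_fin.
apply: leb_aeS2 aeF aeg => x + + x0 => /(_ x0) [dP dE] /(_ (ltW x0)) ->.
by apply: DeriveDef; [exact: dP | rewrite -derive1E; exact: dE].
Qed.

Lemma Rintegral_itvSB (psi : R -> R) (x y : R) : 0 <= x -> x <= y ->
  (leb R).-integrable `[0, y]%classic (EFin \o psi) ->
  \int[leb R]_(s in `[0, y]) psi s - \int[leb R]_(s in `[0, x]) psi s
    = \int[leb R]_(s in `]x, y]) psi s.
Proof.
move=> x0 xy ipsi.
have E : `[0, y]%classic = `[0, x] `|` `]x, y] :> set R.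
  by rewrite -itv_bndbnd_setU// bnd_simp.
rewrite E Rintegral_setU; first by rewrite addrAC subrr add0r.
- by apply: borel_leb; exact: measurable_itv.
- by apply: borel_leb; exact: measurable_itv.
- by rewrite -E.
- by rewrite disj_set2E; apply/eqP/seteqP; split => // t /=; rewrite !in_itv/= => -[/andP[_ tx] /andP[xt]]; rewrite ltNge tx in xt.
Qed.

Lemma leb_primitive_nondecreasing (psi : R -> R) (x y : R) :
  (leb R).-integrable `[0, y]%classic (EFin \o psi) -> (forall t, 0 <= psi t) ->
  0 <= x -> x <= y ->
  \int[leb R]_(s in `[0, x]) psi s <= \int[leb R]_(s in `[0, y]) psi s.
Proof.
by move=> ipsi p0 x0 xy; rewrite -subr_ge0 Rintegral_itvSB//; exact: Rintegral_ge0.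
Qed.

Lemma leb_integrable_bounded (psi : R -> R) (M : R) (b : R) :
  measurable_fun (@halfline R : set (Leb R)) (psi : Leb R -> R) ->
  (forall t, 0 <= t <= b -> `|psi t| <= M) ->
  (leb R).-integrable `[0, b]%classic (EFin \o psi).
Proof.
move=> mpsi psiM.
have mh : measurable (`[0, b]%classic : set (Leb R)).
  by apply: borel_leb; exact: measurable_itv.
apply: measurable_bounded_integrable => //.
- have : (mu `[0%R, b]%classic < +oo)%E.
    by rewrite lebesgue_measure_itv/=; case: ifP => // _; rewrite -EFinB ltry.
  by apply.
- apply: measurable_funS mpsi; first by apply: borel_leb; exact: measurable_halfline.
  by move=> s /=; rewrite /halfline/= !in_itv/= andbT => /andP[].
- exists M; split; first exact: num_real.
  by move=> N MN t /=; rewrite in_itv/= => ti; apply: le_trans (ltW MN); exact: psiM.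
Qed.

(** Local boundedness makes the primitive Lipschitz on each [[0, b]], which yields absolute
    continuity at once. *)
Lemma leb_primitive_bounded (psi : R -> R) :
  measurable_fun (@halfline R : set (Leb R)) (psi : Leb R -> R) ->
  (forall b : R, exists M : R, forall t : R, 0 <= t <= b -> `|psi t| <= M) ->
  acd (fun t => \int[leb R]_(s in `[0, t]) psi s) psi.
Proof.
move=> mpsi bpsi; split; last first.
  apply: leb_primitive_derive => // b; have [M HM] := bpsi b.
  exact: leb_integrable_bounded HM.
move=> b; have [M HM] := bpsi b; apply: (@ac1_lipschitz _ _ _ M) => x y x0 xy yb.
have ib : (leb R).-integrable `[0, y]%classic (EFin \o psi).
  by apply: (leb_integrable_bounded mpsi (M := M)) => t /andP[t0 ty]; apply: HM; rewrite t0 (le_trans ty).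
rewrite Rintegral_itvSB//.
have mxy : measurable (`]x, y]%classic : set (Leb R)).
  by apply: borel_leb; exact: measurable_itv.
have muxy : leb R `]x, y]%classic = (y - x)%:E.
  have : mu `]x, y]%classic = (y - x)%:E.
    rewrite lebesgue_measure_itv/= lte_fin; move: xy; rewrite le_eqVlt => /predU1P[->|->//].
    by rewrite ltxx subrr.
  by apply.
have igxy : (leb R).-integrable `]x, y]%classic (EFin \o psi).
  apply: integrableS ib => //; first by apply: borel_leb; exact: measurable_itv.
  by move=> t /=; rewrite !in_itv/= => /andP[xt ->]; rewrite (le_trans x0 (ltW xt)).
apply: (@le_trans _ _ (\int[leb R]_(s in `]x, y]) `|psi s|)).
  exact: le_normr_Rintegral.
apply: (@le_trans _ _ (\int[leb R]_(s in `]x, y]) M)).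
  apply: le_Rintegral => //.
  - exact: integrable_norm.
  - apply: measurable_bounded_integrable; [exact: mxy| |exact: measurable_cst|].
      by have := ltry (y - x); rewrite -muxy; apply.
    exists `|M|; split; first exact: num_real.
    by move=> N MN t _ /=; exact: ltW.
  - move=> s /=; rewrite in_itv/= => /andP[xs sy]; apply: HM.
    by rewrite (le_trans x0 (ltW xs)) (le_trans sy).
rewrite Rintegral_cst; last exact: mxy.
rewrite [fine _](_ : _ = y - x); first exact: lexx.
by rewrite -[RHS]/(fine (y - x)%:E) -muxy.
Qed.

End primitive.

(** * Calculus of almost everywhere derivatives *)

Section acd_theory.
Variable R : realType.
Implicit Types u v w : R -> R.

Lemma acd_ae v w w' : {ae leb R, forall t : R, 0 < t -> w t = w' t} -> acd v w -> acd v w'.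
Proof.
move=> ww' [cv dv]; split => //; apply: leb_aeS2 ww' dv => t + + t0.
by move=> /(_ t0) <- /(_ t0).
Qed.

Lemma acd_eqr v w w' : (forall t, 0 < t -> w t = w' t) -> acd v w -> acd v w'.
Proof. by move=> h; apply: acd_ae; exact: aeW. Qed.

Lemma acd_eql v v' w : (forall t, 0 <= t -> v t = v' t) -> acd v w -> acd v' w.
Proof.
move=> vv' [cv dv]; split.
  move=> b e e0; have [d d0 H] := cv b e e0; exists d => // s sb sp sd.
  apply: le_lt_trans (H s sb sp sd); rewrite !big_seq; apply: ler_sum => I Is.
  have /andP[/andP[I0 I12] Ib] := allP sb _ Is.
  by rewrite !vv'// (le_trans I0).
apply: leb_aeS dv => t + t0 => /(_ t0) dvt.
apply: near_eq_is_derive dvt.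
near=> x; apply: vv'; apply/ltW; near: x.
exact: lt_nbhsr.
Unshelve. all: by end_near. Qed.

Lemma acd_cst (c : R) : acd (fun=> c) (fun=> 0).
Proof. by split => [b|]; [exact: ac1_cst | apply: aeW => t _; exact: is_derive_cst]. Qed.

Lemma acdD v v' w w' : acd v v' -> acd w w' ->
  acd (fun t => v t + w t) (fun t => v' t + w' t).
Proof.
move=> [cv dv] [cw dw]; split; first by move=> b; exact: ac1D.
by apply: leb_aeS2 dv dw => t + + t0 => /(_ t0) ? /(_ t0) ?; exact: is_deriveD.
Qed.

Lemma acdM v v' w w' : acd v v' -> acd w w' ->
  acd (fun t => v t * w t) (fun t => v' t * w t + v t * w' t).
Proof.
move=> [cv dv] [cw dw]; split; first by move=> b; exact: ac1M.
apply: leb_aeS2 dv dw => t + + t0 => /(_ t0) ? /(_ t0) ?.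
apply: is_derive_eq; rewrite /GRing.scale/= addrC; congr (_ + _).
by rewrite mulrC.
Qed.

Lemma acdZ (c : R) v v' : acd v v' -> acd (fun t => c * v t) (fun t => c * v' t).
Proof.
move=> dv; apply: acd_eqr (acdM (acd_cst c) dv) => t _.
by rewrite mul0r add0r.
Qed.

Lemma acdN v v' : acd v v' -> acd (fun t => - v t) (fun t => - v' t).
Proof.
move=> dv; have := acdZ (-1) dv.
by under eq_fun do rewrite mulN1r; under [X in acd _ X]eq_fun do rewrite mulN1r.
Qed.

Lemma acdB v v' w w' : acd v v' -> acd w w' ->
  acd (fun t => v t - w t) (fun t => v' t - w' t).
Proof. by move=> dv dw; apply: acdD => //; exact: acdN. Qed.

Lemma acd_sum (I : Type) (r : seq I) (v v' : I -> R -> R) :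
  (forall i, acd (v i) (v' i)) ->
  acd (fun t => \sum_(i <- r) v i t) (fun t => \sum_(i <- r) v' i t).
Proof.
move=> dv; elim: r => [|i r IHr].
  by under eq_fun do rewrite big_nil; under [X in acd _ X]eq_fun do rewrite big_nil; exact: acd_cst.
under eq_fun do rewrite big_cons; under [X in acd _ X]eq_fun do rewrite big_cons.
exact: acdD.
Qed.

Lemma continuous_itv_bounded (w : R -> R) (b : R) : continuous w ->
  exists M : R, forall t, 0 <= t <= b -> `|w t| <= M.
Proof.
move=> cw.
have cK : compact (w @` `[0, b]).
  apply: continuous_compact; last exact: segment_compact.
  exact: continuous_subspaceT.
have [M [_ HM]] := compact_bounded cK.
exists (M + 1) => t tb; apply: (HM (M + 1)); first by rewrite ltrDl.
by exists t => //=; rewrite in_itv.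
Qed.

Lemma acd_C1 v w : (forall t, is_derive t (1 : R) v (w t)) -> continuous w -> acd v w.
Proof.
move=> dv cw; split; last by apply: aeW => t _; exact: dv.
move=> b; have [M HM] := continuous_itv_bounded b cw.
apply: (@ac1_lipschitz _ _ _ M) => x y x0 xy yb.
have [|c] := @MVT_segment R v w x y xy (fun x _ => dv x).
  by apply: derivable_within_continuous => z _; have [] := dv z.
rewrite in_itv/= => /andP[xc cy] ->; rewrite normrM (ger0_norm (_ : 0 <= y - x)) ?subr_ge0//.
by rewrite ler_wpM2r ?subr_ge0// HM// (le_trans x0 xc) (le_trans cy yb).
Qed.

Lemma acd_measurable v w : acd v w ->
  measurable_fun (@halfline R : set (Leb R)) (v : Leb R -> R).
Proof.
move=> [cv _]; apply: borel_leb_fun; first exact: measurable_halfline.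
apply: subspace_continuous_measurable_fun; first exact: measurable_halfline.
apply/continuous_within_itvcyP; split; last first.
  apply/cvgrPdist_lt => e e0.
  have h01 : 0 <= (0 : R) <= 1 by rewrite lexx ler01.
  have [d d0 H] := ac1_continuous (cv 1) h01 e0.
  near=> y; rewrite distrC; apply: H.
    by apply/andP; split; apply: ltW; near: y; [exact: nbhs_right_gt | exact: nbhs_right_lt].
  rewrite subr0 gtr0_norm//; near: y; exact: nbhs_right_lt.
move=> x; rewrite in_itv/= andbT => x0.
apply/cvgrPdist_lt => e e0.
have hx : 0 <= x <= x + 1 by rewrite (ltW x0)/= lerDl.
have [d d0 H] := ac1_continuous (cv _) hx e0.
near=> y; rewrite distrC; apply: H.
  by apply/andP; split; apply: ltW; near: y; [exact: lt_nbhsr | apply: lt_nbhsl; rewrite ltrDl].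
by near: y; exists d => // z /=; rewrite distrC.
Unshelve. all: by end_near. Qed.

End acd_theory.

(** * Almost everywhere derivatives of matrix-valued functions *)

Definition acdmx (R : realType) (m n : nat) (X X' : R -> 'M[R]_(m, n)) : Prop :=
  forall i j, acd (fun t => X t i j) (fun t => X' t i j).

Section acdmx_theory.
Variable R : realType.

Lemma acdmx_cst m n (C : 'M[R]_(m, n)) : acdmx (fun=> C) (fun=> 0).
Proof. by move=> i j; under [X in acd _ X]eq_fun do rewrite mxE; exact: acd_cst. Qed.

Lemma acdmxD m n (X X' Y Y' : R -> 'M[R]_(m, n)) : acdmx X X' -> acdmx Y Y' ->
  acdmx (fun t => X t + Y t) (fun t => X' t + Y' t).
Proof.
move=> dX dY i j; under eq_fun do rewrite mxE; under [X in acd _ X]eq_fun do rewrite mxE.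
exact: acdD.
Qed.

Lemma acdmxM m n p (X X' : R -> 'M[R]_(m, n)) (Y Y' : R -> 'M[R]_(n, p)) :
  acdmx X X' -> acdmx Y Y' ->
  acdmx (fun t => X t *m Y t) (fun t => X' t *m Y t + X t *m Y' t).
Proof.
move=> dX dY i j; under eq_fun do rewrite mxE.
under [X in acd _ X]eq_fun do rewrite !mxE -big_split/=.
by apply: acd_sum => k; exact: acdM.
Qed.

Lemma acdmx_mull m n p (C : 'M[R]_(m, n)) (Y Y' : R -> 'M[R]_(n, p)) :
  acdmx Y Y' -> acdmx (fun t => C *m Y t) (fun t => C *m Y' t).
Proof.
move=> dY; have := acdmxM (acdmx_cst C) dY.
by under [X in acdmx _ X]eq_fun do rewrite mul0mx add0r.
Qed.

Lemma acdmx_tr m n (X X' : R -> 'M[R]_(m, n)) : acdmx X X' ->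
  acdmx (fun t => (X t)^T) (fun t => (X' t)^T).
Proof.
by move=> dX i j; under eq_fun do rewrite mxE; under [X in acd _ X]eq_fun do rewrite mxE.
Qed.

Lemma acdmx_eqr m n (X X' X'' : R -> 'M[R]_(m, n)) : (forall t, 0 < t -> X' t = X'' t) ->
  acdmx X X' -> acdmx X X''.
Proof. by move=> h dX i j; apply: acd_eqr (dX i j) => t t0; rewrite h. Qed.

Lemma acdmx_eql m n (X Y X' : R -> 'M[R]_(m, n)) : (forall t, 0 <= t -> X t = Y t) ->
  acdmx X X' -> acdmx Y X'.
Proof. by move=> h dX i j; apply: acd_eql (dX i j) => t t0; rewrite h. Qed.

Lemma leb_ae_forall (I : finType) (P : I -> R -> Prop) :
  (forall i, {ae leb R, forall t, P i t}) -> {ae leb R, forall t, forall i, P i t}.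
Proof.
move=> h; apply: (@filter_forall _ _ _ _ (ae_filter_ringOfSetsType (leb R))).
exact: h.
Qed.

Lemma is_derive_mxP m n (X : R -> 'M[R]_(m, n)) (t : R) (D : 'M[R]_(m, n)) :
  is_derive t (1 : R) X D <-> forall i j, is_derive t (1 : R) (fun t => X t i j) (D i j).
Proof.
split=> [[dX DE] i j|h].
  apply: DeriveDef; first exact: (derivable_mxP X t 1).1.
  by have := derive_mx dX; rewrite DE => ->; rewrite mxE.
have dX : derivable X t 1 by apply/derivable_mxP => i j; have [] := h i j.
apply: DeriveDef => //; rewrite derive_mx//; apply/matrixP => i j; rewrite mxE.
by have [_ ->] := h i j.
Qed.

End acdmx_theory.

Lemma cvg_sumr (R : realType) (I T : Type) (r : seq I) (F : set_system T) (f : I -> T -> R)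
    (l : I -> R) : Filter F -> (forall i, f i x @[x --> F] --> l i) ->
  \sum_(i <- r) f i x @[x --> F] --> \sum_(i <- r) l i.
Proof.
move=> FF h; elim: r => [|i r IHr].
  by under eq_fun do rewrite big_nil; rewrite big_nil; exact: cvg_cst.
by under eq_fun do rewrite big_cons; rewrite big_cons; exact: cvgD.
Qed.

(** * The matrix exponential *)

Section expmx_theory.
Variables (R : realType) (n : nat).
Implicit Types M : 'M[R]_n.

Lemma cvg_mx_coord (u : nat -> 'M[R]_n) (l : 'M[R]_n) :
  (forall i j, u k i j @[k --> \oo] --> l i j) -> u @ \oo --> l.
Proof.
move=> h; apply/cvg_mx_entourageP => A entA.
have hf i j : \forall k \near \oo, (l i j, u k i j) \in A.
  have /cvg_entourageP := h i j => /(_ A entA).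
  by move=> H; near=> k; rewrite inE; near: k; exact: H.
by apply: filter_forall => i; apply: filter_forall => j; exact: hf.
Unshelve. all: by end_near. Qed.

Lemma normr_expmx_entry M k i j : `|(M ^+ k) i j| <= (1 + \sum_i \sum_j `|M i j|) ^+ k.
Proof.
set B := 1 + _.
have B1 : 1 <= B by rewrite lerDl; apply: sumr_ge0 => a _; exact: sumr_ge0.
elim: k i j => [|k IHk] i j.
  rewrite !expr0 [_ i j](_ : _ = (1%:M : 'M[R]_n) i j)// mxE.
  by case: (i == j); rewrite ?normr1 ?normr0.
rewrite !exprS [_ i j](_ : _ = (M *m M ^+ k) i j)// mxE.
apply: le_trans (ler_norm_sum _ _ _) _.
apply: (@le_trans _ _ (\sum_l `|M i l| * B ^+ k)).
  by apply: ler_sum => l _; rewrite normrM ler_wpM2l.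
rewrite -mulr_suml ler_wpM2r ?exprn_ge0 ?(le_trans ler01)//.
rewrite /B [X in 1 + X](bigD1 i)//= addrCA lerDl addr_ge0//.
by apply: sumr_ge0 => a _; exact: sumr_ge0.
Qed.

(** Taylor coefficients at 0 of the entry [(i, j)] of [M ^+ a] times the exponential of [t M]. The
    shift [a] is there because termwise differentiation raises it by one. *)
Definition expc M a i j (k : nat) : R := k`!%:R^-1 * (M ^+ (k + a)) i j.

Lemma cvg_pseries_expc M a i j (x : R) : cvgn (pseries (expc M a i j) x).
Proof.
apply: normed_cvg => /=.
set B := 1 + \sum_i \sum_j `|M i j|.
have B0 : 0 <= B by apply: addr_ge0 => //; apply: sumr_ge0 => b _; exact: sumr_ge0.
apply: (@series_le_cvg _ _ (fun k => B ^+ a * exp_coeff (B * `|x|) k)) => //.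
- by move=> k; exact: normr_ge0.
- by move=> k; rewrite mulr_ge0 ?exprn_ge0// exp_coeff_ge0// mulr_ge0.
- move=> k; rewrite /= /expc !normrM normrX ger0_norm ?invr_ge0//.
  rewrite /exp_coeff/= exprMn.
  have -> : B ^+ a * (B ^+ k * `|x| ^+ k / k`!%:R) = k`!%:R^-1 * B ^+ (k + a) * `|x| ^+ k.
    by rewrite exprD; ring.
  apply: ler_wpM2r; first exact: exprn_ge0.
  by apply: ler_wpM2l; [rewrite invr_ge0 | exact: normr_expmx_entry].
- exact/is_cvg_seriesZ/is_cvg_series_exp_coeff.
Qed.

Lemma pseries_diffs_expc M a i j : pseries_diffs (expc M a i j) = expc M a.+1 i j.
Proof.
apply/funext => k; rewrite /pseries_diffs /expc factS natrM invfM mulrA mulVKf// ?addSnnS//.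
Qed.

Lemma exprZmx M (t : R) k : (t *: M) ^+ k = t ^+ k *: M ^+ k.
Proof.
elim: k => [|k IHk]; first by rewrite !expr0 scale1r.
rewrite !exprS IHk.
change ((t *: M) *m (t ^+ k *: M ^+ k) = (t * t ^+ k) *: (M *m M ^+ k)).
by rewrite -scalemxAl -scalemxAr scalerA.
Qed.

Lemma expmxE M (t : R) i j : expmx (t *: M) i j = limn (pseries (expc M 0 i j) t).
Proof.
suff H : series (fun k : nat => k`!%:R^-1 *: (t *: M) ^+ k) @ \oo -->
    (\matrix_(i, j) limn (pseries (expc M 0 i j) t) : 'M[R]_n).
  by rewrite /expmx (cvg_lim _ H)// mxE.
apply: cvg_mx_coord => {}i {}j; rewrite mxE.
have := @cvg_pseries_expc M 0 i j t; apply: cvg_trans.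
apply: near_eq_cvg; apply: nearW => N.
rewrite /pseries /series/= summxE; apply: eq_bigr => k _.
by rewrite mxE exprZmx mxE /expc addn0 mulrA mulrAC.
Qed.

Lemma pseries_expcMl M i j (t : R) :
  limn (pseries (expc M 1 i j) t) = (M *m expmx (t *: M)) i j.
Proof.
rewrite mxE; apply/cvg_lim => //.
rewrite [X in X @ _ --> _](_ : _ = (fun N => \sum_l M i l * pseries (expc M 0 l j) t N)).
  apply: cvg_sumr => l; apply: cvgM; [exact: cvg_cst | rewrite expmxE].
  exact: cvg_pseries_expc.
apply/funext => N; rewrite /pseries /series/=.
under [RHS]eq_bigr do rewrite mulr_sumr.
rewrite exchange_big/=; apply: eq_bigr => k _.
rewrite /expc addn1 addn0 exprS [(M * _) i j]mxE mulr_sumr mulr_suml.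
by apply: eq_bigr => l _; ring.
Qed.

Lemma pseries_expcMr M i j (t : R) :
  limn (pseries (expc M 1 i j) t) = (expmx (t *: M) *m M) i j.
Proof.
rewrite mxE; apply/cvg_lim => //.
rewrite [X in X @ _ --> _](_ : _ = (fun N => \sum_l pseries (expc M 0 i l) t N * M l j)).
  apply: cvg_sumr => l; apply: cvgM; [rewrite expmxE | exact: cvg_cst].
  exact: cvg_pseries_expc.
apply/funext => N; rewrite /pseries /series/=.
under [RHS]eq_bigr do rewrite mulr_suml.
rewrite exchange_big/=; apply: eq_bigr => k _.
rewrite /expc addn1 addn0 exprSr [(_ * M) i j]mxE mulr_sumr mulr_suml.
by apply: eq_bigr => l _; ring.
Qed.

Lemma is_derive_expmx M (t : R) i j :
  is_derive t (1 : R) (fun t => expmx (t *: M) i j) ((M *m expmx (t *: M)) i j).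
Proof.
under eq_fun do rewrite expmxE.
rewrite -pseries_expcMl -pseries_diffs_expc.
apply: (@pseries_snd_diffs _ _ (`|t| + 1)).
- exact: cvg_pseries_expc.
- by rewrite pseries_diffs_expc; exact: cvg_pseries_expc.
- by rewrite !pseries_diffs_expc; exact: cvg_pseries_expc.
- by rewrite [ltRHS]ger0_norm ?addr_ge0// ltrDl.
Qed.

Lemma expmx_comm M (t : R) : M *m expmx (t *: M) = expmx (t *: M) *m M.
Proof. by apply/matrixP => i j; rewrite -pseries_expcMl pseries_expcMr. Qed.

Lemma expmx0 : expmx 0 = 1%:M :> 'M[R]_n.
Proof.
apply/matrixP => i j; rewrite -(scale0r 1%:M) expmxE mxE; apply/cvg_lim => //.
apply: cvg_near_cst; near=> N.
rewrite /pseries /series/= -(@prednK N); last by near: N; exact: nbhs_infty_gt.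
rewrite big_nat_recl// big1 ?addr0.
  by rewrite /expc fact0 invr1 !expr0 mul1r mulr1 [LHS](_ : _ = (1%:M : 'M[R]_n) i j)// mxE.
by move=> k _; rewrite expr0n mulr0.
Unshelve. all: by end_near. Qed.

Lemma continuous_expmx M i j : continuous (fun t : R => expmx (t *: M) i j).
Proof.
move=> t; apply/differentiable_continuous/derivable1_diffP.
by have [] := is_derive_expmx M t i j.
Qed.

Lemma continuous_mulmx_expmx m p (C1 : 'M[R]_(m, n)) (C2 : 'M[R]_(n, p)) M i j :
  continuous (fun t : R => (C1 *m expmx (t *: M) *m C2) i j).
Proof.
move=> t; rewrite /continuous_at mxE; under eq_fun do rewrite mxE.
apply: cvg_sumr => l; apply: cvgM; last exact: cvg_cst.
rewrite mxE; under eq_fun do rewrite mxE.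
by apply: cvg_sumr => k; apply: cvgM; [exact: cvg_cst | exact: continuous_expmx].
Qed.

(** The product in [key] has zero derivative in [s], by commutation of [M] with its exponential, so
    it equals its value at [s = 0]. With [d = 0] this gives inverses, with [d = c] the addition
    formula. *)
Lemma expmxD M (t c : R) : expmx ((t + c) *: M) = expmx (t *: M) *m expmx (c *: M).
Proof.
have key (s d : R) : expmx (- s *: M) *m expmx ((s + d) *: M) = expmx (d *: M).
  apply/matrixP => i j.
  rewrite [RHS](_ : _ = (expmx (- 0 *: M) *m expmx ((0 + d) *: M)) i j); last first.
    by rewrite oppr0 scale0r expmx0 mul1mx add0r.
  apply: (@is_derive_0_is_cst _ (fun s => (expmx (- s *: M) *m expmx ((s + d) *: M)) i j)).
  move=> {}s; under eq_fun do rewrite mxE.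
  have D1 k l : is_derive s (1 : R) (fun s => expmx (- s *: M) k l) (- (M *m expmx (- s *: M)) k l).
    have := @is_derive1_comp R (fun t => expmx (t *: M) k l) -%R s _ _ (is_derive_expmx M (- s) k l) (is_deriveNid s 1).
    by rewrite mulrN1.
  have D2 k l : is_derive s (1 : R) (fun s => expmx ((s + d) *: M) k l) ((M *m expmx ((s + d) *: M)) k l).
    have dd : is_derive s (1 : R) (fun s : R => s + d) 1.
      by apply: is_derive_eq; rewrite addr0.
    have := @is_derive1_comp R (fun t => expmx (t *: M) k l) (fun s : R => s + d) s _ _ (is_derive_expmx M (s + d) k l) dd.
    by rewrite mulr1.
  have D : is_derive s (1 : R) (\sum_l (fun s => expmx (- s *: M) i l * expmx ((s + d) *: M) l j))
      (\sum_l (expmx (- s *: M) i l *: (M *m expmx ((s + d) *: M)) l j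
      + expmx ((s + d) *: M) l j *: (- (M *m expmx (- s *: M)) i l))).
    by apply: is_derive_sum => l; exact: is_deriveM.
  have EF : \sum_l (fun s => expmx (- s *: M) i l * expmx ((s + d) *: M) l j)
      = (fun s => \sum_l expmx (- s *: M) i l * expmx ((s + d) *: M) l j).
    by apply/funext => u; rewrite fct_sumE.
  rewrite EF in D; apply: is_derive_eq D _.
  rewrite big_split/= /GRing.scale/=.
  have HA : (expmx (- s *: M) *m (M *m expmx ((s + d) *: M))) i j
      = \sum_l expmx (- s *: M) i l * (M *m expmx ((s + d) *: M)) l j by rewrite mxE.
  have HB : ((M *m expmx (- s *: M)) *m expmx ((s + d) *: M)) i j
      = \sum_l (M *m expmx (- s *: M)) i l * expmx ((s + d) *: M) l j by rewrite mxE.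
  rewrite -HA; under eq_bigr do rewrite mulrN mulrC; rewrite sumrN -HB.
  by rewrite (expmx_comm M (- s)) mulmxA subrr.
have e0 : expmx (- (- t) *: M) *m expmx (- t *: M) = 1%:M.
  have := key (- t) 0; rewrite addr0 => ->; rewrite scale0r; exact: expmx0.
by rewrite opprK in e0; rewrite -(key t c) mulmxA e0 mul1mx.
Qed.

Lemma expmxNK M (t : R) : expmx (t *: M) *m expmx (- t *: M) = 1%:M.
Proof. by rewrite -expmxD subrr scale0r expmx0. Qed.

Lemma acdmx_expmx M : acdmx (fun t => expmx (t *: M)) (fun t => M *m expmx (t *: M)).
Proof.
move=> i j; apply: acd_C1 => [t|]; first exact: is_derive_expmx.
have := @continuous_mulmx_expmx _ _ M 1%:M M i j.
by under eq_fun do rewrite mulmx1.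
Qed.

Lemma acdmx_expmxN M : acdmx (fun t => expmx (- t *: M)) (fun t => - (M *m expmx (- t *: M))).
Proof.
move=> i j; apply: acd_C1 => [t|].
  have := @is_derive1_comp R (fun t => expmx (t *: M) i j) -%R t _ _ (is_derive_expmx M (- t) i j) (is_deriveNid t 1).
  by rewrite mulrN1 => h; rewrite [X in is_derive _ _ _ X]mxE.
have -> : (fun t : R => (- (M *m expmx (- t *: M))) i j) = (fun t : R => - (M *m expmx (- t *: M)) i j).
  by apply/funext => u; rewrite [LHS]mxE.
have h := @continuous_mulmx_expmx _ _ M 1%:M M i j.
have c : continuous ((fun x : R => - (M *m expmx (x *: M)) i j) \o -%R).
  move=> u; apply: continuous_comp; first exact: opp_continuous.
  apply: continuousN; have := h (- u).
  by under eq_fun do rewrite mulmx1.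
exact: c.
Qed.

End expmx_theory.

(** * Euclidean norm, quadratic forms and definite matrices *)

Section enorm_theory.
Variable R : realType.

Definition dot (n : nat) (x y : 'cV[R]_n) : R := (x^T *m y) 0 0.

Lemma dotE n (x y : 'cV[R]_n) : dot x y = \sum_i x i 0 * y i 0.
Proof. by rewrite /dot mxE; apply: eq_bigr => i _; rewrite mxE. Qed.

Lemma dotC n (x y : 'cV[R]_n) : dot x y = dot y x.
Proof. by rewrite !dotE; apply: eq_bigr => i _; rewrite mulrC. Qed.

Lemma dotDl n (x y z : 'cV[R]_n) : dot (x + y) z = dot x z + dot y z.
Proof. by rewrite /dot raddfD/= mulmxDl mxE. Qed.

Lemma dotDr n (x y z : 'cV[R]_n) : dot z (x + y) = dot z x + dot z y.
Proof. by rewrite /dot mulmxDr mxE. Qed.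

Lemma dotNl n (x y : 'cV[R]_n) : dot (- x) y = - dot x y.
Proof. by rewrite /dot raddfN/= mulNmx mxE. Qed.

Lemma dotNr n (x y : 'cV[R]_n) : dot x (- y) = - dot x y.
Proof. by rewrite /dot mulmxN mxE. Qed.

Lemma dotZl n a (x y : 'cV[R]_n) : dot (a *: x) y = a * dot x y.
Proof. by rewrite /dot linearZ/= -scalemxAl mxE. Qed.

Lemma dotZr n a (x y : 'cV[R]_n) : dot x (a *: y) = a * dot x y.
Proof. by rewrite /dot -scalemxAr mxE. Qed.

Lemma dot_mull m n (A : 'M[R]_(m, n)) x y : dot (A *m x) y = dot x (A^T *m y).
Proof. by rewrite /dot trmx_mul mulmxA. Qed.

Lemma quadE n (Q : 'M[R]_n) x : quad Q x = dot x (Q *m x).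
Proof. by rewrite /quad /dot mulmxA. Qed.

Lemma quadD n (P Q : 'M[R]_n) x : quad (P + Q) x = quad P x + quad Q x.
Proof. by rewrite !quadE mulmxDl dotDr. Qed.

Lemma quadZ n a (Q : 'M[R]_n) x : quad (a *: Q) x = a * quad Q x.
Proof. by rewrite !quadE -scalemxAl dotZr. Qed.

Lemma enorm_ge0 n (x : 'cV[R]_n) : 0 <= enorm x.
Proof. exact: sqrtr_ge0. Qed.

Lemma sqr_enorm n (x : 'cV[R]_n) : enorm x ^+ 2 = dot x x.
Proof.
rewrite /enorm sqr_sqrtr ?dotE; first by apply: eq_bigr => i _; rewrite expr2.
by apply: sumr_ge0 => i _; exact: sqr_ge0.
Qed.

Lemma dot_ge0 n (x : 'cV[R]_n) : 0 <= dot x x.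
Proof. by rewrite -sqr_enorm exprn_ge0// enorm_ge0. Qed.

Lemma dot_eq0 n (x : 'cV[R]_n) : dot x x = 0 -> x = 0.
Proof.
move=> h; apply/colP => i; rewrite mxE; apply/eqP; rewrite -sqrf_eq0; apply/eqP.
move: h; rewrite dotE; move/psumr_eq0P => H; rewrite expr2; apply: H => // j _.
by rewrite -expr2 sqr_ge0.
Qed.

(* The discriminant of the nonnegative quadratic [t |-> quad S (x + t y)]. *)
Lemma psd_cauchy_schwarz n (S : 'M[R]_n) x y : psd_mx S ->
  dot x (S *m y) ^+ 2 <= quad S x * quad S y.
Proof.
move=> [symS S0].
have E (t : R) : quad S (x + t *: y) = quad S x + 2 * t * dot x (S *m y) + t ^+ 2 * quad S y.
  rewrite !quadE mulmxDr -scalemxAr !dotDr !dotDl !dotZr !dotZl.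
  rewrite (_ : dot y (S *m x) = dot x (S *m y)); last by rewrite dotC dot_mull symS.
  by ring.
have H t : 0 <= quad S x + 2 * t * dot x (S *m y) + t ^+ 2 * quad S y.
  by rewrite -E; exact: S0.
move: H; set a := quad S x; set b := dot _ _; set c := quad S y => H.
have a0 : 0 <= a by exact: S0.
have c0 : 0 <= c by exact: S0.
have [c00|cn0] := eqVneq c 0.
  rewrite c00 mulr0; have [->|b0] := eqVneq b 0; first by rewrite expr0n.
  (* When [c = 0] the polynomial is affine in [t]; this [t] gives it the value -1. *)
  have := H (- (a + 1) / (2 * b)); rewrite c00 mulr0 addr0.
  rewrite (_ : 2 * (- (a + 1) / (2 * b)) * b = - (a + 1)); last by field; rewrite b0.
  by rewrite opprD addrA subrr sub0r ler0N1.
have cp : 0 < c by rewrite lt_def cn0.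
have := H (- b / c).
rewrite (_ : _ + _ = (a * c - b ^+ 2) / c); last by field.
by rewrite pmulr_lge0 ?invr_gt0// subr_ge0.
Qed.

Lemma psd_mx1 n : psd_mx (1%:M : 'M[R]_n).
Proof.
split; first by rewrite /symmetric_mx trmx1.
by move=> x; rewrite quadE mul1mx dot_ge0.
Qed.

Lemma dot_le n (x y : 'cV[R]_n) : `|dot x y| <= enorm x * enorm y.
Proof.
rewrite -ler_sqr ?nnegrE ?mulr_ge0 ?enorm_ge0// real_normK ?num_real// exprMn !sqr_enorm.
by have := psd_cauchy_schwarz x y (psd_mx1 n); rewrite !quadE !mul1mx.
Qed.

Lemma enormD n (x y : 'cV[R]_n) : enorm (x + y) <= enorm x + enorm y.
Proof.
rewrite -ler_sqr ?nnegrE ?addr_ge0 ?enorm_ge0// sqrrD !sqr_enorm dotDl !dotDr.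
rewrite (dotC y x); have := le_trans (ler_norm _) (dot_le x y); lra.
Qed.

Lemma enormZ n a (x : 'cV[R]_n) : enorm (a *: x) = `|a| * enorm x.
Proof.
apply: (@pexpIrn _ 2) => //; rewrite ?nnegrE ?mulr_ge0 ?enorm_ge0//.
by rewrite exprMn !sqr_enorm dotZl dotZr real_normK ?num_real// mulrA expr2.
Qed.

Lemma enormN n (x : 'cV[R]_n) : enorm (- x) = enorm x.
Proof. by rewrite -scaleN1r enormZ normrN1 mul1r. Qed.

Lemma normr_coord_le_enorm n (x : 'cV[R]_n) i : `|x i 0| <= enorm x.
Proof.
rewrite -ler_sqr ?nnegrE ?enorm_ge0// real_normK ?num_real// sqr_enorm dotE.
by rewrite (bigD1 i)//= -expr2 lerDl; apply: sumr_ge0 => j _; rewrite -expr2 sqr_ge0.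
Qed.

Lemma enorm_le_sum n (x : 'cV[R]_n) : enorm x <= \sum_i `|x i 0|.
Proof.
rewrite -ler_sqr ?nnegrE ?enorm_ge0 ?sumr_ge0// sqr_enorm dotE expr2 mulr_suml.
apply: ler_sum => i _; rewrite -expr2 -real_normK ?num_real// expr2 ler_wpM2l//.
by rewrite (bigD1 i)//= lerDl sumr_ge0.
Qed.

Lemma enorm_mulmx m n (A : 'M[R]_(m, n)) :
  exists2 K : R, 0 <= K & forall x, enorm (A *m x) <= K * enorm x.
Proof.
exists (\sum_i \sum_j `|A i j|); first by apply: sumr_ge0 => i _; exact: sumr_ge0.
move=> x; apply: le_trans (enorm_le_sum _) _.
rewrite mulr_suml; apply: ler_sum => i _; rewrite mxE mulr_suml.
apply: le_trans (ler_norm_sum _ _ _) _; apply: ler_sum => j _.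
by rewrite normrM ler_wpM2l// normr_coord_le_enorm.
Qed.

Lemma dot_mulmx_le m n (A : 'M[R]_(m, n)) :
  exists2 K : R, 0 <= K & forall x y, `|dot x (A *m y)| <= K * (enorm x * enorm y).
Proof.
have [K K0 AK] := enorm_mulmx A; exists K => // x y.
by apply: le_trans (dot_le _ _) _; rewrite mulrCA ler_wpM2l ?enorm_ge0.
Qed.

(** Cauchy-Schwarz for the form [S] between [S y] and [y] bounds [|S y|^4] by [quad S (S y)] times
    [quad S y], and the first factor is at most [K |S y|^2]. *)
Lemma psd_enorm_le n (S : 'M[R]_n) : psd_mx S ->
  exists2 K : R, 0 <= K & forall y, enorm (S *m y) ^+ 2 <= K * quad S y.
Proof.
move=> psdS; have [K K0 SK] := dot_mulmx_le S; exists K => // y.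
have qy : 0 <= quad S y by exact: psdS.2.
have := psd_cauchy_schwarz (S *m y) y psdS; rewrite -sqr_enorm.
have := le_trans (ler_norm _) (SK (S *m y) (S *m y)); rewrite -quadE -expr2.
set e := enorm _ ^+ 2; have e0 : 0 <= e by exact: sqr_ge0.
move=> qS h; have [->|en0] := eqVneq e 0; first by rewrite mulr_ge0.
rewrite -(ler_pM2l (_ : 0 < e)); last by rewrite lt_def en0.
rewrite -expr2; apply: le_trans h _.
by rewrite mulrA (mulrC e) ler_wpM2r.
Qed.

Lemma pd_unitmx n (P : 'M[R]_n) : pd_mx P -> P \in unitmx.
Proof.
move=> [symP P0]; rewrite -row_free_unit -kermx_eq0.
apply/rowV0P => v /sub_kermxP vP0; apply/eqP; apply: contraT => v0.
have := P0 v^T; rewrite -trmx0 (inj_eq trmx_inj) v0 => /(_ isT).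
by rewrite /quad trmxK vP0 mul0mx mxE ltxx.
Qed.

Lemma pd_psd n (P : 'M[R]_n) : pd_mx P -> psd_mx P.
Proof.
move=> [symP P0]; split => // x; have [->|x0] := eqVneq x 0; last exact/ltW/P0.
by rewrite quadE mulmx0 /dot mulmx0 mxE.
Qed.

(** No compactness of the sphere: Cauchy-Schwarz for [P] between [x] and [P^-1 x] bounds [|x|^4] by
    [quad P x] times [quad P (P^-1 x)], and the latter is at most [K |x|^2]. *)
Lemma pd_coercive n (P : 'M[R]_n) : pd_mx P ->
  exists2 c : R, 0 < c & forall x, c * enorm x ^+ 2 <= quad P x.
Proof.
move=> pdP; have uP := pd_unitmx pdP; have psdP := pd_psd pdP.
have [K K0 PK] := dot_mulmx_le (invmx P).
exists (K + 1)^-1; first by rewrite invr_gt0 ltr_wpDl.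
move=> x; have := psd_cauchy_schwarz x (invmx P *m x) psdP.
rewrite mulKVmx// -sqr_enorm => h.
have q0 : 0 <= quad P x by exact: psdP.2.
have q1 : quad P (invmx P *m x) <= K * enorm x ^+ 2.
  rewrite quadE mulKVmx// dotC expr2; exact: le_trans (ler_norm _) (PK _ _).
rewrite mulrC ler_pdivrMr ?ltr_wpDl//.
set e := enorm x ^+ 2 in h q1 *; have e0 : 0 <= e by exact: sqr_ge0.
have [->|en0] := eqVneq e 0; first by rewrite mulr_ge0// addr_ge0.
rewrite -(ler_pM2l (_ : 0 < e)); last by rewrite lt_def en0.
rewrite -expr2; apply: le_trans h _.
rewrite mulrCA ler_wpM2l//; apply: le_trans q1 _.
by rewrite mulrC ler_wpM2l// lerDl.
Qed.

End enorm_theory.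

(** * Lyapunov functions *)

Section lyapunov.
Variable R : realType.
Local Notation C := R[i].
Local Notation Re := (@complex.Re R).
Local Notation Im := (@complex.Im R).

Lemma Re_mulmx m n p (A : 'M[C]_(m, n)) (B : 'M[C]_(n, p)) :
  map_mx Re (A *m B) = map_mx Re A *m map_mx Re B - map_mx Im A *m map_mx Im B.
Proof.
apply/matrixP => i j; rewrite !mxE raddf_sum -sumrB; apply: eq_bigr => k _.
by rewrite !mxE; case: (A i k) => a b; case: (B k j).
Qed.

Lemma Im_mulmx m n p (A : 'M[C]_(m, n)) (B : 'M[C]_(n, p)) :
  map_mx Im (A *m B) = map_mx Re A *m map_mx Im B + map_mx Im A *m map_mx Re B.
Proof.
apply/matrixP => i j; rewrite !mxE raddf_sum -big_split; apply: eq_bigr => k _.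
by rewrite !mxE; case: (A i k) => a b; case: (B k j).
Qed.

(** Complex Schur form: the diagonal entries of [T] are eigenvalues of [M]. Dimension 0 is set apart
    because [Schur] asks for a positive one. *)
Lemma hurwitz_triangular n (M : 'M[R]_n) : hurwitz M ->
  exists (U T : 'M[C]_n), [/\ U \in unitmx, is_trig_mx T,
    U *m map_mx (real_complex R) M = T *m U & forall i, Re (T i i) < 0].
Proof.
move=> hM; case: n M hM => [|n] M hM.
  exists 1%:M, 0; split; [exact: unitmx1| by apply/is_trig_mxP => -[] | | by case].
  by rewrite mul0mx; apply/matrixP => -[].
have [U uU] := Schur (map_mx (real_complex R) M) (ltn0Sn n).
have unU := unitarymx_unit uU.
move=> trT.
set A := map_mx _ M in trT *; set T := conjmx U A in trT.
have UA : U *m A = T *m U by rewrite /T conjumx// mulmxKV.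
exists U, T; split => // i; apply: hM.
have : eigenvalue T (T i i).
  by rewrite eigenvalue_root_char char_poly_trig// (bigD1 i)//= rootM root_XsubC eqxx.
move=> /eigenvalueP[v vT v0]; apply/eigenvalueP; exists (v *m U).
  by rewrite -mulmxA UA mulmxA vT scalemxAl.
apply: contra v0 => /eqP h; apply/eqP.
by rewrite -(mulmxK unU v) h mul0mx.
Qed.

(* Real and imaginary parts of a Schur form, conjugated by [diag (del ^ i)] so
   that the off-diagonal entries become arbitrarily small. *)
Lemma hurwitz_near_diagonal n (M : 'M[R]_n) : hurwitz M ->
  exists (Ur Ui Tr Ti : 'M[R]_n) (al : R),
  [/\ 0 < al, forall x : 'cV[R]_n, Ur *m x = 0 -> Ui *m x = 0 -> x = 0,
     Ur *m M = Tr *m Ur - Ti *m Ui /\ Ui *m M = Tr *m Ui + Ti *m Ur,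
     forall i, Tr i i <= - al &
     \sum_i \sum_(j | j != i) (`|Tr i j| + `|Ti i j|) <= al / 2].
Proof.
move=> /hurwitz_triangular[U [T [unU trT UM Tneg]]].
set A := map_mx _ M in UM.
have ReA : map_mx Re A = M by apply/matrixP => i j; rewrite !mxE.
have ImA : map_mx Im A = 0 by apply/matrixP => i j; rewrite !mxE.
set vr := map_mx Re U; set vi := map_mx Im U.
set sr := map_mx Re T; set si := map_mx Im T.
have E1 : vr *m M = sr *m vr - si *m vi.
  have := Re_mulmx U A; rewrite UM Re_mulmx ReA ImA mulmx0 subr0 => <-.
  by [].
have E2 : vi *m M = sr *m vi + si *m vr.
  have := Im_mulmx U A; rewrite UM Im_mulmx ReA ImA mulmx0 add0r => <-.
  by [].
(* [1 / S] is a positive lower bound of all the numbers [- sr i i], obtained without a minimum over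
   a possibly empty index set. *)
pose S := 1 + \sum_i (- sr i i)^-1.
have sneg i : 0 < - sr i i by rewrite oppr_gt0 mxE.
have S0 : 0 < S by rewrite ltr_pwDl// sumr_ge0// => i _; rewrite invr_ge0 ltW.
pose al := S^-1; have al0 : 0 < al by rewrite invr_gt0.
have alle i : sr i i <= - al.
  rewrite lerNr /al invf_ple ?posrE// /S (bigD1 i)//= addrCA lerDl.
  by rewrite addr_ge0// sumr_ge0// => j _; rewrite invr_ge0 ltW.
pose K := \sum_i \sum_(j | j != i) (`|sr i j| + `|si i j|).
have K0 : 0 <= K by rewrite sumr_ge0// => i _; rewrite sumr_ge0// => j _; rewrite addr_ge0.
(* Chosen to have both [del <= 1] and [del * K <= al / 2]. *)
pose del := al / (2 * (K + al)).
have del0 : 0 < del by rewrite divr_gt0// mulr_gt0// ltr_wpDl.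
have del1 : del <= 1.
  rewrite ler_pdivrMr ?mul1r; last by rewrite mulr_gt0// ltr_wpDl.
  lra.
have delK : del * K <= al / 2.
  rewrite /del mulrAC ler_pdivrMr; last by rewrite mulr_gt0// ltr_wpDl.
  rewrite (_ : _ / 2 * _ = al * (K + al)); last by field.
  by rewrite ler_wpM2l ?ltW// ltrDl.
have deln0 k : del ^+ k != 0 by rewrite expf_neq0// gt_eqF.
(* [D] rescales the rows of the basis [U], and [Dc] is the matching conjugation of [T]. Below the
   diagonal [Dc] multiplies the entry [(i, j)] by [del ^ (i - j)], which is at most [del]; above it
   [T] vanishes. *)
pose D (V : 'M[R]_n) : 'M[R]_n := \matrix_(i, j) (del ^+ i * V i j).
pose Dc (V : 'M[R]_n) : 'M[R]_n := \matrix_(i, j) (del ^+ i * V i j / del ^+ j).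
have DM V : D V *m M = D (V *m M).
  apply/matrixP => i j; rewrite !mxE mulr_sumr; apply: eq_bigr => k _.
  by rewrite !mxE mulrA.
have DcD V W : Dc V *m D W = D (V *m W).
  apply/matrixP => i j; rewrite !mxE mulr_sumr; apply: eq_bigr => k _.
  by rewrite !mxE; field.
have DD V W : D (V + W) = D V + D W.
  by apply/matrixP => i j; rewrite !mxE mulrDr.
have DN V : D (- V) = - D V.
  by apply/matrixP => i j; rewrite !mxE mulrN.
have Dx V (x : 'cV[R]_n) : D V *m x = 0 -> V *m x = 0.
  move=> h; apply/colP => i; move/colP: h => /(_ i); rewrite !mxE => h.
  apply: (mulfI (deln0 i)); rewrite mulr0 -[RHS]h mulr_sumr.
  by apply: eq_bigr => k _; rewrite !mxE mulrA.
have trij (i j : 'I_n) : (i < j)%N -> T i j = 0 by move=> ij; exact: (is_trig_mxP trT).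
have Dcij (V : 'M[R]_n) (i j : 'I_n) : j != i -> ((i < j)%N -> V i j = 0) -> `|Dc V i j| <= del * `|V i j|.
  move=> ji Vij; rewrite mxE; have [ij|] := ltnP i j.
    by rewrite Vij// mulr0 mul0r normr0 mulr0.
  rewrite leq_eqVlt eq_sym val_eqE eq_sym (negbTE ji)/= => ij.
  rewrite mulrAC normrM ler_wpM2r// -(subnK (ltnW ij)) exprD mulfK//.
  rewrite ger0_norm; last by rewrite exprn_ge0// (ltW del0).
  have : (0 < i - j)%N by rewrite subn_gt0.
  case: (i - j)%N => // k _; rewrite exprS; apply: ler_piMr; first exact: ltW.
  by rewrite exprn_ile1// (ltW del0).
exists (D vr), (D vi), (Dc sr), (Dc si), al; split => //.
- move=> x /Dx vrx /Dx vix.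
  have Ux : U *m map_mx (real_complex R) x = 0.
    have h1 := Re_mulmx U (map_mx (real_complex R) x).
    have h2 := Im_mulmx U (map_mx (real_complex R) x).
    have Rex : map_mx Re (map_mx (real_complex R) x) = x by apply/matrixP => i j; rewrite !mxE.
    have Imx : map_mx Im (map_mx (real_complex R) x) = 0 by apply/matrixP => i j; rewrite !mxE.
    rewrite Rex Imx mulmx0 subr0 vrx in h1; rewrite Rex Imx mulmx0 add0r vix in h2.
    apply/colP => i; move/colP: h1 => /(_ i); move/colP: h2 => /(_ i).
    rewrite [LHS]mxE [RHS]mxE => h2; rewrite [LHS]mxE [RHS]mxE => h1; rewrite [RHS]mxE.
    by move: h1 h2; case: (_ i 0) => a b /= -> ->.
  have := mulKmx unU (map_mx (real_complex R) x); rewrite Ux mulmx0 => /colP h.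
  by apply/colP => i; have := h i; rewrite !mxE => -[].
- split; first by rewrite DM E1 DD DN !DcD.
  by rewrite DM E2 DD !DcD.
- by move=> i; rewrite mxE mulrAC divff// mul1r.
- apply: le_trans delK; rewrite /K mulr_sumr; apply: ler_sum => i _.
  rewrite mulr_sumr; apply: ler_sum => j ji; rewrite mulrDr.
  by apply: lerD; apply: Dcij => // ij; rewrite mxE trij.
Qed.

(** [Q] is the real part of [U^* U] for the rescaled Schur basis [U = Ur + i Ui], so [quad Q x] is
    [|U x|^2]. In the form to be bounded the diagonal of the triangular matrix contributes at most
    [- al |U x|^2], and the off-diagonal entries give back at most half of that. *)
Lemma hurwitz_lyapunov n (M : 'M[R]_n) : hurwitz M ->
  exists2 Q : 'M[R]_n, pd_mx Q & exists2 c : R, 0 < c &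
    forall x, dot x (Q *m (M *m x)) <= - c * enorm x ^+ 2.
Proof.
move=> /hurwitz_near_diagonal[Ur [Ui [Tr [Ti [al [al0 inj [E1 E2] diag off]]]]]].
pose Q := Ur^T *m Ur + Ui^T *m Ui.
have QE (x y : 'cV[R]_n) : dot x (Q *m y) = dot (Ur *m x) (Ur *m y) + dot (Ui *m x) (Ui *m y).
  by rewrite /Q mulmxDl dotDr !dot_mull !mulmxA.
have pdQ : pd_mx Q.
  split; first by rewrite /symmetric_mx /Q raddfD/= !trmx_mul !trmxK.
  move=> x x0; rewrite quadE QE lt_def addr_ge0 ?dot_ge0// andbT.
  apply: contra x0; rewrite paddr_eq0 ?dot_ge0// => /andP[/eqP/dot_eq0 h1 /eqP/dot_eq0 h2].
  exact/eqP/inj.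
exists Q => //; have [c c0 Qc] := pd_coercive pdQ.
exists (al / 2 * c); first by rewrite mulr_gt0// divr_gt0.
move=> x; rewrite QE !mulmxA E1 E2 mulmxBl mulmxDl -!mulmxA.
set a := Ur *m x; set b := Ui *m x.
set N := dot a a + dot b b.
have Nx : c * enorm x ^+ 2 <= N by apply: le_trans (Qc x) _; rewrite quadE QE.
move: a b @N Nx => a b N Nx.
apply: (@le_trans _ _ (- (al / 2) * N)); last first.
  by rewrite !mulNr lerN2 -(mulrA (al / 2)) ler_wpM2l// divr_ge0// ltW.
have aN i : a i 0 ^+ 2 + b i 0 ^+ 2 <= N.
  rewrite /N !dotE lerD// (bigD1 i)//= -expr2 lerDl; apply: sumr_ge0 => j _;
  by rewrite -expr2 sqr_ge0.
have N0 : 0 <= N by rewrite addr_ge0 ?dot_ge0.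
(* The diagonal of [Ti] cancels: only the real parts of the eigenvalues act on the diagonal. *)
have -> : dot a (Tr *m a - Ti *m b) + dot b (Tr *m b + Ti *m a) =
    \sum_i (Tr i i * (a i 0 ^+ 2 + b i 0 ^+ 2) + \sum_(j | j != i)
      (Tr i j * (a i 0 * a j 0 + b i 0 * b j 0) + Ti i j * (b i 0 * a j 0 - a i 0 * b j 0))).
  rewrite !dotE -big_split/=; apply: eq_bigr => i _; rewrite !mxE.
  rewrite mulrBr mulrDr !mulr_sumr -sumrB -!big_split/= (bigD1 i)//=.
  by congr (_ + _); [ring | apply: eq_bigr => j _; ring].
rewrite big_split/=.
apply: (@le_trans _ _ (- al * N + al / 2 * N)); last by rewrite -mulrDl ler_wpM2r//; lra.
apply: lerD.
  rewrite /N !dotE -big_split/= mulr_sumr; apply: ler_sum => i _.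
  by rewrite -!expr2 ler_wpM2r// addr_ge0// sqr_ge0.
apply: le_trans (ler_wpM2r N0 off).
rewrite mulr_suml; apply: ler_sum => i _; rewrite mulr_suml; apply: ler_sum => j _.
rewrite mulrDl; apply: lerD.
  apply: le_trans (ler_norm _) _; rewrite normrM ler_wpM2l// ler_norml.
  have := aN i; have := aN j.
  have := sqr_ge0 (a i 0 - a j 0); have := sqr_ge0 (b i 0 - b j 0).
  have := sqr_ge0 (a i 0 + a j 0); have := sqr_ge0 (b i 0 + b j 0).
  rewrite !sqrrD !sqrrN => ? ? ? ? ? ?; apply/andP; split; lra.
apply: le_trans (ler_norm _) _; rewrite normrM ler_wpM2l// ler_norml.
have := aN i; have := aN j.
have := sqr_ge0 (b i 0 - a j 0); have := sqr_ge0 (a i 0 - b j 0).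
have := sqr_ge0 (b i 0 + a j 0); have := sqr_ge0 (a i 0 + b j 0).
rewrite !sqrrD !sqrrN => ? ? ? ? ? ?; apply/andP; split; lra.
Qed.

(* A Lyapunov matrix [Q] of the detectability pair leaves cross terms in [F1 x]
   and [S0 P x]; the Riccati equation makes a multiple of [P] absorb them. *)
Lemma riccati_lyapunov n m (A1 S0 D1 P : 'M[R]_n) (F1 : 'M[R]_(m, n)) :
  psd_mx S0 -> D1 = F1^T *m F1 -> detectable A1 F1 -> riccati_sol A1 S0 D1 P ->
  exists2 Q : 'M[R]_n, pd_mx Q & exists2 c : R, 0 < c &
    forall x, dot x (Q *m ((A1 - S0 *m P) *m x)) <= - c * enorm x ^+ 2.
Proof.
move=> psdS0 D1E [L hL] [psdP ric].
have [Q pdQ [c c0 Qc]] := hurwitz_lyapunov hL.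
have [K K0 QK] := dot_mulmx_le (Q *m L).
have [K1 K10 QK1] := dot_mulmx_le Q.
have [k k0 Sk] := psd_enorm_le psdS0.
have symP : P^T = P := psdP.1.
have symS : S0^T = S0 := psdS0.1.
(* The Riccati equation makes [P] dissipate exactly the two quantities, [|F1 x|^2] and
   [quad S0 (P x)], in which the cross terms are measured. *)
have Pdot x : dot x (P *m ((A1 - S0 *m P) *m x))
    = - ((enorm (F1 *m x) ^+ 2 + quad S0 (P *m x)) / 2).
  have ricx : dot x (P *m (A1 *m x)) + dot x (P *m (A1 *m x)) - quad S0 (P *m x)
      + enorm (F1 *m x) ^+ 2 = 0.
    have : dot x ((P *m A1 + A1^T *m P - P *m S0 *m P + D1) *m x) = 0.
      by rewrite ric mul0mx /dot mulmx0 mxE.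
    rewrite D1E !mulmxDl mulNmx !dotDr dotNr -!mulmxA => <-.
    congr (_ + _ - _ + _); last by rewrite -dot_mull sqr_enorm.
      by rewrite -dot_mull dotC dot_mull symP.
    by rewrite quadE dot_mull symP.
  rewrite mulmxBl mulmxBr dotDr dotNr.
  have -> : dot x (P *m (S0 *m P *m x)) = quad S0 (P *m x).
    by rewrite quadE [RHS]dot_mull symP !mulmxA.
  lra.
(* Young's inequality with weight [c / 4] on [|x|^2] leaves [K^2 / c] times [|F1 x|^2] and
   [K1^2 k / c] times [quad S0 (P x)]. The factor 2 offsets the half in [Pdot]. *)
pose kap := 2 * (K ^+ 2 / c + K1 ^+ 2 * k / c).
have kap0 : 0 <= kap by rewrite mulr_ge0// addr_ge0// divr_ge0 ?(ltW c0)// ?mulr_ge0// sqr_ge0.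
exists (Q + kap *: P).
  split; first by rewrite /symmetric_mx raddfD/= linearZ/= symP pdQ.1.
  move=> x x0; rewrite quadD quadZ; apply: ltr_wpDr; last exact: pdQ.2.
  by rewrite mulr_ge0//; exact: psdP.2.
exists (c / 2); first by rewrite divr_gt0.
move=> x; rewrite mulmxDl -scalemxAl dotDr dotZr Pdot.
have -> : (A1 - S0 *m P) *m x = (A1 + L *m F1) *m x - L *m (F1 *m x) - S0 *m (P *m x).
  by rewrite !mulmxA -!mulmxBl; congr (_ *m _); rewrite addrK.
rewrite !mulmxBr !dotDr !dotNr.
have h1 := Qc x.
have := le_trans (ler_norm _) (QK (- x) (F1 *m x)); rewrite dotNl enormN -mulmxA.
have := le_trans (ler_norm _) (QK1 (- x) (S0 *m (P *m x))); rewrite dotNl enormN.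
have := Sk (P *m x).
have := enorm_ge0 x; have := enorm_ge0 (F1 *m x); have := enorm_ge0 (S0 *m (P *m x)).
move: h1; set X := enorm x; set e := enorm (F1 *m x); set sg := enorm (S0 *m _); set q := quad _ _.
set d1 := dot _ _; set d2 := dot _ _; set d3 := dot _ _ => h1 sg0 e0 X0 h2 h3 h4.
have y1 : K * (X * e) <= c / 4 * X ^+ 2 + K ^+ 2 / c * e ^+ 2.
  have := sqr_ge0 (c * X / 2 - K * e) => h.
  rewrite -subr_ge0 (_ : _ - _ = (c * X / 2 - K * e) ^+ 2 / c); last by field; rewrite gt_eqF.
  by rewrite divr_ge0// ltW.
have y2 : K1 * (X * sg) <= c / 4 * X ^+ 2 + K1 ^+ 2 / c * sg ^+ 2.
  have := sqr_ge0 (c * X / 2 - K1 * sg) => h.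
  rewrite -subr_ge0 (_ : _ - _ = (c * X / 2 - K1 * sg) ^+ 2 / c); last by field; rewrite gt_eqF.
  by rewrite divr_ge0// ltW.
have y3 : K1 ^+ 2 / c * sg ^+ 2 <= K1 ^+ 2 * k / c * q.
  rewrite (_ : _ * q = K1 ^+ 2 / c * (k * q)); last by ring.
  by rewrite ler_wpM2l// divr_ge0 ?sqr_ge0// ltW.
have q0 : 0 <= q by exact: psdS0.2.
have z1 : 0 <= K ^+ 2 / c * q by rewrite mulr_ge0// divr_ge0 ?sqr_ge0// ltW.
have z2 : 0 <= K1 ^+ 2 * k / c * e ^+ 2.
  by rewrite mulr_ge0 ?sqr_ge0// divr_ge0 ?(ltW c0)// mulr_ge0// sqr_ge0.
have -> : kap * - ((e ^+ 2 + q) / 2) = - (K ^+ 2 / c * e ^+ 2) - (K1 ^+ 2 * k / c * e ^+ 2)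
   - K ^+ 2 / c * q - K1 ^+ 2 * k / c * q.
  by rewrite /kap; field; rewrite gt_eqF.
move: y1 y2 y3 z1 z2 h1 h3 h4; clear.
set a1 := K * _; set a2 := K1 * _; set a3 := _ * e ^+ 2; set a4 := _ * sg ^+ 2; set a5 := _ * q.
set a6 := _ * q; set a7 := _ * e ^+ 2; set a8 := X ^+ 2.
have -> : c / 4 * a8 = (c * a8) / 4 by ring.
have -> : - c * a8 = - (c * a8) by ring.
have -> : - (c / 2) * a8 = - ((c * a8) / 2) by ring.
lra.
Qed.

End lyapunov.

(** * Integrals over the half-line *)

Section halfline_integrals.
Variable R : realType.
Notation mu := (@lebesgue_measure R).
Local Notation halfR := (`[0%R, +oo[%classic : set R).

Lemma measurable_halfline_leb : measurable (@halfline R : set (Leb R)).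
Proof. exact: (@borel_leb R _ (@measurable_halfline R)). Qed.

Lemma measurable_expRM (k : R) : measurable_fun [set: R] (fun t : R => expR (k * t)).
Proof.
apply: continuous_measurable_fun => t; apply: continuous_comp; last exact: continuous_expR.
by apply: cvgM; [exact: cvg_cst | exact: cvg_id].
Qed.

(** Read off from the total mass 1 of the exponential distribution. *)
Lemma integral_halfline_expR (gam : R) : 0 < gam ->
  (\int[mu]_(t in halfR) (expR (- gam * t))%:E = (gam^-1)%:E)%E.
Proof.
move=> g0.
have mE : measurable_fun halfR (fun t : R => (expR (- gam * t))%:E).
  by apply/measurable_EFinP; apply: measurable_funTS; exact: measurable_expRM.
have := integral_exponential_pdf g0.
have -> : (fun x => (exponential_pdf gam x)%:E) =
    (fun t : R => (gam%:E * (expR (- gam * t))%:E)%E) \_ halfR.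
  apply/funext => x; rewrite /exponential_pdf !patchE.
  by case: ifPn.
rewrite -integral_mkcond ge0_integralZl//; last by rewrite lee_fin ltW.
set I := (\int[_]_(_ in _) _)%E => h.
have : ((gam^-1)%:E * (gam%:E * I) = (gam^-1)%:E)%E by rewrite h mule1.
by rewrite muleA -EFinM mulVf ?gt_eqF// mul1e.
Qed.

Lemma integral_halfline_expR_leb (gam : R) : 0 < gam ->
  (\int[leb R]_(t in @halfline R) (expR (- gam * t))%:E = (gam^-1)%:E)%E.
Proof.
move=> g0; rewrite -(integral_halfline_expR g0) -integral_leb//.
by apply/measurable_EFinP; apply: measurable_funTS; exact: measurable_expRM.
Qed.

Lemma integrable_halfline_expR_leb (K gam : R) : 0 < gam ->
  (leb R).-integrable (@halfline R) (fun t => (K * expR (- gam * t))%:E).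
Proof.
move=> g0.
have mE : measurable_fun (@halfline R : set (Leb R)) ((fun t : R => (expR (- gam * t))) : Leb R -> R).
  apply: borel_leb_fun; first exact: measurable_halfline.
  by apply: measurable_funTS; exact: measurable_expRM.
have iE : (leb R).-integrable (@halfline R) (fun t => (expR (- gam * t))%:E).
  apply/integrableP; split; first exact/measurable_EFinP.
  under eq_integral do rewrite gee0_abs ?lee_fin ?expR_ge0//.
  by rewrite integral_halfline_expR_leb// ltry.
have := @integrableZl _ _ _ _ _ measurable_halfline_leb K _ iE.
by apply: eq_integrable => [|t _]; [exact: measurable_halfline_leb|rewrite EFinM].
Qed.

Lemma le_halfline_expR_integrable (v : R -> R) (K gam : R) : 0 < gam ->
  measurable_fun (@halfline R : set (Leb R)) (v : Leb R -> R) ->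
  (forall t, 0 <= t -> `|v t| <= K * expR (- gam * t)) ->
  (leb R).-integrable (@halfline R) (EFin \o v).
Proof.
move=> g0 mv vK.
apply: le_integrable (integrable_halfline_expR_leb K g0).
- exact: measurable_halfline_leb.
- exact/measurable_EFinP.
- move=> t; rewrite /halfline/= in_itv/= andbT => t0.
  by rewrite lee_fin (le_trans (vK _ t0))// ler_norm.
Qed.

Lemma le_halfline_expR_Rintegral (v : R -> R) (K gam : R) : 0 < gam ->
  measurable_fun (@halfline R : set (Leb R)) (v : Leb R -> R) ->
  (forall t, 0 <= t -> `|v t| <= K * expR (- gam * t)) ->
  `|\int[leb R]_(t in @halfline R) v t| <= K / gam.
Proof.
move=> g0 mv vK.
have iv := le_halfline_expR_integrable g0 mv vK.
have iE := integrable_halfline_expR_leb 1 g0.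
have -> : K / gam = \int[leb R]_(t in @halfline R) (K * expR (- gam * t)).
  rewrite RintegralZl; last 2 first.
  - exact: measurable_halfline_leb.
  - by move: iE; apply: eq_integrable => [|t _]; [exact: measurable_halfline_leb|rewrite mul1r].
  by rewrite /Rintegral integral_halfline_expR_leb.
apply: le_trans (le_normr_Rintegral measurable_halfline_leb iv) _.
apply: le_Rintegral; first exact: measurable_halfline_leb.
- by apply: integrable_norm.
- exact: integrable_halfline_expR_leb.
- by move=> t; rewrite /halfline/= in_itv/= andbT; exact: vK.
Qed.

Lemma lebesgue_measure_shift (t : R) (A : set R) : measurable A ->
  mu A = mu ((fun x => x + t) @^-1` A).
Proof.
move=> mA.
have mshift : measurable_fun [set: measurableTypeR R] ((fun x : R => x + t) : measurableTypeR R -> measurableTypeR R).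
  apply: measurable_funD => //.
pose nu : {measure set (measurableTypeR R) -> \bar R} :=
  measure_function_pushforward__canonical__measure_function_Measure mu mshift.
change (mu A = nu A).
apply: lebesgue_measure_unique => // X /ocitvP[->|[[a b] /= ab ->]]; first by rewrite !measure0.
have -> : nu `]a, b]%classic = mu `]a - t, b - t]%classic.
  rewrite [LHS]/(mu _); congr (mu _); apply/seteqP; split => x /=; rewrite !in_itv/=.
    by rewrite ltrBlDr lerBrDr.
  by rewrite ltrBlDr lerBrDr.
rewrite !lebesgue_measure_itv/= !lte_fin ltrD2r; case: ifP => // _.
by rewrite -!EFinB; congr (_%:E); ring.
Qed.

Lemma integral_shift (t : R) (f : R -> R) : measurable_fun [set: R] f ->
  mu.-integrable `[t, +oo[%classic (EFin \o f) ->
  \int[mu]_(x in halfR) f (x + t) = \int[mu]_(x in `[t, +oo[) f x.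
Proof.
move=> mf fi.
pose shift : measurableTypeR R -> measurableTypeR R := fun x : R => x + t.
have mshift : measurable_fun [set: measurableTypeR R] shift.
  exact: measurable_funD.
have pre : shift @^-1` `[t, +oo[%classic = halfR.
  by apply/seteqP; split => x /=; rewrite !in_itv/= !andbT lerDr.
have nuE (g : R -> \bar R) :
    (\int[mu]_(x in `[t, +oo[) g x = \int[pushforward mu shift]_(x in `[t, +oo[) g x)%E.
  pose nu : {measure set (measurableTypeR R) -> \bar R} :=
    measure_function_pushforward__canonical__measure_function_Measure mu mshift.
  apply: (@eq_measure_integral _ _ R _ nu mu) => A mA _.
  exact: lebesgue_measure_shift.
have mEf : measurable_fun [set: measurableTypeR R] (EFin \o f) by exact/measurable_EFinP.
have fi' : mu.-integrable (shift @^-1` `[t, +oo[%classic) ((EFin \o f) \o shift).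
  apply/integrableP; split; first by apply: measurable_funTS; exact: measurableT_comp.
  have /integrableP[_] := fi; rewrite nuE ge0_integral_pushforward//.
  by apply: measurable_funTS; exact: measurableT_comp.
rewrite /Rintegral nuE (integral_pushforward mshift mEf fi')//.
by rewrite pre.
Qed.

End halfline_integrals.

(** * Quadratic forms along trajectories and boundedness of the exponential *)

Section acd_quadratic.
Variables (R : realType) (n : nat).

Lemma acd_dot (x x' y y' : R -> 'cV[R]_n) : acdmx x x' -> acdmx y y' ->
  acd (fun t => dot (x t) (y t)) (fun t => dot (x' t) (y t) + dot (x t) (y' t)).
Proof.
move=> dx dy; have := acdmxM (acdmx_tr dx) dy 0 0.
by under [X in acd _ X]eq_fun do rewrite mxE.
Qed.

Lemma acd_quad (Q : 'M[R]_n) (x x' : R -> 'cV[R]_n) : Q^T = Q -> acdmx x x' ->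
  acd (fun t => quad Q (x t)) (fun t => 2 * dot (x t) (Q *m x' t)).
Proof.
move=> symQ dx; have := acd_dot dx (acdmx_mull Q dx).
under eq_fun do rewrite -quadE; apply: acd_eqr => t _.
have -> : dot (x' t) (Q *m x t) = dot (x t) (Q *m x' t) by rewrite dotC dot_mull symQ.
ring.
Qed.

(** The columns of the exponential of [t M] are trajectories of x' = M x, along which [quad Q] does
    not increase. The transpose is the form in which the exponential enters [h10]. *)
Lemma expmx_bounded (M Q : 'M[R]_n) (c : R) : pd_mx Q -> 0 < c ->
  (forall x, dot x (Q *m (M *m x)) <= - c * enorm x ^+ 2) ->
  exists2 K : R, 0 <= K &
    forall t, 0 <= t -> forall i j, `|expmx (t *: M^T) i j| <= K.
Proof.
move=> pdQ c0 Qc; have [d d0 Qd] := pd_coercive pdQ.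
pose X t := (expmx (t *: M^T))^T.
have dX : acdmx X (fun t => M *m X t).
  have := acdmx_tr (@acdmx_expmx R n M^T).
  by apply: acdmx_eqr => t _; rewrite expmx_comm trmx_mul trmxK.
have dx (e : 'cV[R]_n) : acdmx (fun t => X t *m e) (fun t => M *m (X t *m e)).
  have := acdmxM dX (acdmx_cst e).
  by apply: acdmx_eqr => t _; rewrite mulmx0 addr0 mulmxA.
pose e (i : 'I_n) : 'cV[R]_n := delta_mx i 0.
have VB i t : 0 <= t -> quad Q (X t *m e i) <= quad Q (e i).
  move=> t0; have := acd_nonincreasing (acd_quad pdQ.1 (dx (e i))) _ (lexx 0) t0.
  have -> : X 0 = 1%:M by rewrite /X scale0r expmx0 trmx1.
  rewrite mul1mx; apply=> s _.
  have := Qc (X s *m e i); have := sqr_ge0 (enorm (X s *m e i)) => h1 h2.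
  have : 0 <= c * enorm (X s *m e i) ^+ 2 by rewrite mulr_ge0// ltW.
  by rewrite mulNr in h2; lra.
exists (1 + \sum_i quad Q (e i) / d).
  rewrite addr_ge0// sumr_ge0// => i _; rewrite divr_ge0 ?(ltW d0)//.
  exact: (pd_psd pdQ).2.
move=> t t0 i j.
have -> : expmx (t *: M^T) i j = (X t *m e i) j 0.
  by rewrite /X /e -colE !mxE.
apply: le_trans (normr_coord_le_enorm _ _) _.
set y := enorm _.
have y2 : y ^+ 2 <= quad Q (e i) / d.
  by rewrite ler_pdivlMr// mulrC (le_trans (Qd _))// VB.
(* The inequality [y <= 1 + y ^+ 2] replaces a square root and keeps the constant polynomial. *)
apply: (@le_trans _ _ (1 + y ^+ 2)).
  have := sqr_ge0 (y - 1 / 2); have := sqr_ge0 y; rewrite sqrrB => ? ?; lra.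
rewrite lerD2l (le_trans y2)// (bigD1 i)//= lerDl sumr_ge0// => k _.
rewrite divr_ge0 ?(ltW d0)//; exact: (pd_psd pdQ).2.
Qed.

End acd_quadratic.

Lemma Rintegral_sum d (T : measurableType d) (R : realType) (mu : {measure set T -> \bar R}) (n : nat)
    (D : set T) (c : 'I_n -> R) (psi : 'I_n -> T -> R) :
  measurable D -> (forall j, mu.-integrable D (EFin \o psi j)) ->
  \int[mu]_(x in D) (\sum_j c j * psi j x) = \sum_j c j * \int[mu]_(x in D) psi j x.
Proof.
move=> mD ipsi.
have ic j : mu.-integrable D (fun x => (c j * psi j x)%:E).
  have := integrableZl mD (c j) (ipsi j).
  by apply: eq_integrable => // x _; rewrite EFinM.
suff H (s : seq 'I_n) : mu.-integrable D (EFin \o (fun x => \sum_(j <- s) c j * psi j x)) /\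
    \int[mu]_(x in D) (\sum_(j <- s) c j * psi j x) = \sum_(j <- s) c j * \int[mu]_(x in D) psi j x.
  by have [] := H (index_enum 'I_n).
elim: s => [|j s [IH1 IH2]].
  under [X in EFin \o X]eq_fun do rewrite big_nil.
  under eq_Rintegral do rewrite big_nil.
  rewrite big_nil; split; first exact: integrable0.
  by rewrite /Rintegral integral0.
under [X in EFin \o X]eq_fun do rewrite big_cons.
under eq_Rintegral do rewrite big_cons.
rewrite big_cons; split.
  have := integrableD mD (ic j) IH1.
  by apply: eq_integrable => // x _; rewrite /= EFinD.
rewrite RintegralD//; last exact: ic.
by rewrite IH2 RintegralZl.
Qed.

Lemma leb_integrable_borel (R : realType) (f : R -> R) : measurable_fun [set: R] f ->
  (leb R).-integrable (@halfline R) (EFin \o f) ->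
  (@lebesgue_measure R).-integrable `[0%R, +oo[%classic (EFin \o f).
Proof.
move=> mf /integrableP[_].
have mf' (D : set (measurableTypeR R)) : measurable_fun D (f : measurableTypeR R -> R).
  by apply: (@measurable_funS _ _ (measurableTypeR R) _ setT) => //; exact: mf.
rewrite integral_leb; last 2 first.
- exact: measurable_halfline.
- by apply: measurableT_comp => //; apply/measurable_EFinP; exact: mf'.
by move=> h'; apply/integrableP; split => //; apply/measurable_EFinP; exact: mf'.
Qed.

(** * The adjoint equation *)

Section h10_ode.
Variables (R : realType) (n : nat) (M P : 'M[R]_n) (f : R -> 'cV[R]_n) (a gam : R).
Notation mu := (@lebesgue_measure R).
Local Notation halfR := (`[0%R, +oo[%classic : set R).
Hypotheses (gam0 : 0 < gam) (mf : meas_vec f)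
  (fa : forall t, 0 <= t -> forall i, `|f t i 0| <= a * expR (- gam * t)).
Variable K : R.
Hypotheses (EK : forall t, 0 <= t -> forall i j, `|expmx (t *: M^T) i j| <= K) (K0 : 0 <= K).

Let h := h10 M P f.
Let E t := expmx (t *: M^T).

Lemma measurable_mulmx_continuous m (X : R -> 'M[R]_(m, n)) (g : R -> 'cV[R]_n) i :
  (forall j, continuous (fun t => X t i j)) ->
  (forall j, measurable_fun [set: R] (fun t => g t j 0)) ->
  measurable_fun [set: R] (fun t => (X t *m g t) i 0).
Proof.
move=> cX mg; under eq_fun do rewrite mxE.
apply: measurable_sum => j; apply: measurable_funM; last exact: mg.
exact: continuous_measurable_fun.
Qed.

Lemma le_mulmx_expR (X : 'M[R]_n) (g : 'cV[R]_n) (B b : R) i : (forall j, `|X i j| <= B) ->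
  (forall j, `|g j 0| <= b) -> `|(X *m g) i 0| <= n%:R * B * b.
Proof.
move=> XB gb; rewrite mxE (le_trans (ler_norm_sum _ _ _))//.
apply: (@le_trans _ _ (\sum_(j < n) B * b)).
  by apply: ler_sum => j _; rewrite normrM ler_pM.
by rewrite sumr_const card_ord -mulrA [n%:R * _]mulr_natl.
Qed.

Lemma meas_vec_borel (v : R -> 'cV[R]_n) : meas_vec v ->
  exists g : R -> 'cV[R]_n, [/\ forall i, measurable_fun [set: R] (fun t => g t i 0),
    {ae leb R, forall t : R, 0 <= t -> v t = g t} &
    forall t i, g t i 0 = 0 \/ (0 <= t /\ g t i 0 = v t i 0)].
Proof.
move=> mv; have [g Hg] := choice (fun i => leb_fun_borel (mv i)).
exists (fun t => \col_i g i t); split.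
- by move=> i; under eq_fun do rewrite mxE; have [] := Hg i.
- have : {ae leb R, forall t : R, forall i, 0 <= t -> v t i 0 = g i t}.
    by apply: leb_ae_forall => i; have [_ + _] := Hg i.
  by apply: leb_aeS => t ht t0; apply/colP => i; rewrite mxE; exact: ht.
- by move=> t i; rewrite mxE; have [_ _] := Hg i; apply.
Qed.

(** Substituting s = x + t turns [h t] into the exponential of [- t M^T] applied to the tail
    integral from [t] of [psi], and the product rule gives the equation. Since the exponential is
    bounded at nonnegative times, [h] decays at the same rate as [f]. Shifting integrals is done
    with the Borel representative [G] of [f]. *)
Lemma h10_ode : acdmx h (fun t => - (M^T *m h t) - P *m f t) /\
  exists2 C : R, 0 <= C & forall t, 0 <= t -> enorm (h t) <= C * expR (- gam * t).
Proof.
have [G [mG aeG G0]] := meas_vec_borel mf.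
have a0 (i : 'I_n) : 0 <= a.
  by have := fa (lexx 0) i; rewrite mulr0 expR0 mulr1; apply: le_trans.
have Ga t i : `|G t i 0| <= a * expR (- gam * t).
  case: (G0 t i) => [->|[t0 ->]]; last exact: fa.
  by rewrite normr0 mulr_ge0 ?expR_ge0// (a0 i).
pose K2 := n%:R * K * \sum_i \sum_j `|P i j|.
have EP t i j : 0 <= t -> `|(E t *m P) i j| <= K2.
  move=> t0; rewrite [_ i j](_ : _ = (E t *m col j P) i 0); last by rewrite !mxE; apply: eq_bigr => l _; rewrite mxE.
  apply: le_mulmx_expR; first by move=> l; exact: EK.
  move=> l; rewrite mxE (bigD1 l)//= (bigD1 j)//= -addrA lerDl.
  by rewrite addr_ge0// sumr_ge0// => k _; rewrite sumr_ge0.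
pose psi j s := (E s *m P *m G s) j 0.
have cEP i j : continuous (fun t : R => (E t *m P) i j).
  have := @continuous_mulmx_expmx R n _ _ 1%:M P M^T i j.
  by under eq_fun do rewrite mul1mx.
have mpsi j : measurable_fun [set: R] (psi j).
  by apply: measurable_mulmx_continuous => // l; exact: cEP.
pose C := n%:R * K2 * a.
have psiC j s : 0 <= s -> `|psi j s| <= C * expR (- gam * s).
  move=> s0; rewrite /C -[X in _ <= X]mulrA; apply: le_mulmx_expR => // l; exact: EP.
have ipsi_leb j : (leb R).-integrable (@halfline R) (EFin \o psi j).
  apply: le_halfline_expR_integrable (psiC j) => //.
  by apply: borel_leb_fun; [exact: measurable_halfline | exact: measurable_funTS].
have ipsi j : mu.-integrable halfR (EFin \o psi j).
  by apply: leb_integrable_borel; [exact: mpsi | exact: ipsi_leb].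
pose Psi j t := \int[leb R]_(s in `[0, t]) psi j s.
have dPsi j : acd (Psi j) (psi j).
  apply: leb_primitive_bounded.
    by apply: borel_leb_fun; [exact: measurable_halfline | exact: measurable_funTS].
  move=> b; exists `|C| => t /andP[t0 _]; apply: le_trans (psiC j t t0) _.
  apply: (@le_trans _ _ (`|C| * expR (- gam * t))).
    by rewrite ler_wpM2r ?expR_ge0// ler_norm.
  by rewrite ler_piMr// -expR0 ler_expR mulNr oppr_le0 mulr_ge0// ltW.
pose cc j := \int[mu]_(x in halfR) psi j x.
have tailE j t : 0 <= t -> \int[mu]_(x in `[t, +oo[) psi j x = cc j - Psi j t.
  move=> t0; rewrite -Rintegral_itv_obnd_cbnd; last first.
    apply: integrableS (ipsi j) => //.
    by move=> x /=; rewrite !in_itv/= !andbT => /ltW; exact: le_trans.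
  rewrite -(@Rintegral_itvB _ _ (BLeft 0)) ?bnd_simp//; congr (_ - _).
  rewrite /Psi /Rintegral (integral_leb (f := EFin \o psi j))//.
  by apply/measurable_EFinP; exact: measurable_funTS.
(* [f] and [G] are compared at [x + t], so the exceptional set has to be translated, which keeps it
   null. *)
have aeGt t : 0 <= t -> {ae leb R, forall x : R, 0 <= x -> f (x + t) = G (x + t)}.
  move=> t0; have [A [mA A0 sA]] := leb_borel_negligible aeG.
  have mshift : measurable_fun [set: measurableTypeR R] (fun x : R => x + t).
    exact: measurable_funD.
  have mAt : measurable (((fun x : R => x + t) @^-1` A) : set (measurableTypeR R)).
    by rewrite -[X in measurable X]setTI; exact: mshift.
  exists ((fun x : R => x + t) @^-1` A); split; first exact: borel_leb.
    by have := lebesgue_measure_shift t mA; rewrite A0 => /esym; apply.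
  move=> x /= hx; apply: sA => /= h'; apply: hx => x0; apply: h'.
  by rewrite addr_ge0.
(* The integrand of [h t] is a fixed matrix times [psi] taken at [x + t]. *)
have phiE t x : E x *m P *m G (x + t) = E (- t) *m (E (x + t) *m P *m G (x + t)).
  by rewrite !mulmxA -expmxD (addrC (- t)) addrK.
have hE t i : 0 <= t -> h t i 0 = \int[mu]_(x in halfR) ((E x *m P *m G (x + t)) i 0).
  move=> t0; rewrite /h /h10 mxE /Rintegral; congr fine.
  have mphi : measurable_fun [set: R] (fun x : R => (E x *m P *m G (x + t)) i 0).
    apply: measurable_mulmx_continuous => [j|j]; first exact: cEP.
    apply: (measurableT_comp (f := fun s => G s j 0)) => //.
    exact: measurable_funD.
  rewrite -integral_leb; last 2 first.
  - exact: measurable_halfline.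
  - by apply/measurable_EFinP; exact: measurable_funTS.
  have aeq : ae_eq (leb R) (@halfline R)
      (fun x => ((E x *m P *m G (x + t)) i 0)%:E) (fun x => ((E x *m P *m f (x + t)) i 0)%:E).
    apply: leb_aeS (aeGt t t0) => x hx; rewrite /halfline/= in_itv/= andbT => x0.
    by rewrite hx.
  have mleb : measurable_fun (@halfline R : set (Leb R)) (fun x : Leb R => ((E x *m P *m G (x + t)) i 0)%:E).
    apply/measurable_EFinP; apply: borel_leb_fun; first exact: measurable_halfline.
    exact: measurable_funTS.
  apply/esym; apply: ae_eq_integral (aeq); [exact: measurable_halfline_leb | exact: mleb |].
  exact: (ae_measurable_fun (@completed_lebesgue_measure_is_complete R) aeq mleb).
have hE2 t : 0 <= t -> h t = expmx (- t *: M^T) *m (\col_j (cc j - Psi j t)).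
  move=> t0; apply/colP => i; rewrite hE//.
  under eq_Rintegral do rewrite phiE mxE.
  have -> : \int[mu]_(x in halfR) (\sum_j E (- t) i j * (E (x + t) *m P *m G (x + t)) j 0)
      = \sum_j E (- t) i j * \int[mu]_(x in halfR) psi j (x + t).
    apply: (Rintegral_sum (D := halfR : set (measurableTypeR R)) (E (- t) i) (psi := fun j x => psi j (x + t))) => // j.
    apply: leb_integrable_borel.
      by apply: (measurableT_comp (f := psi j)) => //; exact: measurable_funD.
    apply: (@le_halfline_expR_integrable _ _ (C * expR (- gam * t)) gam); first exact: gam0.
      apply: borel_leb_fun; first exact: measurable_halfline.
      by apply: measurable_funTS; apply: (measurableT_comp (f := psi j)) => //; exact: measurable_funD.
    move=> x x0; rewrite -mulrA -expRD -mulrDr addrC; apply: psiC.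
    by rewrite addr_ge0.
  rewrite mxE; apply: eq_bigr => j _; rewrite mxE -tailE// integral_shift//.
  apply: integrableS (ipsi j) => //.
  by move=> x /=; rewrite !in_itv/= !andbT; exact: le_trans.
split.
  pose W t := \col_j (cc j - Psi j t).
  have dW : acdmx W (fun t => - (E t *m P *m G t)).
    move=> i j; under eq_fun do rewrite mxE.
    have := acdB (acd_cst (cc i)) (dPsi i).
    by apply: acd_eqr => t _; rewrite sub0r ord1 [RHS]mxE.
  have dEW := acdmxM (@acdmx_expmxN R n M^T) dW.
  have dh : acdmx h (fun t => - (M^T *m expmx (- t *: M^T)) *m W t + expmx (- t *: M^T) *m - (E t *m P *m G t)).
    by apply: acdmx_eql dEW => t t0; rewrite hE2.
  move=> i j; apply: acd_ae (dh i j); apply: leb_aeS aeG => t Gt t0.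
  rewrite Gt ?(ltW t0)// hE2 ?(ltW t0)// mulNmx mulmxN !mulmxA.
  by rewrite -expmxD addNr scale0r expmx0 mul1mx.
exists (\sum_(i < n) (C / gam)).
  apply: sumr_ge0 => i _; rewrite divr_ge0 ?(ltW gam0)//.
  rewrite /C mulr_ge0 ?(a0 i)// mulr_ge0// /K2 mulr_ge0 ?mulr_ge0//.
  by rewrite sumr_ge0// => j _; rewrite sumr_ge0.
move=> t t0; apply: le_trans (enorm_le_sum _) _; rewrite mulr_suml; apply: ler_sum => i _.
rewrite hE//.
have mphi : measurable_fun [set: R] (fun x : R => (E x *m P *m G (x + t)) i 0).
  apply: measurable_mulmx_continuous => [j|j]; first exact: cEP.
  apply: (measurableT_comp (f := fun s => G s j 0)) => //.
  exact: measurable_funD.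
have -> : \int[mu]_(x in halfR) (E x *m P *m G (x + t)) i 0 =
    \int[leb R]_(x in @halfline R) ((E x *m P *m G (x + t)) i 0).
  rewrite /Rintegral integral_leb//; first exact: measurable_halfline.
  by apply/measurable_EFinP; exact: measurable_funTS.
rewrite mulrAC; apply: le_halfline_expR_Rintegral; first exact: gam0.
  by apply: borel_leb_fun; [exact: measurable_halfline | exact: measurable_funTS].
move=> x x0; rewrite /C -2!mulrA -expRD mulrA.
have -> : - gam * t + - gam * x = - gam * (x + t) by ring.
rewrite -[leRHS]mulrA.
by apply: le_mulmx_expR => // l; exact: EP.
Qed.

End h10_ode.

(** * Functions bounded on every interval [[0, b]] *)

Definition locally_bounded (R : realType) (v : R -> R) : Prop :=
  forall b : R, exists M : R, forall t : R, 0 <= t <= b -> `|v t| <= M.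

Section locally_bounded_theory.
Variable R : realType.

Lemma locally_boundedM (v w : R -> R) : locally_bounded v -> locally_bounded w ->
  locally_bounded (fun t => v t * w t).
Proof.
move=> bv bw b; have [M HM] := bv b; have [N HN] := bw b.
exists (M * N) => t tb; rewrite normrM; apply: ler_pM => //; [exact: HM | exact: HN].
Qed.

Lemma locally_boundedD (v w : R -> R) : locally_bounded v -> locally_bounded w ->
  locally_bounded (fun t => v t + w t).
Proof.
move=> bv bw b; have [M HM] := bv b; have [N HN] := bw b.
by exists (M + N) => t tb; apply: le_trans (ler_normD _ _) _; apply: lerD; [exact: HM | exact: HN].
Qed.

Lemma locally_bounded_cst (c : R) : locally_bounded (fun=> c).
Proof. by move=> b; exists `|c|. Qed.

Lemma locally_bounded_sum (I : Type) (r : seq I) (v : I -> R -> R) :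
  (forall i, locally_bounded (v i)) -> locally_bounded (fun t => \sum_(i <- r) v i t).
Proof.
move=> bv; elim: r => [|i r IH].
  by under eq_fun do rewrite big_nil; exact: locally_bounded_cst.
by under eq_fun do rewrite big_cons; exact: locally_boundedD.
Qed.

Lemma locally_bounded_continuous (v : R -> R) : continuous v -> locally_bounded v.
Proof. by move=> cv b; exact: continuous_itv_bounded. Qed.

Lemma acd_locally_bounded (v w : R -> R) : acd v w -> locally_bounded v.
Proof. by move=> [cv _] b; have [M _ HM] := ac1_bounded (cv b); exists M. Qed.

End locally_bounded_theory.

(** * Linear differential equations *)

Section linear_ode.
Variables (R : realType) (n : nat).

(** Variation of constants; local boundedness of [phi] provides the absolute continuity of the
    integral. *)
Lemma linear_ode_exists (M : 'M[R]_n) (phi : R -> 'cV[R]_n) (z0 : 'cV[R]_n) :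
  meas_vec phi -> (forall i, locally_bounded (fun t => phi t i 0)) ->
  exists2 z : R -> 'cV[R]_n, z 0 = z0 & acdmx z (fun t => M *m z t + phi t).
Proof.
move=> mphi bphi.
pose psi i (s : R) := (expmx (- s *: M) *m phi s) i 0.
have cE i j : continuous (fun s : R => expmx (- s *: M) i j).
  move=> s; apply: (@continuous_comp R R R (-%R) (fun s => expmx (s *: M) i j)).
    exact: opp_continuous.
  exact: continuous_expmx.
have mpsi i : measurable_fun (@halfline R : set (Leb R)) (psi i : Leb R -> R).
  rewrite /psi; under eq_fun do rewrite mxE.
  apply: measurable_sum => j; apply: measurable_funM; last exact: mphi.
  apply: borel_leb_fun; first exact: measurable_halfline.
  by apply: measurable_funTS; exact: continuous_measurable_fun.
have bpsi i : locally_bounded (psi i).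
  rewrite /psi; under eq_fun do rewrite mxE.
  apply: locally_bounded_sum => j; apply: locally_boundedM => //.
  exact: locally_bounded_continuous.
pose Psi (t : R) : 'cV[R]_n := \col_i \int[leb R]_(s in `[0, t]) psi i s.
have dPsi : acdmx (fun t => z0 + Psi t) (fun t => expmx (- t *: M) *m phi t).
  move=> i j; rewrite !ord1; have := acdD (acd_cst (z0 i 0)) (leb_primitive_bounded (mpsi i) (bpsi i)).
  have -> : (fun t => (z0 + Psi t) i 0) = (fun t => z0 i 0 + \int[leb R]_(s in `[0, t]) psi i s).
    by apply/funext => t; rewrite !mxE.
  by apply: acd_eqr => t _; rewrite add0r.
exists (fun t => expmx (t *: M) *m (z0 + Psi t)).
  rewrite scale0r expmx0 mul1mx; apply/colP => i; rewrite !mxE.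
  have -> : `[0, 0]%classic = [set 0] :> set R by rewrite set_itv1.
  rewrite /Rintegral (@null_set_integral _ (Leb R) _ _ [set 0] (EFin \o psi i)) ?addr0//.
  - by apply: borel_leb; exact: measurable_set1.
  - apply/measurable_EFinP; apply: measurable_funS (mpsi i); first exact: measurable_halfline_leb.
    by move=> x ->; rewrite /halfline/= in_itv/= lexx.
  - exact: (@lebesgue_measure_set1 R 0).
have := acdmxM (@acdmx_expmx R n M) dPsi.
apply: acdmx_eqr => t _.
by rewrite !mulmxA expmxNK mul1mx.
Qed.

(** The exponential of [- t M] applied to [d t] has zero derivative almost everywhere, so each
    coordinate and its opposite are nonincreasing. *)
Lemma linear_ode_zero (M : 'M[R]_n) (d : R -> 'cV[R]_n) :
  d 0 = 0 -> acdmx d (fun t => M *m d t) -> forall t, 0 <= t -> d t = 0.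
Proof.
move=> d0 dd t t0.
have key : acdmx (fun t => expmx (- t *: M) *m d t) (fun=> 0).
  have := acdmxM (@acdmx_expmxN R n M) dd.
  by apply: acdmx_eqr => s _; rewrite expmx_comm mulNmx mulmxA addNr.
have E0 : expmx (- t *: M) *m d t = 0.
  apply/matrixP => i j.
  have h := key i j; have h' : acd (fun t => (expmx (- t *: M) *m d t) i j) (fun=> 0).
    by apply: acd_eqr h => s _; rewrite mxE.
  have h1 := acd_nonincreasing h' (fun _ _ => lexx _) (lexx 0) t0.
  have h'' : acd (fun t => - (expmx (- t *: M) *m d t) i j) (fun=> 0).
    by have := acdN h'; apply: acd_eqr => s _; rewrite oppr0.
  have h2 := acd_nonincreasing h'' (fun _ _ => lexx _) (lexx 0) t0.
  rewrite d0 !mulmx0 in h1 h2; move: h1 h2; rewrite [X in _ <= X]mxE [X in _ <= - X]mxE [RHS]mxE.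
  by rewrite oppr0 oppr_le0 => h1 h2; apply/eqP; rewrite eq_le h1 h2.
by rewrite -(mul1mx (d t)) -(expmxNK M t) -mulmxA E0 mulmx0.
Qed.

Lemma ac1_family (b : R) (v : 'I_n -> R -> R) : (forall i, ac1 b (v i)) ->
  forall e : R, 0 < e -> exists2 d : R, 0 < d &
    forall s : seq (R * R),
      all (fun I => (0 <= I.1) && (I.1 <= I.2) && (I.2 <= b)) s ->
      pairwise (fun I J => (I.2 <= J.1) || (J.2 <= I.1)) s ->
      \sum_(I <- s) (I.2 - I.1) < d ->
      \sum_(I <- s) \sum_i `|v i I.2 - v i I.1| < e.
Proof.
move=> acv; elim: (index_enum 'I_n) => [|i r IH] e e0.
  exists 1 => // s _ _ _; rewrite big1// => I _; exact: big_nil.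
have e20 : 0 < e / 2 by rewrite divr_gt0.
have [d1 d10 H1] := IH _ e20; have [d2 d20 H2] := acv i _ e20.
exists (Num.min d1 d2); first by rewrite lt_min d10.
move=> s sb sp; rewrite lt_min => /andP[sd1 sd2].
rewrite [ltRHS]splitr; apply: le_lt_trans (ltrD (H2 s sb sp sd2) (H1 s sb sp sd1)).
rewrite -big_split/=; apply: ler_sum => I _.
by rewrite big_cons.
Qed.

Lemma loc_abs_continuousP (z : R -> 'cV[R]_n) :
  loc_abs_continuous z <-> forall i b, ac1 b (fun t => z t i 0).
Proof.
split=> [acz i b e e0|acz b b0 e e0].
  have [|d d0 H] := acz (Num.max b 1) _ e e0; first by rewrite lt_max ltr01 orbT.
  exists d => // s sb sp sd.
  have sb' : all (fun I : R * R => (0 <= I.1) && (I.1 <= I.2) && (I.2 <= Num.max b 1)) s.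
    by apply: sub_all sb => I /andP[-> Ib]; rewrite le_max Ib.
  apply: le_lt_trans (H s sb' sp sd); apply: ler_sum => I _.
  by have := normr_coord_le_enorm (z I.2 - z I.1) i; rewrite !mxE.
have [d d0 H] := @ac1_family b (fun i t => z t i 0) (fun i => acz i b) e e0.
exists d => // s sb sp sd; apply: le_lt_trans (H s sb sp sd).
apply: ler_sum => I _; apply: le_trans (enorm_le_sum _) _.
by apply: ler_sum => i _; rewrite !mxE.
Qed.

(** [closed_loop_sol] speaks of t >= 0 and [acdmx] of t > 0; the gap is the null set formed by the
    instant 0. *)
Lemma closed_loop_solP r (A : 'M[R]_n) (B : 'M[R]_(n, r)) f z0 u z :
  closed_loop_sol A B f z0 u z <->
  z 0 = z0 /\ acdmx z (fun t => A *m z t + B *m u (z t) t + f t).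
Proof.
split=> [[/loc_abs_continuousP acz z00 dz]|[z00 dz]].
  split=> // i j; rewrite ord1; split; first exact: acz.
  apply: leb_aeS dz => t + t0 => /(_ (ltW t0)) /is_derive_mxP; exact.
split=> //.
  by apply/loc_abs_continuousP => i b; have [] := dz i 0.
have [A0 [mA0 m0 sub0]] := leb_negligible_set1 (0 : R).
have ae0 : {ae leb R, forall t : R, t != 0}.
  by exists A0; split => // t /= /negP; rewrite negbK => /eqP ->; exact: sub0.
have dz' : {ae leb R, forall t : R, forall i : 'I_n, 0 < t ->
    is_derive t (1 : R) (fun t => z t i 0) ((A *m z t + B *m u (z t) t + f t) i 0)}.
  by apply: leb_ae_forall => i; have [] := dz i 0.
apply: leb_aeS2 ae0 dz' => t tn0 h t0; apply/is_derive_mxP => i j; rewrite ord1.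
by apply: h; rewrite lt_neqAle eq_sym tn0.
Qed.

End linear_ode.

(** * Comparing the cost integral with a value function *)

Section cost_bounds.
Variable R : realType.
Implicit Types L V w : R -> R.

Lemma measurable_halflineS b (v : R -> R) :
  measurable_fun (@halfline R : set (Leb R)) (v : Leb R -> R) ->
  measurable_fun (`[0, b]%classic : set (Leb R)) (v : Leb R -> R).
Proof.
apply: measurable_funS; first exact: measurable_halfline_leb.
by move=> s /=; rewrite /halfline/= !in_itv/= andbT => /andP[].
Qed.

(** The primitive of [L] plus [V] does not increase, which bounds the cost up to each time; monotone
    convergence along [[0, k]] reaches the half-line. The bound on [V] is asymptotic, so [V] need
    not have a limit. *)
Lemma cost_upper_bound L V w (J : R) : acd V w ->
  measurable_fun (@halfline R : set (Leb R)) (L : Leb R -> R) ->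
  (forall t, 0 <= L t) -> locally_bounded L ->
  (forall t, 0 < t -> L t <= - w t) ->
  (forall e : R, 0 < e -> exists T : R, forall t, T <= t -> V 0 - V t <= J + e) ->
  (\int[leb R]_(t in @halfline R) (L t)%:E <= J%:E)%E.
Proof.
move=> dV mL L0 bL Lw VJ.
pose Psi (t : R) := \int[leb R]_(s in `[0, t]) L s.
have dPsi : acd Psi L by exact: leb_primitive_bounded.
have iL b : (leb R).-integrable `[0, b]%classic (EFin \o L).
  by have [M HM] := bL b; exact: leb_integrable_bounded HM.
have Psi0 : Psi 0 = 0.
  rewrite /Psi set_itv1 /Rintegral (@null_set_integral _ (Leb R) _ _ [set 0] (EFin \o L))//.
  - by apply: borel_leb; exact: measurable_set1.
  - apply/measurable_EFinP; apply: measurable_funS mL; first exact: measurable_halfline_leb.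
    by move=> x ->; rewrite /halfline/= in_itv/= lexx.
  - exact: (@lebesgue_measure_set1 R 0).
have PsiV b : 0 <= b -> Psi b <= V 0 - V b.
  move=> b0; have := acd_nonincreasing (acdD dPsi dV) _ (lexx 0) b0.
  rewrite Psi0 add0r lerBrDr; apply => t t0.
  by have := Lw t t0; lra.
have PsiJ b : 0 <= b -> Psi b <= J.
  move=> b0; apply/ler_addgt0Pr => e e0; have [T HT] := VJ e e0.
  have bT : b <= Num.max b T by rewrite le_max lexx.
  apply: (le_trans (leb_primitive_nondecreasing (iL _) L0 b0 bT)).
  apply: le_trans (PsiV _ (le_trans b0 bT)) _.
  by apply: HT; rewrite le_max lexx orbT.
have hE : @halfline R = \bigcup_(n : nat) `[0, n%:R]%classic.
  apply/seteqP; split => x /=; rewrite /halfline/= in_itv/= andbT.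
    by move=> x0; exists (Num.bound x) => //=; rewrite in_itv/= x0 ltW// archi_boundP.
  by move=> [k _] /=; rewrite in_itv/= => /andP[].
rewrite hE.
have mI (k : nat) : measurable (`[0, k%:R]%classic : set (Leb R)).
  by apply: borel_leb; exact: measurable_itv.
have cvgL : (\int[leb R]_(t in `[0%R, k%:R]) (L t)%:E @[k --> \oo] -->
    \int[leb R]_(t in \bigcup_(k : nat) `[0%R, k%:R]%classic) (L t)%:E)%E.
  apply: (@ge0_nondecreasing_set_cvg_integral _ (Leb R) R (fun k : nat => `[0%R, k%:R]%classic) (fun t => (L t)%:E) (leb R)).
  - move=> k m km; apply/subsetPset => x /=; rewrite !in_itv/= => /andP[-> xk].
    by rewrite (le_trans xk)// ler_nat.
  - exact: mI.
  - by move=> k; apply/measurable_EFinP; exact: measurable_halflineS.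
  - by move=> k x _; rewrite lee_fin.
have LJ (k : nat) : (\int[leb R]_(t in `[0%R, k%:R]) (L t)%:E <= J%:E)%E.
  have := PsiJ k%:R (ler0n _ _); rewrite -lee_fin /Psi /Rintegral fineK//.
  by apply: integrable_fin_num => //; exact: mI.
rewrite -(cvg_lim _ cvgL)//; apply: lime_le; first exact: cvgP cvgL.
exact: nearW.
Qed.

(** [L] is only integrable, so its primitive enters [ac1_ae_le] through monotonicity and almost
    everywhere differentiability alone. *)
Lemma cost_lower_bound L V w (b : R) : acd V w ->
  measurable_fun (@halfline R : set (Leb R)) (L : Leb R -> R) ->
  (forall t, 0 <= L t) -> (leb R).-integrable (@halfline R) (EFin \o L) ->
  (forall t, 0 < t -> - w t <= L t) -> 0 <= b ->
  V 0 - V b <= \int[leb R]_(t in @halfline R) L t.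
Proof.
move=> dV mL L0 iL Lw b0.
pose Psi (t : R) := \int[leb R]_(s in `[0, t]) L s.
have mI (c : R) : measurable (`[0, c]%classic : set (Leb R)).
  by apply: borel_leb; exact: measurable_itv.
have sub c : `[0, c]%classic `<=` @halfline R.
  by move=> x /=; rewrite /halfline/= !in_itv/= andbT => /andP[].
have iLb c : (leb R).-integrable `[0, c]%classic (EFin \o L).
  by apply: integrableS iL; [exact: measurable_halfline_leb|exact: mI|exact: sub].
have dPsi := leb_primitive_derive mL iLb.
have Psi0 : 0 <= Psi 0 by exact: Rintegral_ge0.
have [acV aeV] := acdN dV.
have := @ac1_ae_le R (fun t => - V t) Psi (fun t => - w t - L t) b (acV b).
move=> /(_ _ _ 0 (lexx 0) b0) H.
have {H} : - V b - Psi b <= - V 0 - Psi 0.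
  apply: H.
    by move=> x y x0 xy _; exact: leb_primitive_nondecreasing.
  apply: leb_aeS2 aeV dPsi => t + + t0 => /(_ t0) h1 /(_ t0) h2.
  by split; [exact: is_deriveB | have := Lw t t0; lra].
have : Psi b <= \int[leb R]_(t in @halfline R) L t.
  rewrite /Psi /Rintegral; apply: fine_le.
  - by apply: integrable_fin_num => //; exact: mI.
  - by apply: integrable_fin_num => //; exact: measurable_halfline_leb.
  apply: ge0_subset_integral; [exact: mI|exact: measurable_halfline_leb|exact/measurable_EFinP| |exact: sub].
  by move=> x _; rewrite lee_fin.
lra.
Qed.

Lemma meas_vec_enorm n (x : R -> 'cV[R]_n) : meas_vec x ->
  measurable_fun (@halfline R : set (Leb R)) ((fun t => enorm (x t) ^+ 2) : Leb R -> R).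
Proof.
move=> mx; under eq_fun do rewrite sqr_enorm dotE.
by apply: measurable_sum => i; apply: measurable_funM; exact: mx.
Qed.

(** Otherwise the integral would be at least [del ^+ 2 * k] for every [k]. Small values at
    arbitrarily late times replace convergence of the trajectory to 0. *)
Lemma in_L2_small n (x : R -> 'cV[R]_n) (del T : R) : in_L2 x -> 0 < del ->
  exists t, [/\ 0 <= t, T <= t & enorm (x t) < del].
Proof.
move=> [mx fin] d0; apply: contrapT => H.
pose T0 := Num.max 0 T.
have big t : T0 <= t -> del ^+ 2 <= enorm (x t) ^+ 2.
  rewrite ge_max => /andP[t0 Tt]; rewrite ler_sqr ?nnegrE ?enorm_ge0 ?(ltW d0)//.
  by rewrite leNgt; apply/negP => h; apply: H; exists t.
have key (k : nat) : ((del ^+ 2 * k%:R)%:E <= \int[leb R]_(t in @halfline R) (enorm (x t) ^+ 2)%:E)%E.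
  have mI : measurable (`[T0, T0 + k%:R]%classic : set (Leb R)).
    by apply: borel_leb; exact: measurable_itv.
  have sub : `[T0, T0 + k%:R]%classic `<=` @halfline R.
    move=> t /=; rewrite /halfline/= !in_itv/= andbT => /andP[+ _].
    by apply: le_trans; rewrite le_max lexx.
  have mx2 := meas_vec_enorm mx.
  apply: (@le_trans _ _ (\int[leb R]_(t in `[T0, (T0 + k%:R)%R]) (enorm (x t) ^+ 2)%:E)%E); last first.
    apply: ge0_subset_integral; [exact: mI|exact: measurable_halfline_leb|exact/measurable_EFinP| |exact: sub].
    by move=> t _; rewrite lee_fin sqr_ge0.
  have -> : (del ^+ 2 * k%:R)%:E = (\int[leb R]_(t in `[T0, (T0 + k%:R)%R]) (cst (del ^+ 2)%:E) t)%E.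
    rewrite integral_cst; last exact: mI.
    rewrite EFinM; congr (_ * _)%E.
    have : lebesgue_measure (`[T0, T0 + k%:R]%classic : set R) = (k%:R)%:E.
      rewrite lebesgue_measure_itv/= lte_fin ltrDl ltr0n -EFinB.
      by case: (posnP k) => [->//|_]; rewrite addrAC subrr add0r.
    by move/esym; apply.
  apply: ge0_le_integral; [exact: mI| | | |].
  - by move=> t _; rewrite lee_fin sqr_ge0.
  - exact: measurable_cst.
  - apply/measurable_EFinP; apply: measurable_funS mx2 => //; exact: measurable_halfline_leb.
  - by move=> t; rewrite /= in_itv/= => /andP[tT _]; rewrite lee_fin big.
move: fin key; case: (integral _ _ _) => [r| |] // _.
- move=> h; have r0 : 0 <= r by have := h 0%N; rewrite mulr0 lee_fin.
  have d20 : 0 < del ^+ 2 by rewrite exprn_gt0.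
  have := h (Num.bound (r / del ^+ 2)); rewrite lee_fin mulrC -ler_pdivlMr// leNgt.
  by rewrite archi_boundP// divr_ge0// ltW.
- by move=> /(_ 0%N); rewrite leeNy_eq.
Qed.

Lemma in_L2_expR n (x : R -> 'cV[R]_n) (K m : R) : 0 < m -> meas_vec x ->
  (forall t, 0 <= t -> enorm (x t) ^+ 2 <= K * expR (- m * t)) -> in_L2 x.
Proof.
move=> m0 mx xK; split=> //.
have xK' t : 0 <= t -> `|enorm (x t) ^+ 2| <= K * expR (- m * t).
  by move=> t0; rewrite ger0_norm ?sqr_ge0//; exact: xK.
have /integrableP[_] := le_halfline_expR_integrable m0 (meas_vec_enorm mx) xK'.
apply: le_lt_trans; apply: ge0_le_integral; first exact: measurable_halfline_leb.
- by move=> t _; rewrite lee_fin sqr_ge0.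
- by apply/measurable_EFinP; exact: meas_vec_enorm.
- by apply: measurableT_comp => //; apply/measurable_EFinP; exact: meas_vec_enorm.
- by move=> t _ /=; rewrite lee_fin ler_norm.
Qed.

End cost_bounds.

(** * The reduced system *)

Section block_vectors.
Variables (R : realType) (m n : nat).

Lemma dot_col_mx (a c : 'cV[R]_m) (b d : 'cV[R]_n) :
  dot (col_mx a b) (col_mx c d) = dot a c + dot b d.
Proof. by rewrite /dot tr_col_mx mul_row_col mxE. Qed.

Lemma sqr_enorm_submx (z : 'cV[R]_(m + n)) :
  enorm z ^+ 2 = enorm (usubmx z) ^+ 2 + enorm (dsubmx z) ^+ 2.
Proof. by rewrite -{1}(vsubmxK z) !sqr_enorm dot_col_mx. Qed.

Lemma enorm_usubmx (z : 'cV[R]_(m + n)) : enorm (usubmx z) <= enorm z.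
Proof. by rewrite -ler_sqr ?nnegrE ?enorm_ge0// sqr_enorm_submx lerDl sqr_ge0. Qed.

Lemma enorm_dsubmx (z : 'cV[R]_(m + n)) : enorm (dsubmx z) <= enorm z.
Proof. by rewrite -ler_sqr ?nnegrE ?enorm_ge0// sqr_enorm_submx lerDr sqr_ge0. Qed.

Lemma quad_block_diag (M : 'M[R]_m) (N : 'M[R]_n) (z : 'cV[R]_(m + n)) :
  quad (block_mx M 0 0 N) z = quad M (usubmx z) + quad N (dsubmx z).
Proof.
rewrite !quadE -{1 2}(vsubmxK z) mul_block_col !mul0mx addr0 add0r.
exact: dot_col_mx.
Qed.

End block_vectors.

Section affine_feedback.
Variable R : realType.

Lemma meas_vecD n (v w : R -> 'cV[R]_n) : meas_vec v -> meas_vec w ->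
  meas_vec (fun t => v t + w t).
Proof.
move=> mv mw i; under [X in measurable_fun _ X]eq_fun do rewrite mxE.
exact: measurable_funD.
Qed.

Lemma meas_vec_mull m n (M : 'M[R]_(m, n)) (v : R -> 'cV[R]_n) : meas_vec v ->
  meas_vec (fun t => M *m v t).
Proof.
move=> mv i; under [X in measurable_fun _ X]eq_fun do rewrite mxE.
apply: measurable_sum => j; apply: measurable_funM => //.
Qed.

Lemma meas_vec_cst n (v : 'cV[R]_n) : meas_vec (fun=> v).
Proof. by move=> i; exact: measurable_cst. Qed.

Lemma acdmx_meas_vec n (v w : R -> 'cV[R]_n) : acdmx v w -> meas_vec v.
Proof. by move=> dv i; exact: acd_measurable (dv i 0). Qed.

Lemma locally_bounded_enorm n (v : R -> 'cV[R]_n) : locally_bounded (fun t => enorm (v t)) ->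
  forall i, locally_bounded (fun t => v t i 0).
Proof.
move=> bv i b; have [M bM] := bv b; exists M => t tb.
by apply: le_trans (normr_coord_le_enorm _ _) _; apply: le_trans (ler_norm _) (bM t tb).
Qed.

Lemma locally_bounded_mull m n (M : 'M[R]_(m, n)) (v : R -> 'cV[R]_n) :
  (forall i, locally_bounded (fun t => v t i 0)) ->
  forall i, locally_bounded (fun t => (M *m v t) i 0).
Proof.
move=> bv i; under eq_fun do rewrite mxE.
by apply: locally_bounded_sum => j; apply: locally_boundedM => //; exact: locally_bounded_cst.
Qed.

Lemma meas_vec_dot n (v w : R -> 'cV[R]_n) : meas_vec v -> meas_vec w ->
  measurable_fun (@halfline R : set (Leb R)) ((fun t => dot (v t) (w t)) : Leb R -> R).
Proof.
move=> mv mw; under eq_fun do rewrite dotE.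
by apply: measurable_sum => j; apply: measurable_funM.
Qed.

Lemma meas_vec_quad n (M : 'M[R]_n) (v : R -> 'cV[R]_n) : meas_vec v ->
  measurable_fun (@halfline R : set (Leb R)) ((fun t => quad M (v t)) : Leb R -> R).
Proof.
move=> mv; under eq_fun do rewrite quadE.
by apply: (meas_vec_dot mv); exact: meas_vec_mull.
Qed.

Lemma locally_bounded_quad n (M : 'M[R]_n) (v : R -> 'cV[R]_n) :
  (forall i, locally_bounded (fun t => v t i 0)) -> locally_bounded (fun t => quad M (v t)).
Proof.
move=> bv; under eq_fun do rewrite quadE dotE.
apply: locally_bounded_sum => i; apply: locally_boundedM => //.
exact: locally_bounded_mull.
Qed.

Lemma meas_vec_submx m n (v : R -> 'cV[R]_(m + n)) : meas_vec v ->
  meas_vec (fun t => usubmx (v t)).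
Proof. by move=> mv i; under eq_fun do rewrite mxE; exact: mv. Qed.

(** The gain [K] is constant in time, so the closed loop is linear with constant matrix [A + B K],
    and the difference of two solutions solves the homogeneous equation. *)
Lemma affine_feedback_sol n r (A : 'M[R]_n) (B : 'M[R]_(n, r)) (f : R -> 'cV[R]_n)
    (z0 : 'cV[R]_n) (K : 'M[R]_(r, n)) (phi : R -> 'cV[R]_r) (u : feedback R n r) :
  (forall z t, u z t = K *m z + phi t) -> meas_vec f -> meas_vec phi ->
  (forall i, locally_bounded (fun t => f t i 0)) ->
  (forall i, locally_bounded (fun t => phi t i 0)) ->
  [/\ forall z, meas_vec (u z), loc_lipschitz u &
    exists2 z, closed_loop_sol A B f z0 u z & forall z', closed_loop_sol A B f z0 u z' ->
      forall t, 0 <= t -> z' t = z t].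
Proof.
move=> uE mf mphi bf bphi; split.
- move=> z; have -> : u z = (fun t => K *m z + phi t) by apply/funext => t; exact: uE.
  by apply: meas_vecD => //; exact: meas_vec_cst.
- move=> z1; exists 1 => //; have [L L0 KL] := enorm_mulmx K; exists L => x y _ _ t _.
  by rewrite !uE opprD addrACA subrr addr0 -mulmxBr; exact: KL.
have [] := @linear_ode_exists R n (A + B *m K) (fun t => B *m phi t + f t) z0.
- by apply: meas_vecD; [exact: meas_vec_mull | exact: mf].
- move=> i; under eq_fun do rewrite mxE.
  by apply: locally_boundedD => //; exact: locally_bounded_mull.
move=> z z00 dz.
have rhsE (v : 'cV[R]_n) t : A *m v + B *m u v t + f t = (A + B *m K) *m v + (B *m phi t + f t).
  by rewrite uE mulmxDr mulmxDl !mulmxA !addrA.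
exists z.
  apply/closed_loop_solP; split => //; apply: acdmx_eqr dz => t _; exact/esym/rhsE.
move=> z' /closed_loop_solP[z'00 dz'] t t0; apply/eqP; rewrite -subr_eq0; apply/eqP.
apply: (@linear_ode_zero R n (A + B *m K) (fun t => z' t - z t)) => //.
  by rewrite z00 z'00 subrr.
have := acdmxD dz' (acdmx_mull (- 1%:M) dz).
under eq_fun do rewrite mulNmx mul1mx.
apply: acdmx_eqr => v _; rewrite mulNmx mul1mx rhsE mulmxBr opprD addrACA subrr addr0 //.
Qed.

End affine_feedback.

(** * Completion of squares along the reduced dynamics *)

Section value_identity.
Variables (R : realType) (n q s : nat).
Variables (A1 D1 P : 'M[R]_n) (A2 : 'M[R]_(n, s)) (Bt : 'M[R]_(n, q)) (D2 : 'M[R]_s)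
  (Gt : 'M[R]_q).
Hypotheses (pdD2 : pd_mx D2) (pdGt : pd_mx Gt).
Let S0 := A2 *m invmx D2 *m A2^T + Bt *m invmx Gt *m Bt^T.
Let A0 := A1 - S0 *m P.
Hypothesis ric : riccati_sol A1 S0 D1 P.

Lemma quad_complete m l (N : 'M[R]_m) (B : 'M[R]_(l, m)) (y : 'cV[R]_m) (k : 'cV[R]_l) :
  pd_mx N -> quad N (y + invmx N *m B^T *m k)
    = quad N y + 2 * dot k (B *m y) + dot k (B *m invmx N *m B^T *m k).
Proof.
move=> pdN; have uN := pd_unitmx pdN; have symN := pdN.1.
rewrite !quadE mulmxDr !dotDl !dotDr -!mulmxA mulKVmx//.
have -> : dot y (B^T *m k) = dot k (B *m y) by rewrite dotC dot_mull trmxK.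
have -> : dot (invmx N *m (B^T *m k)) (N *m y) = dot k (B *m y).
  by rewrite dot_mull trmx_inv symN mulKmx// dot_mull trmxK.
have -> : dot (invmx N *m (B^T *m k)) (B^T *m k) = dot k (B *m (invmx N *m (B^T *m k))).
  by rewrite dotC dot_mull trmxK.
ring.
Qed.

(* The two squares are completed around the minimizers [y = - D2^-1 A2^T k] and
   [u = - Gt^-1 Bt^T k] of the Hamiltonian. *)
Lemma value_identity (x h f1 : 'cV[R]_n) (y : 'cV[R]_s) (u : 'cV[R]_q) :
  let k := P *m x + h in
  let dx := A1 *m x + A2 *m y + Bt *m u + f1 in
  let dh := - (A0^T *m h) - P *m f1 in
  2 * dot x (P *m dx) + 2 * (dot dh x + dot h dx)
  = - (quad D1 x + quad D2 y + quad Gt u)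
    + (quad D2 (y + invmx D2 *m A2^T *m k) + quad Gt (u + invmx Gt *m Bt^T *m k))
    + (2 * dot h f1 - quad S0 h).
Proof.
move=> k dx dh; have [[symP _] ricE] := ric.
have Pd a b : dot a (P *m b) = dot (P *m a) b by rewrite dot_mull symP.
rewrite !quad_complete//.
have S0k : dot k (A2 *m invmx D2 *m A2^T *m k) + dot k (Bt *m invmx Gt *m Bt^T *m k) = quad S0 k.
  by rewrite quadE /S0 mulmxDl dotDr.
have symS : S0^T = S0.
  rewrite /S0 linearD/= !trmx_mul !trmxK !trmx_inv pdD2.1 pdGt.1.
  by rewrite !mulmxA.
(* The completions leave [quad S0 k]. Of its three parts, the first is balanced by the Riccati
   equation, the cross term by the adjoint equation, and the last by [- quad S0 h] in [c]. *)
have qS : quad S0 k = quad S0 (P *m x) + 2 * dot h (S0 *m (P *m x)) + quad S0 h.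
  rewrite /k !quadE mulmxDr !dotDr !dotDl.
  have -> : dot (P *m x) (S0 *m h) = dot h (S0 *m (P *m x)) by rewrite dotC dot_mull symS.
  ring.
have ricx : 2 * dot (P *m x) (A1 *m x) - quad S0 (P *m x) + quad D1 x = 0.
  have : dot x ((P *m A1 + A1^T *m P - P *m S0 *m P + D1) *m x) = 0.
    by rewrite ricE mul0mx /dot mulmx0 mxE.
  rewrite !mulmxDl mulNmx !dotDr dotNr -!mulmxA !Pd -dot_mull (dotC (A1 *m x)) !quadE => <-.
  ring.
have kx : dot k dx = dot k (A1 *m x) + dot k (A2 *m y) + dot k (Bt *m u) + dot k f1.
  by rewrite /dx !dotDr.
have kE a : dot k a = dot (P *m x) a + dot h a by rewrite /k dotDl.
have dhx : dot dh x = - dot h (A1 *m x) + dot h (S0 *m (P *m x)) - dot (P *m x) f1.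
  rewrite /dh dotDl !dotNl dot_mull trmxK /A0 mulmxBl dotDr dotNr -mulmxA.
  by rewrite (dotC (P *m f1)) Pd; ring.
have -> : dot x (P *m dx) = dot k dx - dot h dx by rewrite Pd kE; ring.
rewrite dhx kx (kE (A1 *m x)) (kE f1).
rewrite qS in S0k; move: S0k ricx; clear.
set a1 := dot k (A2 *m invmx D2 *m _ *m k); set a2 := dot k (Bt *m invmx Gt *m _ *m k).
lra.
Qed.

End value_identity.

(** * Exponential decay from differential inequalities *)

Lemma acd_expRM (R : realType) (a : R) :
  acd (fun t : R => expR (a * t)) (fun t => a * expR (a * t)).
Proof.
apply: acd_C1 => [u|u].
  have h : is_derive u (1 : R) (fun t : R => a * t) a.
    by apply: is_derive_eq; rewrite /GRing.scale/= mulr1.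
  have := @is_derive1_comp R expR (fun t : R => a * t) u _ _ (is_derive_expR (a * u)) h.
  by rewrite mulrC.
apply: cvgM; first exact: cvg_cst.
apply: continuous_comp; last exact: continuous_expR.
by apply: cvgM; [exact: cvg_cst | exact: cvg_id].
Qed.

(** Gronwall argument: [expR (m * t) * V t + K / gam * expR (- gam * t)] does not increase. The
    bound [m <= K^-1] lets [Y] absorb [m V], and [m <= gam] keeps the weighted forcing below
    [expR (- gam * t)]. *)
Lemma expR_decay (R : realType) (V V' Y : R -> R) (K gam : R) : acd V V' -> 0 < K -> 0 < gam ->
  V 0 <= K -> (forall t, 0 < t -> 0 <= Y t) -> (forall t, 0 < t -> V t <= K * Y t) ->
  (forall t, 0 < t -> Y t <= - V' t + K * expR (- (2 * gam) * t)) ->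
  forall t, 0 <= t -> V t <= (K + K / gam) * expR (- Num.min (K^-1) gam * t).
Proof.
move=> dV K0 g0 V0 Y0 VY YV t t0; set m := Num.min _ _.
have m0 : 0 < m by rewrite lt_min invr_gt0 K0.
have mg : m <= gam by rewrite ge_min lexx orbT.
have mK : m * K <= 1.
  by rewrite -(mulVf (lt0r_neq0 K0)) ler_wpM2r ?(ltW K0)// ge_min lexx.
have dU := acdD (acdM (acd_expRM m) dV) (acdZ (K / gam) (acd_expRM (- gam))).
have /(_ _)/= := acd_nonincreasing dU _ (lexx 0) t0.
rewrite !mulr0 !expR0 mul1r mulr1 => H.
have {H} : expR (m * t) * V t + K / gam * expR (- gam * t) <= V 0 + K / gam.
  apply: H => u u0.
  have e1 : expR (m * u) * expR (- (2 * gam) * u) <= expR (- gam * u).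
    rewrite -expRD ler_expR -mulrDl ler_wpM2r ?(ltW u0)//; lra.
  have e2 : 0 < expR (m * u) by exact: expR_gt0.
  have h1 : m * V u + V' u <= K * expR (- (2 * gam) * u).
    have := YV u u0; have : m * V u <= Y u.
      apply: le_trans (ler_wpM2l (ltW m0) (VY u u0)) _.
      by rewrite mulrA ler_piMl// Y0.
    lra.
  have h2 : expR (m * u) * (m * V u + V' u) <= K * expR (- gam * u).
    apply: le_trans (ler_wpM2l (ltW e2) h1) _.
    by rewrite mulrCA ler_wpM2l// ltW.
  rewrite (_ : K / gam * (- gam * expR (- gam * u)) = - (K * expR (- gam * u))); last first.
    by field; rewrite gt_eqF.
  rewrite (_ : m * expR (m * u) * V u + expR (m * u) * V' u = expR (m * u) * (m * V u + V' u)); last by ring.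
  lra.
have e3 : 0 <= K / gam * expR (- gam * t) by rewrite mulr_ge0 ?expR_ge0// divr_ge0 ?ltW.
move=> H; rewrite (mulNr m) expRN ler_pdivlMr ?expR_gt0// (mulrC (V t)); lra.
Qed.

Lemma expR_small (R : realType) (K m e : R) : 0 < m -> 0 < e ->
  exists T : R, forall t, T <= t -> K * expR (- m * t) <= e.
Proof.
move=> m0 e0; exists (K / e / m) => t Tt.
rewrite mulNr expRN ler_pdivrMr ?expR_gt0// -ler_pdivrMl// mulrC.
have : K / e <= m * t by rewrite (mulrC m) -ler_pdivrMr.
have := expR_ge1Dx (m * t); lra.
Qed.

(** With [e t] the integral of the bound from [t] on, [C + e] is nonincreasing and [C - e]
    nondecreasing; the limit of [C] is caught between them as an infimum. *)
Lemma expR_primitive (R : realType) (v : R -> R) (K gam : R) : 0 < gam ->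
  measurable_fun (@halfline R : set (Leb R)) (v : Leb R -> R) ->
  (forall t, 0 <= t -> `|v t| <= K * expR (- gam * t)) ->
  exists2 C : R -> R, acd C v & exists Cinf : R,
    forall t, 0 <= t -> `|C t - Cinf| <= K / gam * expR (- gam * t).
Proof.
move=> g0 mv vK.
have K0 : 0 <= K.
  by have := vK 0 (lexx 0); rewrite mulr0 expR0 mulr1; apply: le_trans.
have bv (b : R) : exists M : R, forall t : R, 0 <= t <= b -> `|v t| <= M.
  exists K => t /andP[t0 _]; apply: le_trans (vK t t0) _.
  by rewrite ler_piMr// expR_le1 mulNr oppr_le0 mulr_ge0// ltW.
have dC := leb_primitive_bounded mv bv.
move: dC; set C := (X in acd X _) => dC; exists C => //.
pose e t := K / gam * expR (- gam * t).
have e0 t : 0 <= e t by rewrite mulr_ge0 ?expR_ge0// divr_ge0// ltW.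
have de := acdZ (K / gam) (acd_expRM (- gam)).
have eE t : K / gam * (- gam * expR (- gam * t)) = - (K * expR (- gam * t)).
  by field; rewrite gt_eqF.
have dec s t : 0 <= s -> s <= t -> C t + e t <= C s + e s.
  apply: (acd_nonincreasing (acdD dC de)) => u u0; rewrite eE.
  by rewrite subr_le0; apply: le_trans (ler_norm _) (vK u (ltW u0)).
have inc s t : 0 <= s -> s <= t -> C s - e s <= C t - e t.
  move=> s0 st; rewrite -lerN2 !opprB.
  have := acd_nonincreasing (acdB de dC) _ s0 st; apply=> u u0; rewrite eE.
  have := vK u (ltW u0); rewrite ler_norml => /andP[+ _]; lra.
have key s t : 0 <= s -> 0 <= t -> C s - e s <= C t + e t.
  move=> s0 t0; have := e0 (Num.max s t).
  have := inc s (Num.max s t) s0; rewrite le_max lexx => /(_ isT).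
  have := dec t (Num.max s t) t0; rewrite le_max lexx orbT => /(_ isT); lra.
pose E := [set C t + e t | t in [set t : R | 0 <= t]].
have E0 : E !=set0 by exists (C 0 + e 0), 0 => /=.
have lE t : 0 <= t -> lbound E (C t - e t) by move=> t0 _ [s /= s0 <-]; exact: key.
exists (inf E) => t t0.
have h1 := lb_le_inf E0 (lE t t0).
have h2 : inf E <= C t + e t by apply: ge_inf; [exists (C t - e t); exact: lE | exists t].
by rewrite ler_distl -/(e t); apply/andP; split; lra.
Qed.

(** * Linear bounds with uniform constants *)

Section linear_bounds.
Variables (R : realType) (T : Type) (N : T -> R).
Hypothesis N0 : forall xi, 0 <= N xi.

(** The index type [T] bundles all varying data, so that the constant is chosen before any of them
    and is uniform. *)
Definition lin_bounded m (r : T -> 'cV[R]_m) : Prop :=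
  exists2 K : R, 0 <= K & forall xi, enorm (r xi) <= K * N xi.

Lemma lin_boundedD m (r r' : T -> 'cV[R]_m) : lin_bounded r -> lin_bounded r' -> lin_bounded (fun xi => r xi + r' xi).
Proof.
move=> [K K0 rK] [K' K'0 rK']; exists (K + K'); first exact: addr_ge0.
by move=> xi; apply: le_trans (enormD _ _) _; rewrite mulrDl lerD.
Qed.

Lemma lin_boundedN m (r : T -> 'cV[R]_m) : lin_bounded r -> lin_bounded (fun xi => - r xi).
Proof. by move=> [K K0 rK]; exists K => // xi; rewrite enormN. Qed.

Lemma lin_boundedB m (r r' : T -> 'cV[R]_m) : lin_bounded r -> lin_bounded r' -> lin_bounded (fun xi => r xi - r' xi).
Proof. by move=> lr lr'; apply: lin_boundedD => //; exact: lin_boundedN. Qed.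

Lemma lin_boundedM m l (M : 'M[R]_(l, m)) (r : T -> 'cV[R]_m) : lin_bounded r -> lin_bounded (fun xi => M *m r xi).
Proof.
move=> [K K0 rK]; have [K' K'0 MK] := enorm_mulmx M; exists (K' * K); first exact: mulr_ge0.
by move=> xi; apply: le_trans (MK _) _; rewrite -mulrA ler_wpM2l.
Qed.

Lemma lin_boundedZ m (e : T -> R) (r : T -> 'cV[R]_m) : (forall xi, 0 <= e xi <= 1) -> lin_bounded r ->
  lin_bounded (fun xi => e xi *: r xi).
Proof.
move=> e01 [K K0 rK]; exists K => // xi; have /andP[e0 e1] := e01 xi.
by rewrite enormZ ger0_norm//; apply: le_trans (rK xi); rewrite ler_piMl// enorm_ge0.
Qed.

Lemma lin_bounded_le m (r : T -> 'cV[R]_m) : (forall xi, enorm (r xi) <= N xi) -> lin_bounded r.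
Proof. by move=> rN; exists 1 => // xi; rewrite mul1r. Qed.

End linear_bounds.

(** The products [X W] add up to at most [6 kap] and the products [X F] to [4 kap]. Young's
    inequality spends [c / 2] of [X ^+ 2] on each, and the [eps] term in [X ^+ 2] another [c / 2],
    out of [2 c]. What falls on [W ^+ 2], namely [18 kap^2 / c + 3 kap], uses one of the two
    available [la / eps]. *)
Lemma energy_scalar (R : realFieldType) (c la kap eps X W F : R) :
  0 < c -> 0 < la -> 0 <= kap -> 0 < eps -> eps <= 1 ->
  eps * (4 * kap) <= c -> eps * (18 * kap ^+ 2 / c + 3 * kap) <= la ->
  0 <= X -> 0 <= W -> 0 <= F ->
  - (2 * c) * X ^+ 2 + 2 * kap * X * (W + F) + 2 * eps * kap * X * (X + W + F)
    + 2 * kap * W * (X + W + F) - 2 * la / eps * W ^+ 2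
  <= - (c / 2) * X ^+ 2 - la / eps * W ^+ 2 + (8 * kap ^+ 2 / c + kap) * F ^+ 2.
Proof.
move=> c0 la0 k0 e0 e1 ec ela X0 W0 F0.
have XX : 2 * eps * kap * (X * X) <= c / 2 * X ^+ 2.
  rewrite expr2 ler_wpM2r ?mulr_ge0//; lra.
have XW : 2 * eps * kap * (X * W) <= 2 * kap * (X * W).
  by rewrite ler_wpM2r ?mulr_ge0// -mulrA ler_wpM2l// ler_piMl.
have XF : 2 * eps * kap * (X * F) <= 2 * kap * (X * F).
  by rewrite ler_wpM2r ?mulr_ge0// -mulrA ler_wpM2l// ler_piMl.
have Y1 : 6 * kap * (X * W) <= c / 2 * X ^+ 2 + 18 * kap ^+ 2 / c * W ^+ 2.
  rewrite -subr_ge0 (_ : _ - _ = (c * X - 6 * kap * W) ^+ 2 / (2 * c)); last by field; rewrite gt_eqF.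
  by rewrite divr_ge0 ?sqr_ge0// mulr_ge0// ltW.
have Y2 : 4 * kap * (X * F) <= c / 2 * X ^+ 2 + 8 * kap ^+ 2 / c * F ^+ 2.
  rewrite -subr_ge0 (_ : _ - _ = (c * X - 4 * kap * F) ^+ 2 / (2 * c)); last by field; rewrite gt_eqF.
  by rewrite divr_ge0 ?sqr_ge0// mulr_ge0// ltW.
have Y3 : 2 * kap * (W * F) <= kap * W ^+ 2 + kap * F ^+ 2.
  rewrite -subr_ge0 (_ : _ - _ = kap * (W - F) ^+ 2); last by ring.
  by rewrite mulr_ge0 ?sqr_ge0.
have Y4 : (18 * kap ^+ 2 / c + 3 * kap) * W ^+ 2 <= la / eps * W ^+ 2.
  by rewrite ler_wpM2r ?sqr_ge0// ler_pdivlMr// mulrC.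
lra.
Qed.

(** * The block system under the family of feedbacks *)

Section block_lq.
Variables (R : realType) (n q s : nat).
Variables (A1 D1 P Q : 'M[R]_n) (A2 : 'M[R]_(n, s)) (A3 : 'M[R]_(s, n)) (A4 : 'M[R]_s)
  (Bt : 'M[R]_(n, q)) (H2 : 'M[R]_(s, q)) (D2 P30 : 'M[R]_s) (Gt : 'M[R]_q)
  (f : R -> 'cV[R]_(n + s)) (h : R -> 'cV[R]_n) (z0 : 'cV[R]_(n + s)) (c gam CF : R).
Let A := block_mx A1 A2 A3 A4.
Let B : 'M[R]_(n + s, q + s) := block_mx Bt 0 H2 1%:M.
Let D := block_mx D1 0 0 D2.
Let G : 'M[R]_(q + s) := block_mx Gt 0 0 0.
Let S0 := A2 *m invmx D2 *m A2^T + Bt *m invmx Gt *m Bt^T.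
Let A0 := A1 - S0 *m P.
Let R1 := invmx Gt *m Bt^T.
Let R2 := invmx D2 *m A2^T.
Let f1 t := usubmx (f t).
Hypotheses (pdD2 : pd_mx D2) (pdGt : pd_mx Gt) (pdP30 : pd_mx P30) (psdD1 : psd_mx D1)
  (ric : riccati_sol A1 S0 D1 P) (pdQ : pd_mx Q) (c0 : 0 < c)
  (Qc : forall x, dot x (Q *m (A0 *m x)) <= - c * enorm x ^+ 2)
  (gam0 : 0 < gam) (mf : meas_vec f)
  (dh : acdmx h (fun t => - (A0^T *m h t) - P *m f1 t))
  (fhF : forall t, 0 <= t -> enorm (h t) + enorm (f t) <= CF * expR (- gam * t)).

(* [w] is the deviation of the fast variable from the slow manifold.  The control
   [u_{eps,2}] is the case [N1 = N2 = 0], and [u_{eps,1}] another one ([u1E]). *)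
Definition block_feedback (N1 : 'M[R]_(q, n)) (N2 : 'M[R]_(q, s)) (eps : R) :
    feedback R (n + s) (q + s) := fun z t =>
  let k := P *m usubmx z + h t in
  let w := dsubmx z + R2 *m k in
  col_mx (- (R1 *m k) + eps *: (N1 *m k + N2 *m w)) (- (eps^-1 *: (P30 *m w))).

(** Substituting the feedback produces [A2 R2 k + Bt R1 k = S0 k], so [x] is driven by [A0] up to
    terms in [w], [h], [f] and terms carrying a factor [eps]. In the fast equation all but
    [- eps^-1 P30 w] is bounded uniformly in [eps]; [la] is the coercivity constant of [P30]. *)
Lemma energy_pointwise (N1 : 'M[R]_(q, n)) (N2 : 'M[R]_(q, s)) :
  exists la, 0 < la /\ exists kap, 0 <= kap /\ forall eps (x : 'cV[R]_n) (w : 'cV[R]_s) (h : 'cV[R]_n) (f : 'cV[R]_(n + s)),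
    0 < eps -> eps <= 1 ->
    let k := P *m x + h in
    let y := w - R2 *m k in
    let u := - (R1 *m k) + eps *: (N1 *m k + N2 *m w) in
    let dx := A1 *m x + A2 *m y + Bt *m u + usubmx f in
    let dk := P *m dx + (- (A0^T *m h) - P *m usubmx f) in
    let dw := A3 *m x + A4 *m y + H2 *m u - eps^-1 *: (P30 *m w) + dsubmx f + R2 *m dk in
    let F := enorm h + enorm f in
    2 * dot x (Q *m dx) <= - (2 * c) * enorm x ^+ 2 + 2 * kap * enorm x * (enorm w + F)
        + 2 * eps * kap * enorm x * (enorm x + enorm w + F) /\
    2 * dot w dw <= 2 * kap * enorm w * (enorm x + enorm w + F) - 2 * la / eps * enorm w ^+ 2.
Proof.
have [la la0 laP] := pd_coercive pdP30.
exists la; split=> //.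
(* [eps] itself is part of the data, confined to [[0, 1]], so that [kap] does not depend on it. *)
pose T : Type := ({e : R | 0 <= e <= 1} * 'cV[R]_n * 'cV[R]_s * 'cV[R]_n * 'cV[R]_(n + s))%type.
pose xe (xi : T) := sval xi.1.1.1.1; pose xx (xi : T) := xi.1.1.1.2; pose xw (xi : T) := xi.1.1.2.
pose xh (xi : T) := xi.1.2; pose xf (xi : T) := xi.2.
pose NF (xi : T) := enorm (xw xi) + (enorm (xh xi) + enorm (xf xi)).
pose NX (xi : T) := enorm (xx xi) + enorm (xw xi) + (enorm (xh xi) + enorm (xf xi)).
have xe01 xi : 0 <= xe xi <= 1 by exact: (svalP xi.1.1.1.1).
have NF0 xi : 0 <= NF xi by rewrite !addr_ge0 ?enorm_ge0.
have NX0 xi : 0 <= NX xi by rewrite !addr_ge0 ?enorm_ge0.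
have enonneg m (v : 'cV[R]_m) := enorm_ge0 v.
have uf xi : enorm (usubmx (xf xi)) <= enorm (xf xi) by exact: enorm_usubmx.
have df xi : enorm (dsubmx (xf xi)) <= enorm (xf xi) by exact: enorm_dsubmx.
have Fw : lin_bounded NF xw by apply: lin_bounded_le => xi; rewrite /NF lerDl addr_ge0.
have Fh : lin_bounded NF xh by apply: lin_bounded_le => xi; rewrite /NF addrCA lerDl addr_ge0.
have Ff1 : lin_bounded NF (fun xi => usubmx (xf xi)).
  by apply: lin_bounded_le => xi; apply: le_trans (uf xi) _; rewrite /NF addrA lerDr addr_ge0.
have Xx : lin_bounded NX xx by apply: lin_bounded_le => xi; rewrite /NX -addrA lerDl !addr_ge0.
have Xw : lin_bounded NX xw by apply: lin_bounded_le => xi; rewrite /NX -addrA addrCA lerDl !addr_ge0.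
have Xh : lin_bounded NX xh by apply: lin_bounded_le => xi; rewrite /NX addrCA lerDl !addr_ge0.
have Xf1 : lin_bounded NX (fun xi => usubmx (xf xi)).
  by apply: lin_bounded_le => xi; apply: le_trans (uf xi) _; rewrite /NX addrA lerDr !addr_ge0.
have Xf2 : lin_bounded NX (fun xi => dsubmx (xf xi)).
  by apply: lin_bounded_le => xi; apply: le_trans (df xi) _; rewrite /NX addrA lerDr !addr_ge0.
pose k xi := P *m xx xi + xh xi.
pose y xi := xw xi - R2 *m k xi.
pose v xi := N1 *m k xi + N2 *m xw xi.
pose u xi := - (R1 *m k xi) + xe xi *: v xi.
pose dx xi := A1 *m xx xi + A2 *m y xi + Bt *m u xi + usubmx (xf xi).
pose dk xi := P *m dx xi + (- (A0^T *m xh xi) - P *m usubmx (xf xi)).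
pose r xi := A3 *m xx xi + A4 *m y xi + H2 *m u xi + dsubmx (xf xi) + R2 *m dk xi.
have Xk : lin_bounded NX k by apply: lin_boundedD => //; exact: lin_boundedM.
have Xy : lin_bounded NX y by apply: lin_boundedB => //; exact: lin_boundedM.
have Xv : lin_bounded NX v by apply: lin_boundedD; exact: lin_boundedM.
have Xu : lin_bounded NX u by apply: lin_boundedD; [apply/lin_boundedN/lin_boundedM | exact: lin_boundedZ].
have Xdx : lin_bounded NX dx by apply: lin_boundedD => //; apply: lin_boundedD; [apply: lin_boundedD|]; exact: lin_boundedM.
have Xdk : lin_bounded NX dk by apply: lin_boundedD; [exact: lin_boundedM | apply: lin_boundedB; [apply/lin_boundedN/lin_boundedM | exact: lin_boundedM]].
have [K3 K30 rK] : lin_bounded NX r.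
  by apply: lin_boundedD; [apply: lin_boundedD => //; apply: lin_boundedD; [apply: lin_boundedD|]|]; exact: lin_boundedM.
(* The part of the slow drift free of both [x] and [eps]; it is measured by [NF], which does not
   contain [x]. *)
pose e1 xi := A2 *m xw xi - S0 *m xh xi + usubmx (xf xi).
have dxE xi : dx xi = A0 *m xx xi + e1 xi + xe xi *: (Bt *m v xi).
  have SP : A2 *m (R2 *m k xi) = S0 *m (P *m xx xi) + S0 *m xh xi - Bt *m (R1 *m k xi).
    by rewrite -mulmxDr -/(k xi) [S0 *m _]mulmxDl /R1 /R2 !mulmxA addrK.
  rewrite /dx /e1 /u /y [A2 *m (_ - _)]mulmxBr [Bt *m (- _ + _)]mulmxDr mulmxN -scalemxAr /A0 mulmxBl -(mulmxA S0) SP.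
  move: (A1 *m _) (A2 *m xw xi) (S0 *m (P *m _)) (S0 *m xh xi) (Bt *m (R1 *m _)) (_ *: _) (usubmx _).
  by move=> ? ? ? ? ? ? ?; apply/colP => i; rewrite !mxE; ring.
have [K1 K10 eK1] : lin_bounded NF (fun xi => Q *m e1 xi).
  by apply: lin_boundedM; apply: lin_boundedD => //; apply: lin_boundedB; exact: lin_boundedM.
have [K2 K20 eK2] : lin_bounded NX (fun xi => Q *m (Bt *m v xi)) by apply/lin_boundedM/lin_boundedM.
exists (K1 + K2 + K3); split; first by rewrite !addr_ge0.
move=> eps x w hh ff eps0 eps1.
have eps01 : 0 <= eps <= 1 by rewrite (ltW eps0).
pose xi : T := (exist _ eps eps01, x, w, hh, ff).
move=> k' y' u' dx' dk' dw' F.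
have -> : dw' = r xi - eps^-1 *: (P30 *m w).
  by rewrite /dw' [X in X + R2 *m _]addrAC [LHS]addrAC.
have -> : dx' = dx xi by [].
have NFE : NF xi = enorm w + F by [].
have NXE : NX xi = enorm x + enorm w + F by [].
split.
  have -> : dot x (Q *m dx xi)
      = dot x (Q *m (A0 *m x)) + dot x (Q *m e1 xi) + eps * dot x (Q *m (Bt *m v xi)).
    rewrite dxE; move: (e1 xi) (v xi) => a b.
    by rewrite !mulmxDr -scalemxAr !dotDr dotZr.
  have h1 := Qc x.
  have h2 : dot x (Q *m e1 xi) <= K1 * enorm x * (enorm w + F).
    apply: le_trans (le_trans (ler_norm _) (dot_le _ _)) _.
    by rewrite -mulrA mulrCA ler_wpM2l//; rewrite -NFE; exact: eK1.
  have h3 : dot x (Q *m (Bt *m v xi)) <= K2 * enorm x * (enorm x + enorm w + F).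
    apply: le_trans (le_trans (ler_norm _) (dot_le _ _)) _.
    by rewrite -mulrA mulrCA ler_wpM2l//; rewrite -NXE; exact: eK2.
  have h4 : eps * dot x (Q *m (Bt *m v xi)) <= eps * (K2 * enorm x * (enorm x + enorm w + F)).
    by rewrite ler_wpM2l// ltW.
  have p1 : 0 <= (K2 + K3) * (enorm x * (enorm w + F)) by rewrite !(mulr_ge0, addr_ge0).
  have p2 : 0 <= eps * ((K1 + K3) * (enorm x * (enorm x + enorm w + F))).
    by rewrite mulr_ge0 ?(ltW eps0)// !(mulr_ge0, addr_ge0).
  lra.
have -> : dot w (r xi - eps^-1 *: (P30 *m w)) = dot w (r xi) - eps^-1 * dot w (P30 *m w).
  by rewrite dotDr dotNr dotZr.
have h1 : dot w (r xi) <= K3 * enorm w * (enorm x + enorm w + F).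
  apply: le_trans (le_trans (ler_norm _) (dot_le _ _)) _.
  by rewrite -mulrA mulrCA ler_wpM2l//; rewrite -NXE; exact: rK.
have h2 : la / eps * enorm w ^+ 2 <= eps^-1 * dot w (P30 *m w).
  by rewrite (mulrC la) -mulrA ler_wpM2l ?invr_ge0 ?(ltW eps0)//; rewrite -quadE; exact: laP.
have p1 : 0 <= (K1 + K2) * (enorm w * (enorm x + enorm w + F)) by rewrite !(mulr_ge0, addr_ge0).
lra.
Qed.

Lemma block_dynamics (z : R -> 'cV[R]_(n + s)) (U : R -> 'cV[R]_(q + s)) :
  acdmx z (fun t => A *m z t + B *m U t + f t) ->
  acdmx (fun t => usubmx (z t))
    (fun t => A1 *m usubmx (z t) + A2 *m dsubmx (z t) + Bt *m usubmx (U t) + f1 t) /\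
  acdmx (fun t => dsubmx (z t))
    (fun t => A3 *m usubmx (z t) + A4 *m dsubmx (z t) + H2 *m usubmx (U t) + dsubmx (U t)
              + dsubmx (f t)).
Proof.
move=> dz.
have E t : A *m z t + B *m U t + f t = col_mx
    (A1 *m usubmx (z t) + A2 *m dsubmx (z t) + Bt *m usubmx (U t) + f1 t)
    (A3 *m usubmx (z t) + A4 *m dsubmx (z t) + H2 *m usubmx (U t) + dsubmx (U t)
      + dsubmx (f t)).
  rewrite -{1}(vsubmxK (z t)) -{1}(vsubmxK (U t)) -{1}(vsubmxK (f t)) !mul_block_col.
  by rewrite mul0mx addr0 mul1mx !add_col_mx !addrA.
split=> i j.
  by have := dz (lshift s i) j; under [X in acd _ X]eq_fun do rewrite E col_mxEu;
     under eq_fun do rewrite -[z _]vsubmxK col_mxEu.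
by have := dz (rshift n i) j; under [X in acd _ X]eq_fun do rewrite E col_mxEd;
   under eq_fun do rewrite -[z _]vsubmxK col_mxEd.
Qed.

(** The energy is [quad Q x + |w|^2] divided by [mu = min (c / 2) la], which normalizes the
    dissipation to [|x|^2 + eps^-1 |w|^2]. The forcing enters squared, hence the rate [2 gam]. The
    initial energy depends on [z0] and [h 0] but not on [eps]. *)
Lemma closed_loop_energy (N1 : 'M[R]_(q, n)) (N2 : 'M[R]_(q, s)) :
  exists e0 : R, exists K : R, [/\ 0 < e0, e0 <= 1, 0 < K &
  forall eps, 0 < eps -> eps <= e0 -> forall z : R -> 'cV[R]_(n + s), z 0 = z0 ->
  acdmx z (fun t => A *m z t + B *m block_feedback N1 N2 eps (z t) t + f t) ->
  exists V : R -> R, exists V' : R -> R, [/\ acd V V', V 0 <= K &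
  forall t, 0 <= t ->
    let x := usubmx (z t) in let w := dsubmx (z t) + R2 *m (P *m x + h t) in
    [/\ enorm x ^+ 2 + enorm w ^+ 2 <= K * V t,
        V t <= K * (enorm x ^+ 2 + enorm w ^+ 2) &
        0 < t -> enorm x ^+ 2 + eps^-1 * enorm w ^+ 2 <= - V' t + K * expR (- (2 * gam) * t)]]].
Proof.
have [la [la0 [kap [kap0 E]]]] := energy_pointwise N1 N2.
have [d d0 Qd] := pd_coercive pdQ.
have [KQ KQ0 QK] := dot_mulmx_le Q.
have symQ := pdQ.1.
have CF0 : 0 <= CF.
  have := fhF (lexx 0); rewrite mulr0 expR0 mulr1; apply: le_trans.
  by rewrite addr_ge0 ?enorm_ge0.
(* [M] dominates both factors of [eps] in the smallness conditions of [energy_scalar]. *)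
pose M := 1 + 4 * kap + (18 * kap ^+ 2 / c + 3 * kap).
have M2 : 0 <= 18 * kap ^+ 2 / c by rewrite divr_ge0 ?(ltW c0)// mulr_ge0// sqr_ge0.
have M0 : 1 <= M by rewrite /M -addrA lerDl; lra.
pose mu := Num.min (c / 2) la.
have mu0 : 0 < mu by rewrite lt_min la0 divr_gt0.
pose e0 := Num.min 1 (Num.min c la / M).
pose KF := 8 * kap ^+ 2 / c + kap.
have KF0 : 0 <= KF by rewrite addr_ge0// divr_ge0 ?(ltW c0)// mulr_ge0// sqr_ge0.
pose W0 := dsubmx z0 + R2 *m (P *m usubmx z0 + h 0).
pose V0 := (quad Q (usubmx z0) + dot W0 W0) / mu.
have V00 : 0 <= V0.
  by rewrite divr_ge0 ?(ltW mu0)// addr_ge0 ?dot_ge0//; exact: (pd_psd pdQ).2.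
pose d1 := Num.min d 1.
have d10 : 0 < d1 by rewrite lt_min d0 ltr01.
(* The summands serve in turn positivity, the initial energy, the two comparisons of [V] with
   [|x|^2 + |w|^2], and the forcing. *)
pose K := 1 + V0 + mu / d1 + (KQ + 1) / mu + KF * CF ^+ 2 / mu.
have K1 : 0 <= mu / d1 by rewrite divr_ge0 ?ltW.
have K2 : 0 <= (KQ + 1) / mu by rewrite divr_ge0 ?(ltW mu0)// addr_ge0.
have K3 : 0 <= KF * CF ^+ 2 / mu by rewrite divr_ge0 ?(ltW mu0)// mulr_ge0 ?sqr_ge0.
have e00 : 0 < e0 by rewrite lt_min ltr01 divr_gt0 ?lt_min ?c0//; lra.
exists e0, K; split => //; first by rewrite ge_min lexx.
  by rewrite /K; lra.
move=> eps eps0; rewrite le_min => /andP[eps1 epsM] z z00 dz.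
have {}epsM : eps * M <= Num.min c la by rewrite -ler_pdivlMr//; lra.
have ec : eps * (4 * kap) <= c.
  have : eps * M <= c by apply: le_trans epsM _; rewrite ge_min lexx.
  by apply: le_trans; rewrite ler_wpM2l ?(ltW eps0)// /M; lra.
have el : eps * (18 * kap ^+ 2 / c + 3 * kap) <= la.
  have : eps * M <= la by apply: le_trans epsM _; rewrite ge_min lexx orbT.
  by apply: le_trans; rewrite ler_wpM2l ?(ltW eps0)// /M; lra.
have [dx dy] := block_dynamics dz.
pose x t := usubmx (z t); pose k t := P *m x t + h t; pose w t := dsubmx (z t) + R2 *m k t.
pose x' t := A1 *m x t + A2 *m dsubmx (z t) + Bt *m usubmx (block_feedback N1 N2 eps (z t) t) + f1 t.
pose y' t := A3 *m x t + A4 *m dsubmx (z t) + H2 *m usubmx (block_feedback N1 N2 eps (z t) t)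
  + dsubmx (block_feedback N1 N2 eps (z t) t) + dsubmx (f t).
pose w' t := y' t + R2 *m (P *m x' t + (- (A0^T *m h t) - P *m f1 t)).
have dw : acdmx w w'.
  by apply: acdmxD; [exact: dy | apply/acdmx_mull/acdmxD; [exact: acdmx_mull|exact: dh]].
have dV := acdZ (mu^-1) (acdD (acd_quad symQ dx) (acd_dot dw dw)).
eexists; eexists; split; first exact: dV.
  rewrite /w /k /x z00 -/W0 mulrC -/V0 /K; lra.
move=> t t0 /=; rewrite -/(x t) -/(k t) -/(w t).
have X0 := enorm_ge0 (x t); have WW0 := enorm_ge0 (w t).
have XW0 : 0 <= enorm (x t) ^+ 2 + enorm (w t) ^+ 2 by rewrite addr_ge0 ?sqr_ge0.
have Qx : quad Q (x t) <= KQ * enorm (x t) ^+ 2.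
  by rewrite quadE expr2; apply: le_trans (ler_norm _) (QK _ _).
have Qx0 : 0 <= quad Q (x t) by exact: (pd_psd pdQ).2.
rewrite -sqr_enorm.
split.
- have h1 : d1 * (enorm (x t) ^+ 2 + enorm (w t) ^+ 2) <= quad Q (x t) + enorm (w t) ^+ 2.
    rewrite mulrDr; apply: lerD.
      by apply: le_trans (Qd _); rewrite ler_wpM2r ?sqr_ge0// ge_min lexx.
    by rewrite ler_piMl ?sqr_ge0// ge_min lexx orbT.
  apply: (@le_trans _ _ (mu / d1 * (mu^-1 * (quad Q (x t) + enorm (w t) ^+ 2)))).
    rewrite mulrA (_ : mu / d1 / mu = d1^-1); last by field; rewrite !gt_eqF.
    by rewrite ler_pdivlMl.
  rewrite ler_wpM2r ?mulr_ge0 ?invr_ge0 ?(ltW mu0) ?addr_ge0 ?sqr_ge0// /K; lra.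
- apply: (@le_trans _ _ ((KQ + 1) / mu * (enorm (x t) ^+ 2 + enorm (w t) ^+ 2))).
    rewrite (mulrC (KQ + 1)) -mulrA ler_wpM2l ?invr_ge0 ?(ltW mu0)//.
    have := mulr_ge0 KQ0 (sqr_ge0 (enorm (w t))); have := sqr_ge0 (enorm (x t)); lra.
  rewrite ler_wpM2r// /K; lra.
move=> t1; rewrite -/(x' t) -/(w' t).
have yE : dsubmx (z t) = w t - R2 *m k t by rewrite /w addrK.
have uE : usubmx (block_feedback N1 N2 eps (z t) t)
    = - (R1 *m k t) + eps *: (N1 *m k t + N2 *m w t) by exact: col_mxKu.
have u2E : dsubmx (block_feedback N1 N2 eps (z t) t) = - (eps^-1 *: (P30 *m w t)).
  exact: col_mxKd.
have := E eps (x t) (w t) (h t) (f t) eps0 eps1.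
rewrite /= -/(k t) -uE -yE -u2E -/(f1 t) -/(x' t) -/(y' t) -/(w' t) => -[H1 H3].
have F0 : 0 <= enorm (h t) + enorm (f t) by rewrite addr_ge0 ?enorm_ge0.
have := energy_scalar c0 la0 kap0 eps0 eps1 ec el X0 WW0 F0.
move: H1 H3; set XX := dot _ _; set WW := dot _ (w' t) => H1 H3 H4.
have F2 : KF * (enorm (h t) + enorm (f t)) ^+ 2 <= KF * CF ^+ 2 * expR (- (2 * gam) * t).
  rewrite -mulrA ler_wpM2l//.
  have -> : expR (- (2 * gam) * t) = expR (- gam * t) ^+ 2.
    by rewrite -expRM_natl; congr expR; ring.
  by rewrite -exprMn lerXn2r ?nnegrE ?mulr_ge0 ?expR_ge0//; exact: fhF.
have -> : dot (w' t) (w t) = WW by exact: dotC.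
have mc : mu * enorm (x t) ^+ 2 <= c / 2 * enorm (x t) ^+ 2.
  by rewrite ler_wpM2r ?sqr_ge0// ge_min lexx.
have ml : mu * (eps^-1 * enorm (w t) ^+ 2) <= la * (eps^-1 * enorm (w t) ^+ 2).
  by rewrite ler_wpM2r ?mulr_ge0 ?invr_ge0 ?(ltW eps0) ?sqr_ge0// ge_min lexx orbT.
have E0 := expR_ge0 (- (2 * gam) * t).
have h5 : mu * (enorm (x t) ^+ 2 + eps^-1 * enorm (w t) ^+ 2)
    <= - (2 * XX + (WW + WW)) + KF * CF ^+ 2 * expR (- (2 * gam) * t).
  move: H1 H3 H4 F2 mc ml; rewrite -/KF; lra.
rewrite -(ler_pM2l mu0); apply: le_trans h5 _.
rewrite mulrDr mulrN (mulVKf (lt0r_neq0 mu0)) lerD2l (mulrA mu).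
apply: ler_wpM2r => //; rewrite -ler_pdivrMl// mulrC /K; lra.
Qed.

(** Pointwise decay uses only [eps^-1 >= 1]. The inequality with the full weight [eps^-1] on [|w|^2]
    is kept, since the estimate of order [eps] for the excess cost rests on it. *)
Lemma closed_loop_decay (N1 : 'M[R]_(q, n)) (N2 : 'M[R]_(q, s)) :
  exists e0 : R, exists K : R, exists mu : R, [/\ 0 < e0 <= 1, 0 < K, 0 < mu <= gam &
  forall eps, 0 < eps -> eps <= e0 -> forall z : R -> 'cV[R]_(n + s), z 0 = z0 ->
  acdmx z (fun t => A *m z t + B *m block_feedback N1 N2 eps (z t) t + f t) ->
  exists V : R -> R, exists V' : R -> R, [/\ acd V V', V 0 <= K &
  forall t, 0 <= t ->
    let x := usubmx (z t) in let w := dsubmx (z t) + R2 *m (P *m x + h t) in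
    [/\ 0 <= V t, enorm x ^+ 2 + enorm w ^+ 2 <= K * expR (- mu * t) &
        0 < t -> enorm x ^+ 2 + eps^-1 * enorm w ^+ 2 <= - V' t + K * expR (- (2 * gam) * t)]]].
Proof.
have [e0 [K [e00 e01 K0 E]]] := closed_loop_energy N1 N2.
have K1 : 0 <= K / gam by rewrite divr_ge0 ?ltW.
pose K' := K + K * (K + K / gam).
have K'0 : K <= K' by rewrite /K' lerDl mulr_ge0 ?(ltW K0)// addr_ge0 ?(ltW K0).
exists e0, K', (Num.min K^-1 gam); split.
- by rewrite e00.
- exact: lt_le_trans K'0.
- by rewrite lt_min invr_gt0 K0 gam0 ge_min lexx orbT.
move=> eps eps0 epse z z00 dz; have [V [V' [dV V0 VE]]] := E eps eps0 epse z z00 dz.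
exists V, V'; split => //; first exact: le_trans K'0.
move=> t t0 /=; have [h1 h2 h3] := VE t t0.
have Vt : 0 <= V t by rewrite -(pmulr_rge0 _ K0); apply: le_trans h1; rewrite addr_ge0 ?sqr_ge0.
split => //.
- apply: le_trans h1 _.
  pose Y t := enorm (usubmx (z t)) ^+ 2
    + enorm (dsubmx (z t) + R2 *m (P *m usubmx (z t) + h t)) ^+ 2.
  have := @expR_decay R V V' Y K gam dV K0 gam0 V0.
  move=> /(_ _ _ _ t t0) H; apply: (@le_trans _ _ (K * ((K + K / gam) * expR (- Num.min K^-1 gam * t)))).
    rewrite ler_wpM2l ?(ltW K0)//; apply: H => v v0.
    + by rewrite addr_ge0 ?sqr_ge0.
    + by have [_ ? _] := VE v (ltW v0).
    have [_ _ /(_ v0)] := VE v (ltW v0); apply: le_trans.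
    rewrite lerD2l ler_peMl ?sqr_ge0// -(invr1 R) lef_pV2 ?posrE//.
    exact: le_trans e01.
  by rewrite mulrA ler_wpM2r ?expR_ge0// /K' lerDr ltW.
by move=> /h3 => /le_trans; apply; rewrite lerD2l ler_wpM2r ?expR_ge0.
Qed.

Lemma block_feedback_affine (N1 : 'M[R]_(q, n)) (N2 : 'M[R]_(q, s)) eps :
  exists Kz : 'M[R]_(q + s, n + s), exists Kh : 'M[R]_(q + s, n),
    forall z t, block_feedback N1 N2 eps z t = Kz *m z + Kh *m h t.
Proof.
(* The feedback formula is linear in [k] and [w]; evaluated on matrices in place of columns it
   directly yields the gains for [z] and [h]. *)
pose fbmx m (k : 'M[R]_(n, m)) (w : 'M[R]_(s, m)) :=
  col_mx (- (R1 *m k) + eps *: (N1 *m k + N2 *m w)) (- (eps^-1 *: (P30 *m w))).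
pose kz := P *m row_mx 1%:M (0 : 'M[R]_(n, s)); pose wz := row_mx 0 1%:M + R2 *m kz.
exists (fbmx _ kz wz), (fbmx _ 1%:M R2) => z t.
have kE : P *m usubmx z + h t = kz *m z + 1%:M *m h t.
  by rewrite -{2}(vsubmxK z) /kz -mulmxA mul_row_col !mul1mx mul0mx addr0.
have wE : dsubmx z + R2 *m (P *m usubmx z + h t) = wz *m z + R2 *m h t.
  rewrite kE /wz mulmxDl -{3}(vsubmxK z) mul_row_col mul0mx add0r mul1mx.
  by rewrite mulmxDr !mul1mx -mulmxA addrA.
rewrite /block_feedback /= wE kE /fbmx !mul_col_mx add_col_mx; clearbody kz wz.
congr col_mx.
  rewrite !mulmx1 mul1mx !mulmxDl !mulNmx -!scalemxAl !mulmxDl !mulmxDr -!mulmxA.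
  move: (invmx Gt *m _) (invmx Gt *m _) (N1 *m _) (N1 *m _) (N2 *m _) (N2 *m _) => a1 a2 a3 a4 a5 a6.
  by apply/colP => i; rewrite !mxE; ring.
by rewrite !mulNmx -!scalemxAl !mulmxDr !mulmxA scalerDr opprD.
Qed.

Let expR_sqr (t : R) : expR (- gam * t) ^+ 2 = expR (- (2 * gam) * t).
Proof. by rewrite -expRM_natl; congr expR; ring. Qed.

Let CF_ge0 : 0 <= CF.
Proof.
have := fhF (lexx 0); rewrite mulr0 expR0 mulr1; apply: le_trans.
by rewrite addr_ge0 ?enorm_ge0.
Qed.

Let enorm_h t : 0 <= t -> enorm (h t) <= CF * expR (- gam * t).
Proof. by move=> t0; apply: le_trans (fhF t0); rewrite lerDl enorm_ge0. Qed.

Let enorm_f t : 0 <= t -> enorm (f t) <= CF * expR (- gam * t).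
Proof. by move=> t0; apply: le_trans (fhF t0); rewrite lerDr enorm_ge0. Qed.

Let locally_bounded_expR m (v : R -> 'cV[R]_m) :
  (forall t, 0 <= t -> enorm (v t) <= CF * expR (- gam * t)) ->
  forall i, locally_bounded (fun t => v t i 0).
Proof.
move=> vE; apply: locally_bounded_enorm => b; exists CF => t /andP[t0 _].
rewrite ger0_norm ?enorm_ge0//; apply: le_trans (vE t t0) _.
by rewrite ler_piMr// expR_le1 mulNr oppr_le0 mulr_ge0// ltW.
Qed.

Lemma block_feedback_admissible (N1 : 'M[R]_(q, n)) (N2 : 'M[R]_(q, s)) :
  exists2 e0 : R, 0 < e0 &
    forall eps, 0 < eps -> eps <= e0 -> admissible A B f z0 (block_feedback N1 N2 eps).
Proof.
have [e0 [K [mu [/andP[e00 e01] K0 /andP[mu0 mug] E]]]] := closed_loop_decay N1 N2.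
exists e0 => // eps eps0 epse.
have [Kz [Kh fbE]] := block_feedback_affine N1 N2 eps.
have mh : meas_vec h by exact: acdmx_meas_vec dh.
have [] := @affine_feedback_sol R _ _ A B f z0 Kz (fun t => Kh *m h t)
  (block_feedback N1 N2 eps) fbE mf.
- exact: meas_vec_mull.
- exact: locally_bounded_expR.
- by apply: locally_bounded_mull; exact: locally_bounded_expR.
move=> mfb lfb [z solz uniq].
(* A class stable under sums and linear maps: it passes from [x], [w] and [h] to [z] and then to the
   control. Its constant may depend on [eps], as the gains do. *)
pose dec m (v : R -> 'cV[R]_m) :=
  exists k : R, forall t, 0 <= t -> enorm (v t) ^+ 2 <= k * expR (- mu * t).
have decD m (v w : R -> 'cV[R]_m) : dec _ v -> dec _ w -> dec _ (fun t => v t + w t).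
  move=> [k vk] [k' wk]; exists (2 * k + 2 * k') => t t0.
  apply: (@le_trans _ _ (2 * enorm (v t) ^+ 2 + 2 * enorm (w t) ^+ 2)).
    apply: (@le_trans _ _ ((enorm (v t) + enorm (w t)) ^+ 2)).
      by rewrite lerXn2r ?nnegrE ?addr_ge0 ?enorm_ge0// enormD.
    by rewrite -subr_ge0; have := sqr_ge0 (enorm (v t) - enorm (w t)); congr (0 <= _); ring.
  have := vk t t0; have := wk t t0; lra.
have decM m l (M : 'M[R]_(l, m)) (v : R -> 'cV[R]_m) : dec _ v -> dec _ (fun t => M *m v t).
  move=> [k vk]; have [KM KM0 MK] := enorm_mulmx M; exists (KM ^+ 2 * k) => t t0.
  apply: (@le_trans _ _ (KM ^+ 2 * enorm (v t) ^+ 2)).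
    by rewrite -exprMn lerXn2r ?nnegrE ?mulr_ge0 ?enorm_ge0.
  by rewrite -mulrA ler_wpM2l ?sqr_ge0// vk.
have L2dec m (v : R -> 'cV[R]_m) : dec _ v -> meas_vec v -> in_L2 v.
  by move=> [k vk] mv; exact: in_L2_expR mu0 mv vk.
have dech : dec _ h.
  exists (CF ^+ 2) => t t0.
  apply: (@le_trans _ _ (CF ^+ 2 * expR (- (2 * gam) * t))).
    by rewrite -expR_sqr -exprMn lerXn2r ?nnegrE ?mulr_ge0 ?expR_ge0 ?enorm_ge0// enorm_h.
  rewrite ler_wpM2l ?sqr_ge0// ler_expR ler_wpM2r//; lra.
have /closed_loop_solP[z00 dz] := solz.
have mz : meas_vec z by exact: acdmx_meas_vec dz.
have [V [V' [_ _ VE]]] := E eps eps0 epse z z00 dz.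
have decx : dec _ (fun t => usubmx (z t)).
  exists K => t t0; have [_ h1 _] := VE t t0; apply: le_trans h1.
  by rewrite lerDl sqr_ge0.
have decw : dec _ (fun t => dsubmx (z t) + R2 *m (P *m usubmx (z t) + h t)).
  exists K => t t0; have [_ h1 _] := VE t t0; apply: le_trans h1.
  by rewrite lerDr sqr_ge0.
have decz : dec _ z.
  have [k yk] := decD _ _ _ decw (decM _ _ (- R2) _ (decD _ _ _ (decM _ _ P _ decx) dech)).
  have [k' xk] := decx; exists (k' + k) => t t0.
  rewrite sqr_enorm_submx mulrDl lerD ?xk//.
  by have := yk t t0; rewrite mulNmx addrK.
split => //; exists z; split => //.
  exact: L2dec decz mz.
apply: L2dec; last first.
  under eq_fun do rewrite fbE.
  by apply: (@meas_vecD R _ (fun t => Kz *m z t) (fun t => Kh *m h t)); exact: meas_vec_mull.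
by move: (decD _ _ _ (decM _ _ Kz _ decz) (decM _ _ Kh _ dech)); under eq_fun do rewrite -fbE.
Qed.

Let cc t := 2 * dot (h t) (f1 t) - quad S0 (h t).

Lemma cc_primitive : exists2 C : R -> R, acd C cc & exists Cinf : R, exists Kc : R,
  forall t, 0 <= t -> `|C t - Cinf| <= Kc * expR (- (2 * gam) * t).
Proof.
have mh : meas_vec h by exact: acdmx_meas_vec dh.
have [KS KS0 SK] := dot_mulmx_le S0.
have mcc : measurable_fun (@halfline R : set (Leb R)) (cc : Leb R -> R).
  apply: measurable_funB; last exact: meas_vec_quad.
  apply: measurable_funM; first exact: measurable_cst.
  exact: (meas_vec_dot mh (meas_vec_submx mf)).
have ccb t : 0 <= t -> `|cc t| <= (2 + KS) * CF ^+ 2 * expR (- (2 * gam) * t).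
  move=> t0; rewrite -expR_sqr -mulrA -exprMn.
  have hh : enorm (h t) * enorm (h t) <= (CF * expR (- gam * t)) ^+ 2.
    by rewrite expr2 ler_pM ?enorm_ge0 ?enorm_h.
  have hf : enorm (h t) * enorm (f1 t) <= (CF * expR (- gam * t)) ^+ 2.
    rewrite expr2 ler_pM ?enorm_ge0 ?enorm_h//.
    exact: le_trans (enorm_usubmx _) (enorm_f t0).
  rewrite [leRHS]mulrDl /cc; apply: le_trans (ler_normB _ _) (lerD _ _).
    rewrite normrM ger0_norm// ler_wpM2l//; exact: le_trans (dot_le _ _) hf.
  rewrite quadE; apply: le_trans (SK _ _) _; exact: ler_wpM2l.
have g2 : 0 < 2 * gam by rewrite mulr_gt0.
have [C dC [Cinf CE]] := expR_primitive g2 mcc ccb.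
by exists C => //; exists Cinf; eexists; exact: CE.
Qed.

Lemma value_derivative (z : R -> 'cV[R]_(n + s)) (U : R -> 'cV[R]_(q + s)) :
  acdmx z (fun t => A *m z t + B *m U t + f t) ->
  acd (fun t => quad P (usubmx (z t)) + 2 * dot (h t) (usubmx (z t)))
    (fun t => let k := P *m usubmx (z t) + h t in
      - (quad D (z t) + quad G (U t))
      + (quad D2 (dsubmx (z t) + R2 *m k) + quad Gt (usubmx (U t) + R1 *m k)) + cc t).
Proof.
move=> dz; have [dx _] := block_dynamics dz; have [[symP _] _] := ric.
have := acdD (acd_quad symP dx) (acdZ 2 (acd_dot dh dx)).
apply: acd_eqr => t _ /=.
have := value_identity pdD2 pdGt ric (usubmx (z t)) (h t) (f1 t) (dsubmx (z t)) (usubmx (U t)).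
move=> /= ->; congr (- _ + _ + _).
by rewrite !quad_block_diag [quad 0 _]quadE mul0mx /dot mulmx0 mxE addr0.
Qed.

(** The chosen [trajectory] agrees with the solution witnessing admissibility only at t >= 0; square
    integrability and measurability are carried over on the half-line. *)
Let trajectory_sol u : admissible A B f z0 u ->
  exists z, [/\ z = trajectory A B f z0 u, z 0 = z0,
    acdmx z (fun t => A *m z t + B *m u (z t) t + f t), in_L2 z & meas_vec (fun t => u (z t) t)].
Proof.
move=> [_ _ [z1 [sol1 uniq L2z [mu _]]]].
pose z := trajectory A B f z0 u.
have solz : closed_loop_sol A B f z0 u z by exact: xgetPex (ex_intro _ z1 sol1).
have zz1 := uniq z solz; have [z00 dz] := (closed_loop_solP _ _ _ _ _ _).1 solz.
exists z; split; [by [] | exact: z00 | exact: dz | |].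
  split; first exact: acdmx_meas_vec dz.
  rewrite (_ : (\int[_]_(t in _) _)%E = (\int[leb R]_(t in halfline (R:=R)) (enorm (z1 t) ^+ 2)%:E)%E).
    exact: L2z.2.
  by apply: eq_integral => t; rewrite inE /halfline/= in_itv/= andbT => t0; rewrite zz1.
move=> i; apply: eq_measurable_fun (mu i) => t; rewrite inE /halfline/= in_itv/= andbT => t0.
by rewrite zz1.
Qed.

Let quad_ge0 (z : 'cV[R]_(n + s)) (u : 'cV[R]_(q + s)) : 0 <= quad D z + quad G u.
Proof.
rewrite !quad_block_diag; have q0 : quad (0 : 'M[R]_s) (dsubmx u) = 0.
  by rewrite quadE mul0mx /dot mulmx0 mxE.
rewrite q0 addr0; apply: addr_ge0; last exact: (pd_psd pdGt).2.
by apply: addr_ge0; [exact: psdD1.2 | exact: (pd_psd pdD2).2].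
Qed.

Let value_le : exists2 K : R, 0 <= K & forall (x : 'cV[R]_n) t, 0 <= t ->
  `|quad P x + 2 * dot (h t) x| <= K * (enorm x ^+ 2 + enorm (h t) * enorm x).
Proof.
have [KP KP0 PK] := dot_mulmx_le P; exists (KP + 2); first exact: addr_ge0.
move=> x t t0; apply: le_trans (ler_normD _ _) _.
have h1 : `|quad P x| <= KP * enorm x ^+ 2 by rewrite quadE expr2; exact: PK.
have h2 : `|2 * dot (h t) x| <= 2 * (enorm (h t) * enorm x).
  by rewrite normrM ger0_norm// ler_wpM2l// dot_le.
have h3 := mulr_ge0 KP0 (mulr_ge0 (enorm_ge0 (h t)) (enorm_ge0 x)).
have h4 := sqr_ge0 (enorm x).
by apply: le_trans (lerD h1 h2) _; lra.
Qed.

(** [|w|^2] is [eps] times [eps^-1 |w|^2], and the slow control deviation contributes a factor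
    [eps ^+ 2]. Both are thus [eps] times the dissipation of the energy, up to [|h|^2]. *)
Lemma excess_cost_le (N1 : 'M[R]_(q, n)) (N2 : 'M[R]_(q, s)) : exists2 K : R, 0 <= K &
  forall eps (x : 'cV[R]_n) (w : 'cV[R]_s) (v : 'cV[R]_n), 0 < eps -> eps <= 1 ->
  quad D2 w + quad Gt (eps *: (N1 *m (P *m x + v) + N2 *m w))
  <= eps * K * (enorm x ^+ 2 + eps^-1 * enorm w ^+ 2 + enorm v ^+ 2).
Proof.
have [KD KD0 DK] := dot_mulmx_le D2; have [KG KG0 GK] := dot_mulmx_le Gt.
have [K1 K10 NP] := enorm_mulmx (N1 *m P); have [K2 K20 N1K] := enorm_mulmx N1.
have [K3 K30 N2K] := enorm_mulmx N2.
pose K4 := 3 * (K1 ^+ 2 + K2 ^+ 2 + K3 ^+ 2).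
have K40 : 0 <= K4 by rewrite mulr_ge0// !addr_ge0 ?sqr_ge0.
exists (KD + KG * K4); first by rewrite addr_ge0// mulr_ge0.
move=> eps x w v eps0 eps1.
set X := enorm x; set W := enorm w; set H := enorm v.
have X0 : 0 <= X by exact: enorm_ge0.
have W0 : 0 <= W by exact: enorm_ge0.
have H0 : 0 <= H by exact: enorm_ge0.
have ei : 1 <= eps^-1 by rewrite -(invr1 R) lef_pV2 ?posrE.
set S := X ^+ 2 + eps^-1 * W ^+ 2 + H ^+ 2.
have WS : W ^+ 2 <= eps^-1 * W ^+ 2 by rewrite ler_peMl ?sqr_ge0.
have S0' : 0 <= S by rewrite !addr_ge0 ?mulr_ge0 ?sqr_ge0// (le_trans _ ei).
have hD : quad D2 w <= eps * KD * S.
  apply: (@le_trans _ _ (KD * W ^+ 2)); first by rewrite quadE expr2; apply: le_trans (ler_norm _) (DK _ _).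
  apply: (@le_trans _ _ (eps * KD * (eps^-1 * W ^+ 2))).
    by rewrite [leRHS](_ : _ = KD * W ^+ 2)//; field; rewrite gt_eqF.
  by rewrite ler_wpM2l ?mulr_ge0 ?(ltW eps0)// /S; have := sqr_ge0 X; have := sqr_ge0 H; lra.
have hN : enorm (N1 *m (P *m x + v) + N2 *m w) <= K1 * X + K2 * H + K3 * W.
  apply: le_trans (enormD _ _) (lerD _ (N2K _)).
  by rewrite mulmxDr mulmxA; apply: le_trans (enormD _ _) (lerD (NP _) (N1K _)).
have hN2 : enorm (N1 *m (P *m x + v) + N2 *m w) ^+ 2 <= K4 * S.
  apply: (@le_trans _ _ ((K1 * X + K2 * H + K3 * W) ^+ 2)).
    by rewrite lerXn2r ?nnegrE ?enorm_ge0// (le_trans (enorm_ge0 _) hN).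
  apply: (@le_trans _ _ (3 * (K1 ^+ 2 * X ^+ 2 + K2 ^+ 2 * H ^+ 2 + K3 ^+ 2 * W ^+ 2))).
    have := sqr_ge0 (K1 * X - K2 * H); have := sqr_ge0 (K1 * X - K3 * W).
    by have := sqr_ge0 (K2 * H - K3 * W); lra.
  rewrite /K4 -mulrA ler_wpM2l// !mulrDl.
  have le1 (a b : R) : b <= S -> a ^+ 2 * b <= a ^+ 2 * S by move=> ?; rewrite ler_wpM2l ?sqr_ge0.
  have x2 := sqr_ge0 X; have h2 := sqr_ge0 H; have w2 := sqr_ge0 W.
  by apply: lerD; [apply: lerD|]; apply: le1; rewrite /S; lra.
have hG : quad Gt (eps *: (N1 *m (P *m x + v) + N2 *m w)) <= eps * (KG * K4) * S.
  set Y := _ + _ in hN hN2 *.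
  rewrite quadE -scalemxAr dotZl dotZr.
  have h1 : dot Y (Gt *m Y) <= KG * (K4 * S).
    apply: le_trans (ler_norm _) (le_trans (GK _ _) _).
    by rewrite -expr2 ler_wpM2l.
  apply: (@le_trans _ _ (eps * (eps * (KG * (K4 * S))))).
    by rewrite !ler_wpM2l ?(ltW eps0).
  rewrite (_ : eps * (KG * K4) * S = eps * (KG * (K4 * S))); last by rewrite !mulrA.
  rewrite ler_wpM2l ?(ltW eps0)// ler_piMl//.
  by apply/mulr_ge0/mulr_ge0.
by move: hD hG; lra.
Qed.

(** * Two-sided bounds for the cost *)

Section optimal_value.
Variables (C : R -> R) (Cinf Kc : R).
Hypotheses (dC : acd C cc)
  (CE : forall t, 0 <= t -> `|C t - Cinf| <= Kc * expR (- (2 * gam) * t)).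
(* [Cinf - C 0] is the integral of [cc] over the half-line. *)
Let J0 := quad P (usubmx z0) + 2 * dot (h 0) (usubmx z0) + Cinf - C 0.

Let dV z (U : R -> 'cV[R]_(q + s)) (dz : acdmx z (fun t => A *m z t + B *m U t + f t)) :=
  acdB (value_derivative dz) dC.

Lemma cost_ge_optimal u : admissible A B f z0 u -> (J0%:E <= cost A B D G f z0 u)%E.
Proof.
move=> adu; have [z [zE z00 dz L2z mu]] := trajectory_sol adu.
rewrite /cost -zE.
pose L t := quad D (z t) + quad G (u (z t) t).
have mL : measurable_fun (@halfline R : set (Leb R)) (L : Leb R -> R).
  exact: (measurable_funD (meas_vec_quad D L2z.1) (meas_vec_quad G mu)).
have L0 t : 0 <= L t by exact: quad_ge0.
have I0 : (0 <= \int[leb R]_(t in @halfline R) (L t)%:E)%E.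
  by apply: integral_ge0 => t _; rewrite lee_fin; exact: L0.
(* A cost of [+oo] is above [J0]; a finite one makes the nonnegative [L] integrable. *)
have [Ioo|Ifin] := eqVneq (\int[leb R]_(t in @halfline R) (L t)%:E)%E +oo%E.
  rewrite [leRHS](_ : _ = +oo%E); first exact: leey.
  exact: Ioo.
have intL : (leb R).-integrable (@halfline R) (EFin \o L).
  apply/integrableP; split; first exact/measurable_EFinP.
  under eq_integral do rewrite /= ger0_norm//.
  by rewrite ltey.
have -> : (\int[leb R]_(t in @halfline R) (quad D (z t) + quad G (u (z t) t))%:E)%E
    = (\int[leb R]_(t in @halfline R) L t)%:E.
  by apply/esym/fineK; rewrite ge0_fin_numE// ltey.
rewrite lee_fin; apply/ler_addgt0Pr => e e0.
have [KV KV0 VK] := value_le.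
have e2 : 0 < e / 2 by rewrite divr_gt0.
have g2 : 0 < 2 * gam by rewrite mulr_gt0.
have [T TE] := expR_small Kc g2 e2.
(* Small enough for the value function at time [b] to be at most [e / 2]; the other half of [e]
   covers the distance from [C b] to [Cinf]. *)
pose del := Num.min 1 (e / 2 / (KV * (1 + CF) + 1)).
have k0 : 0 < KV * (1 + CF) + 1 by rewrite ltr_wpDl// mulr_ge0// addr_ge0.
have del0 : 0 < del by rewrite lt_min ltr01 divr_gt0.
have [b [b0 Tb zb]] := in_L2_small T L2z del0.
have := cost_lower_bound (dV dz) mL L0 intL _ b0.
rewrite /= z00 => /(_ _) H.
have {H} : quad P (usubmx z0) + 2 * dot (h 0) (usubmx z0) - C 0 -
    (quad P (usubmx (z b)) + 2 * dot (h b) (usubmx (z b)) - C b)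
    <= \int[leb R]_(t in @halfline R) L t.
  apply: H => t t0; set x := usubmx (z t); set y := dsubmx (z t).
  have q0 := (pd_psd pdD2).2 (y + R2 *m (P *m x + h t)).
  have q1 := (pd_psd pdGt).2 (usubmx (u (z t) t) + R1 *m (P *m x + h t)).
  rewrite /L; move: q0 q1; lra.
have h1 := CE b0; have h2 := TE b Tb.
have h3 := VK (usubmx (z b)) b b0.
have xb : enorm (usubmx (z b)) <= del by apply: le_trans (enorm_usubmx _) (ltW zb).
have hb : enorm (h b) <= CF.
  apply: le_trans (enorm_h b0) _.
  by rewrite ler_piMr// expR_le1 mulNr oppr_le0 mulr_ge0// ltW.
have h4 : KV * (enorm (usubmx (z b)) ^+ 2 + enorm (h b) * enorm (usubmx (z b))) <= e / 2.
  apply: (@le_trans _ _ (KV * ((1 + CF) * del))).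
    rewrite ler_wpM2l// mulrDl mul1r; apply: lerD; last by rewrite ler_pM ?enorm_ge0.
    rewrite expr2; apply: (le_trans _ xb); rewrite ler_piMl ?enorm_ge0//.
    by apply: (le_trans xb); rewrite ge_min lexx.
  have : del * (KV * (1 + CF) + 1) <= e / 2 by rewrite -ler_pdivlMr// ge_min lexx orbT.
  have := ltW del0; lra.
move: h1 h3; rewrite !ler_norml => /andP[h1 _] /andP[_ h3]; rewrite /J0; lra.
Qed.

Lemma cost_le_optimal (N1 : 'M[R]_(q, n)) (N2 : 'M[R]_(q, s)) :
  exists2 e0 : R, 0 < e0 & exists K : R, forall eps, 0 < eps -> eps <= e0 ->
    admissible A B f z0 (block_feedback N1 N2 eps) /\
    (cost A B D G f z0 (block_feedback N1 N2 eps) <= (J0 + eps * K)%:E)%E.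
Proof.
have [e1 [K [mu [/andP[e10 e11] K0 /andP[mu0 mug] E]]]] := closed_loop_decay N1 N2.
have [e2 e20 adE] := block_feedback_admissible N1 N2.
have [KE KE0 EK] := excess_cost_le N1 N2.
have [KV KV0 VK] := value_le.
exists (Num.min e1 e2); first by rewrite lt_min e10.
pose K11 := KE * (K + CF ^+ 2) / (2 * gam).
exists (KE * K + K11) => eps eps0; rewrite le_min => /andP[epse1 epse2].
have eps1 : eps <= 1 by exact: le_trans e11.
have ad := adE eps eps0 epse2; split => //.
have [z [zE z00 dz L2z mfb]] := trajectory_sol ad.
have [V [V' [dVV V0 VE]]] := E eps eps0 epse1 z z00 dz.
rewrite /cost -zE.
set u := block_feedback N1 N2 eps in mfb dz ad zE *.
pose L t := quad D (z t) + quad G (u (z t) t).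
have K110 : 0 <= eps * K11.
  by rewrite mulr_ge0 ?(ltW eps0)// divr_ge0 ?mulr_ge0 ?addr_ge0 ?sqr_ge0 ?(ltW K0) ?(ltW gam0).
(* Two correctors of order [eps] join the value function: a multiple of the energy, whose decrease
   pays for the dissipation in [excess_cost_le], and an exponential, whose derivative cancels the
   remaining [expR (- (2 * gam) * t)] terms and so determines [K11]. Their initial values make up
   the error [eps * (KE * K + K11)]. *)
have dU := acdD (acdD (dV dz) (acdZ (eps * KE) dVV)) (acdZ (eps * K11) (acd_expRM (- (2 * gam)))).
apply: (@cost_upper_bound R L _ _ (J0 + eps * (KE * K + K11)) dU).
- exact: (measurable_funD (meas_vec_quad D L2z.1) (meas_vec_quad G mfb)).
- move=> t; exact: quad_ge0.
- have [Kz [Kh fbE]] := block_feedback_affine N1 N2 eps.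
  have bz i : locally_bounded (fun t => z t i 0) by exact: acd_locally_bounded (dz i 0).
  apply: locally_boundedD; apply: locally_bounded_quad => // i.
  under eq_fun do rewrite /u fbE mxE.
  by apply: locally_boundedD; apply: locally_bounded_mull => //; exact: locally_bounded_expR.
- move=> t t0; rewrite /L.
  set x := usubmx (z t); set k := P *m x + h t; set w := dsubmx (z t) + R2 *m k.
  have -> : usubmx (u (z t) t) + R1 *m k = eps *: (N1 *m k + N2 *m w).
    by rewrite /u /block_feedback col_mxKu addrAC addNr add0r.
  have [_ _ /(_ t0)] := VE t (ltW t0); rewrite -/x -/k -/w => h3.
  have h4 := EK eps x w (h t) eps0 eps1.
  have h5 : enorm (h t) ^+ 2 <= CF ^+ 2 * expR (- (2 * gam) * t).
    rewrite -expR_sqr -exprMn lerXn2r ?nnegrE ?mulr_ge0 ?expR_ge0 ?enorm_ge0// enorm_h//.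
    exact: ltW.
  have h6 : eps * KE * (enorm x ^+ 2 + eps^-1 * enorm w ^+ 2 + enorm (h t) ^+ 2)
      <= eps * KE * (- V' t + (K + CF ^+ 2) * expR (- (2 * gam) * t)).
    by rewrite ler_wpM2l ?mulr_ge0 ?(ltW eps0)//; lra.
  have h7 : eps * K11 * (- (2 * gam) * expR (- (2 * gam) * t))
      = - (eps * KE * ((K + CF ^+ 2) * expR (- (2 * gam) * t))).
    by rewrite /K11; field; rewrite gt_eqF.
  rewrite h7; rewrite -/k in h4; move: h4 h6.
  set q2 := quad D2 _; set qg := quad Gt _; set ee := expR _; lra.
move=> e e0; have [T TE] := expR_small (KV * (2 * K + CF ^+ 2) + `|Kc|) mu0 e0.
exists (Num.max 0 T) => t; rewrite ge_max => /andP[t0 /TE Tt].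
have [Vt0 xw _] := VE t t0; have vk := VK (usubmx (z t)) t t0; have ct := CE t0.
move: vk ct; set x := usubmx (z t) in xw *; set Wt := quad P x + _ => vk ct.
have gmu : expR (- (2 * gam) * t) <= expR (- mu * t) by rewrite ler_expR ler_wpM2r//; lra.
have hx : enorm x ^+ 2 <= K * expR (- mu * t) by apply: le_trans xw; rewrite lerDl sqr_ge0.
have hh : enorm (h t) ^+ 2 <= CF ^+ 2 * expR (- mu * t).
  apply: (@le_trans _ _ (CF ^+ 2 * expR (- (2 * gam) * t))); last by rewrite ler_wpM2l ?sqr_ge0.
  by rewrite -expR_sqr -exprMn lerXn2r ?nnegrE ?mulr_ge0 ?expR_ge0 ?enorm_ge0// enorm_h.
have h1 : KV * (enorm x ^+ 2 + enorm (h t) * enorm x)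
    <= KV * ((2 * K + CF ^+ 2) * expR (- mu * t)).
  rewrite ler_wpM2l//; have := sqr_ge0 (enorm (h t) - enorm x).
  by have := sqr_ge0 (enorm (h t)); have := sqr_ge0 (enorm x); lra.
have h2 : Kc * expR (- (2 * gam) * t) <= `|Kc| * expR (- mu * t).
  apply: (@le_trans _ _ (`|Kc| * expR (- (2 * gam) * t))).
    by rewrite ler_wpM2r ?expR_ge0// ler_norm.
  by rewrite ler_wpM2l.
have h3 : 0 <= eps * KE * V t by rewrite !mulr_ge0// ltW.
have h4 : 0 <= eps * K11 * expR (- (2 * gam) * t) by rewrite mulr_ge0 ?expR_ge0.
have h5 : eps * KE * V 0 <= eps * KE * K by rewrite ler_wpM2l// mulr_ge0// ltW.
move: vk ct; rewrite !ler_norml => /andP[vk _] /andP[_ ct].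
rewrite z00 mulr0 expR0 /J0; move: (expR (- mu * t)) Tt h1 h2 vk ct h3 h4 h5 => E1.
set E2 := expR _; move: (quad P (usubmx z0)) (dot _ (usubmx z0)) => a1 a2; lra.
Qed.

End optimal_value.

Lemma block_feedback_minimizing (N1 : 'M[R]_(q, n)) (N2 : 'M[R]_(q, s)) :
  exists2 e0 : R, 0 < e0 &
    (forall eps, 0 < eps <= e0 -> admissible A B f z0 (block_feedback N1 N2 eps)) /\
    (forall eps_ : nat -> R, (forall k, 0 < eps_ k <= e0) ->
      eps_ k @[k --> \oo] --> (0 : R) ->
      cost A B D G f z0 (block_feedback N1 N2 (eps_ k)) @[k --> \oo]
        --> min_cost A B D G f z0).
Proof.
have [C dC [Cinf [Kc CE]]] := cc_primitive.
have lower := @cost_ge_optimal C Cinf Kc dC CE.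
have [e0 e00 [K E]] := @cost_le_optimal C Cinf Kc dC CE N1 N2.
move: lower E; set J0 := _ - C 0 => lower E.
have J0le : (J0%:E <= min_cost A B D G f z0)%E.
  by apply: le_ereal_inf_tmp => _ [u adu <-]; exact: lower.
have J0E : min_cost A B D G f z0 = J0%:E.
  apply/eqP; rewrite eq_le J0le andbT; apply/lee_addgt0Pr => e epos.
  (* Makes [eps * K <= e]; the sign of [K] is not known, hence [|K| + 1]. *)
  pose eps := Num.min e0 (e / (`|K| + 1)).
  have k0 : 0 < `|K| + 1 by rewrite ltr_wpDl.
  have eps0 : 0 < eps by rewrite lt_min e00 divr_gt0.
  have epse : eps <= e0 by rewrite ge_min lexx.
  have [ad cle] := E eps eps0 epse.
  apply: (@le_trans _ _ (cost A B D G f z0 (block_feedback N1 N2 eps))).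
    by apply: ereal_inf_lbound; exists (block_feedback N1 N2 eps).
  apply: le_trans cle _; rewrite -EFinD lee_fin lerD2l.
  apply: (@le_trans _ _ (eps * (`|K| + 1))).
    by rewrite ler_wpM2l ?(ltW eps0)//; have := ler_norm K; lra.
  by rewrite -ler_pdivlMr// ge_min lexx orbT.
exists e0 => //; split=> [eps /andP[eps0 epse]|eps_ epsE eps_0]; first by have [] := E eps eps0 epse.
rewrite J0E; apply: (@squeeze_cvge _ _ _ _ (fun=> J0%:E) _ (fun k => (J0 + eps_ k * K)%:E)).
- apply: nearW => k; have /andP[eps0 epse] := epsE k; have [ad cle] := E _ eps0 epse.
  by apply/andP; split; [exact: lower | exact: cle].
- exact: cvg_cst.
apply: cvg_EFin; first exact: nearW.
rewrite -[X in _ --> X]addr0 -[X in _ + X](mul0r K).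
by apply: cvgD; [exact: cvg_cst | apply: cvgM => //; exact: cvg_cst].
Qed.

End block_lq.

(** * Definiteness of the matrices of the reduced problem *)

Section psd_congruence.
Variable R : realType.

Lemma psd_mulmx_inv n l (B : 'M[R]_(l, n)) (N : 'M[R]_n) : pd_mx N ->
  psd_mx (B *m invmx N *m B^T).
Proof.
move=> pdN; have uN := pd_unitmx pdN; split.
  by rewrite /symmetric_mx !trmx_mul trmxK trmx_inv pdN.1 mulmxA.
move=> x; set y := invmx N *m (B^T *m x).
have -> : quad (B *m invmx N *m B^T) x = quad N y.
  by rewrite !quadE mulKVmx// -!mulmxA -/y dotC dot_mull.
exact: (pd_psd pdN).2.
Qed.

Lemma psd_mxD n (M N : 'M[R]_n) : psd_mx M -> psd_mx N -> psd_mx (M + N).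
Proof.
move=> [sM M0] [sN N0]; split; first by rewrite /symmetric_mx linearD/= sM sN.
by move=> x; rewrite quadD addr_ge0.
Qed.

Lemma pd_diag_mx n (g : 'rV[R]_n) : (forall k, 0 < g 0 k) -> pd_mx (diag_mx g).
Proof.
move=> g0; split; first exact: tr_diag_mx.
move=> x x0; rewrite quadE dotE.
have [i xi] : exists i, x i 0 != 0.
  apply/existsP; rewrite -negb_forall; apply: contra x0 => /forallP x0.
  by apply/eqP/colP => i; rewrite mxE; exact/eqP.
have E j : x j 0 * (diag_mx g *m x) j 0 = g 0 j * x j 0 ^+ 2.
  by rewrite mul_diag_mx mxE; ring.
rewrite (bigD1 i)//= ltr_pwDl ?E//.
  by rewrite pmulr_rgt0// exprn_even_gt0.
by apply: sumr_ge0 => j _; rewrite E mulr_ge0 ?sqr_ge0// ltW.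
Qed.

Lemma sqr_pd_mx n (M : 'M[R]_n) : pd_mx M -> pd_mx (M *m M).
Proof.
move=> pdM; have [sM _] := pdM; split; first by rewrite /symmetric_mx trmx_mul sM.
move=> x x0; rewrite quadE -mulmxA -{1}sM -dot_mull.
have Mx0 : M *m x != 0.
  by apply: contra x0 => /eqP Mx; rewrite -(mulKmx (pd_unitmx pdM) x) Mx mulmx0.
by rewrite lt_neqAle dot_ge0 andbT eq_sym; apply: contra Mx0 => /eqP/dot_eq0/eqP.
Qed.

End psd_congruence.

(** * The transformation [T] *)

Section transformation.
Variables (R : realType) (p q s : nat) (calB : 'M[R]_(p + q + s, q + s))
  (calD : 'M[R]_(p + q + s)) (Bc : 'M[R]_(p + q + s, p)).
Let B1 := lsubmx calB.
Let B2 := rsubmx calB.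
Let L := calL Bc calB calD.
Let T := transfo Bc calB calD.
Let H := calH Bc calB calD.
Let D2 := B2^T *m calD *m B2.
Hypotheses (unitB : row_mx (row_mx Bc B1) B2 \in unitmx) (symD : calD^T = calD)
  (unitD2 : D2 \in unitmx).

(** [T] arises from the basis formed by [Bc], [B1] and [B2] through a block unipotent column
    operation. *)
Lemma transfo_unit : T \in unitmx.
Proof.
have -> : T = row_mx (row_mx Bc B1) B2 *m block_mx 1%:M 0 (- H) 1%:M.
  by rewrite mul_row_block !mulmx1 mulmxN mulmx0 add0r.
by rewrite unitmx_mul unitB unitmxE det_lblock !det1 mul1r unitr1.
Qed.

(** The last [q] columns of [L] are [B1] minus [B2] times the last [q] columns of [H]. Solving for
    [B1] gives the first block column; [B2] is itself the last block of [T]. *)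
Lemma transfo_input : invmx T *m calB = block_mx (Btilde R p q) 0 (rsubmx H) 1%:M.
Proof.
rewrite -[RHS](mulKmx transfo_unit); congr (_ *m _).
rewrite /T /transfo mul_row_block mulmx0 add0r mulmx1 -[LHS]hsubmxK; congr row_mx.
have -> : rsubmx H = H *m Btilde R p q.
  by rewrite -{2}(hsubmxK H) mul_row_col mulmx0 add0r mulmx1.
by rewrite /calL -/H mulmxBl (mulmxA _ H) subrK /Bctilde mul_row_col mulmx0 add0r mulmx1.
Qed.

(** [H] is chosen so that [B2^T calD L = 0]: [L] is what remains of [Bctilde] after projection along
    [B2], orthogonally for [calD]. *)
Lemma transfo_weight : T^T *m calD *m T = block_mx (L^T *m calD *m L) 0 0 D2.
Proof.
have BL : B2^T *m calD *m L = 0.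
  rewrite /L /calL mulmxBr mulmxA -/D2 /calH -/D2.
  by rewrite -/B2; move: (D2) unitD2 => N uN; rewrite -!mulmxA mulKVmx// subrr.
rewrite /T /transfo tr_row_mx mul_col_mx mul_col_row; congr block_mx => //.
by apply: trmx_inj; rewrite !trmx_mul trmxK symD mulmxA trmx0.
Qed.

End transformation.

(** * The two controls as members of the family *)

Section feedbacks.
Variables (R : realType) (p q s : nat) (g : 'rV[R]_q) (P10 : 'M[R]_(p + q)) (A2 : 'M[R]_(p + q, s))
  (P30 D2 : 'M[R]_s) (H2 : 'M[R]_(s, q)) (h1 : R -> 'cV[R]_(p + q)).
Hypotheses (g0 : forall k, 0 < g 0 k) (pdP30 : pd_mx P30) (symP : P10^T = P10)
  (D2E : P30 *m P30 = D2).
Let Bt := Btilde R p q.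
Let Gt := diag_mx g.
Let P20 := P10 *m A2 *m invmx P30.
Let h2 t := invmx P30 *m A2^T *m h1 t.

Lemma S0mxE : S0mx g A2 D2 = A2 *m invmx D2 *m A2^T + Bt *m invmx Gt *m Bt^T.
Proof.
congr (_ + _); rewrite /Bt /Btilde tr_col_mx trmx0 trmx1 mul_col_mx mul_col_row.
by rewrite !mul0mx mul1mx mulmx0 mulmx1.
Qed.

(** With [P30] a square root of [D2], [invmx D2] is the square of [invmx P30], so one factor [P30]
    comes out and leaves the deviation [w]. *)
Let fastE x y (v : 'cV[R]_(p + q)) :
  P20^T *m x + P30 *m y + invmx P30 *m A2^T *m v
  = P30 *m (y + invmx D2 *m A2^T *m (P10 *m x + v)).
Proof.
have u3 := pd_unitmx pdP30.
have iD2 : invmx D2 = invmx P30 *m invmx P30.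
  rewrite -[RHS](@mulKmx _ _ _ D2); last by rewrite -D2E unitmx_mul u3.
  by rewrite -{3}D2E -mulmxA mulKVmx// mulmxV// mulmx1.
have -> : P30 *m (y + invmx D2 *m A2^T *m (P10 *m x + v))
    = P30 *m y + invmx P30 *m A2^T *m (P10 *m x + v).
  by rewrite mulmxDr iD2 -!mulmxA mulKVmx.
rewrite /P20 !trmx_mul trmx_inv pdP30.1 symP mulmxDr !mulmxA.
by rewrite addrAC addrC addrA addrAC addrC addrA.
Qed.

Lemma u2E eps : u2 g P10 P20 P30 h1 h2 eps = block_feedback P10 A2 Bt D2 P30 Gt h1 0 0 eps.
Proof.
apply/funext => z; apply/funext => t; rewrite /u2 /block_feedback fastE.
by rewrite !mul0mx addr0 scaler0 addr0.
Qed.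

(** In the fast row [eps^-2] from the inverse of [G + E] meets the [eps] of [P0] and [h0], leaving
    [eps^-1 P30 w] as in [u2]. In the slow row the extra terms are [eps] times [Bt^T P20 y] and
    [H2^T P30 w]; replacing [y] by [w - R2 k], with [R2] denoting [D2^-1 A2^T], yields [N1] and
    [N2]. *)
Lemma u1E (B : 'M[R]_(p + q + s, q + s)) eps : B = block_mx Bt 0 H2 1%:M -> 0 < eps ->
  u1 g B P10 P20 P30 h1 h2 eps
  = block_feedback P10 A2 Bt D2 P30 Gt h1
      (invmx Gt *m Bt^T *m P20 *m (invmx D2 *m A2^T))
      (- (invmx Gt *m (Bt^T *m P20 + H2^T *m P30))) eps.
Proof.
move=> BE eps0; apply/funext => z; apply/funext => t.
have uG : Gt \in unitmx by exact: pd_unitmx (pd_diag_mx g0).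
have e0 : eps != 0 by rewrite gt_eqF.
pose GE' := block_mx (invmx Gt) 0 0 ((eps ^- 2)%:M : 'M[R]_s).
have GEV : (Gmx s g + Emx q s eps) *m GE' = 1%:M.
  rewrite /Gmx /Emx add_block_mx !addr0 add0r /GE' mulmx_block !mulmx0 !mul0mx !addr0 !add0r.
  by rewrite mulmxV// -scalar_mxM divff ?expf_neq0// -scalar_mx_block.
have iGE : invmx (Gmx s g + Emx q s eps) = GE'.
  have [uGE _] := mulmx1_unit GEV.
  by rewrite -[LHS]mulmx1 -GEV mulKmx.
pose x := usubmx z; pose y := dsubmx z; pose k := P10 *m x + h1 t.
pose w := y + invmx D2 *m A2^T *m k.
have PE : block_mx P10 (eps *: P20) (eps *: P20^T) (eps *: P30) *m z
    + col_mx (h1 t) (eps *: h2 t)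
    = col_mx (k + eps *: (P20 *m y)) (eps *: (P30 *m w)).
  rewrite -{1}(vsubmxK z) mul_block_col add_col_mx -!scalemxAl -!scalerDr fastE.
  by rewrite addrAC.
rewrite /u1 iGE -!(mulmxA (GE' *m B^T)) -opprD -mulmxDr PE BE tr_block_mx trmx0 trmx1.
rewrite -(mulmxA GE') /GE' !mul_block_col !mul0mx !mul1mx !add0r addr0 mul_scalar_mx scalerA.
rewrite (_ : eps ^- 2 * eps = eps^-1); last by field.
rewrite /block_feedback -/x -/y -/k -/w opp_col_mx; congr col_mx.
have -> : P20 *m y = P20 *m w - P20 *m (invmx D2 *m A2^T *m k).
  by rewrite -mulmxBr /w addrK.
clearbody w k P20; clear.
rewrite !mulNmx -!mulmxA !mulmxDl -!mulmxA.
move: (P20 *m (invmx _ *m _)) (P20 *m w) (P30 *m w) => a b c.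
rewrite !mulmxDr -!scalemxAr !mulmxDr !mulmxN.
move: (invmx Gt *m _) (invmx Gt *m _) (invmx Gt *m _) (invmx Gt *m _) => a1 a2 a3 a4.
by apply/colP => i; rewrite !mxE; ring.
Qed.

End feedbacks.

(** The matrix [Q] of [riccati_lyapunov] is used twice: it bounds the exponential behind the adjoint
    equation, and it is the slow part of the energy. The two instances of the family have their own
    thresholds, and [ehat] is the smaller one. *)
Lemma reduced_feedbacks_minimizing (R : realType) (p q s m : nat) (A1 D1 P10 : 'M[R]_(p + q))
    (A2 : 'M[R]_(p + q, s)) (A3 : 'M[R]_(s, p + q)) (A4 D2 P30 : 'M[R]_s) (H2 : 'M[R]_(s, q))
    (g : 'rV[R]_q) (z0 : 'cV[R]_(p + q + s)) (f : R -> 'cV[R]_(p + q + s))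
    (F1 : 'M[R]_(m, p + q)) (a gam : R) :
  let A := block_mx A1 A2 A3 A4 in
  let B : 'M[R]_(p + q + s, q + s) := block_mx (Btilde R p q) 0 H2 1%:M in
  let D := block_mx D1 0 0 D2 in
  let G := Gmx s g in
  let S0 := S0mx g A2 D2 in
  let h1 := h10 (A1 - S0 *m P10) P10 (fun t => usubmx (f t)) in
  let h2 := fun t => invmx P30 *m A2^T *m h1 t in
  let P20 := P10 *m A2 *m invmx P30 in
  let v1 := u1 g B P10 P20 P30 h1 h2 in
  let v2 := u2 g P10 P20 P30 h1 h2 in
  meas_vec f -> psd_mx D1 -> (forall k, 0 < g 0 k) -> 0 < gam ->
  (forall t : R, 0 <= t -> enorm (f t) <= a * expR (- gam * t)) ->
  D1 = F1^T *m F1 -> detectable A1 F1 -> riccati_sol A1 S0 D1 P10 ->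
  pd_mx P30 -> P30 *m P30 = D2 ->
  exists2 ehat : R, 0 < ehat &
    (forall eps : R, 0 < eps <= ehat ->
       admissible A B f z0 (v1 eps) /\ admissible A B f z0 (v2 eps)) /\
    (forall eps_ : nat -> R, (forall k, 0 < eps_ k <= ehat) ->
       eps_ k @[k --> \oo] --> (0 : R) ->
       (cost A B D G f z0 (v1 (eps_ k)) @[k --> \oo] --> min_cost A B D G f z0) /\
       (cost A B D G f z0 (v2 (eps_ k)) @[k --> \oo] --> min_cost A B D G f z0)).
Proof.
move=> A B D G S0 h1 h2 P20 v1 v2 mf psdD1 g0 gam0 fa D1E det ric pdP30 D2E.
have [[symP _] _] := ric.
have pdD2 : pd_mx D2 by rewrite -D2E; exact: sqr_pd_mx.
have pdG := pd_diag_mx g0.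
have S0E : S0 = _ := S0mxE g A2 D2.
have psdS0 : psd_mx S0 by rewrite S0E; apply: psd_mxD; exact: psd_mulmx_inv.
have [Q pdQ [c c0 Qc]] := riccati_lyapunov psdS0 D1E det ric.
have [K K0 EK] := expmx_bounded pdQ c0 Qc.
have mf1 := meas_vec_submx mf.
have fa1 t : 0 <= t -> forall i, `|usubmx (f t) i 0| <= a * expR (- gam * t).
  move=> t0 i; apply: le_trans (normr_coord_le_enorm _ _) _.
  exact: le_trans (enorm_usubmx _) (fa t t0).
have [dh [Ch Ch0 hC]] := h10_ode P10 gam0 mf1 fa1 EK K0.
have hfC t : 0 <= t -> enorm (h1 t) + enorm (f t) <= (Ch + a) * expR (- gam * t).
  by move=> t0; rewrite mulrDl; apply: lerD; [exact: hC | exact: fa].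
rewrite -/h1 in dh.
rewrite S0E in ric Qc dh.
have main := block_feedback_minimizing A3 A4 H2 z0 pdD2 pdG pdP30 psdD1 ric pdQ c0 Qc gam0 mf dh hfC.
have v2E eps : v2 eps = block_feedback P10 A2 (Btilde R p q) D2 P30 (diag_mx g) h1 0 0 eps.
  exact: u2E.
pose N1 := invmx (diag_mx g) *m (Btilde R p q)^T *m P20 *m (invmx D2 *m A2^T).
pose N2 := - (invmx (diag_mx g) *m ((Btilde R p q)^T *m P20 + H2^T *m P30)).
have v1E eps : 0 < eps ->
    v1 eps = block_feedback P10 A2 (Btilde R p q) D2 P30 (diag_mx g) h1 N1 N2 eps.
  exact: u1E.
have [e1 e10 [ad1 lim1]] := main N1 N2; have [e2 e20 [ad2 lim2]] := main 0 0.
exists (Num.min e1 e2); first by rewrite lt_min e10.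
have minE (eps : R) : 0 < eps <= Num.min e1 e2 -> [/\ 0 < eps, 0 < eps <= e1 & 0 < eps <= e2].
  by rewrite le_min => /and3P[-> -> ->].
split=> [eps /minE[eps0 le1 le2]|eps_ /(_ _)/minE epsE eps_0].
  by split; [rewrite v1E//; exact: ad1 | rewrite v2E; exact: ad2].
split.
  have -> : (fun k => cost A B D G f z0 (v1 (eps_ k))) = (fun k => cost A B D G f z0
      (block_feedback P10 A2 (Btilde R p q) D2 P30 (diag_mx g) h1 N1 N2 (eps_ k))).
    by apply/funext => k; rewrite v1E//; have [] := epsE k.
  by apply: lim1 => // k; have [] := epsE k.
under eq_fun do rewrite v2E.
by apply: lim2 => // k; have [] := epsE k.
Qed.

Theorem theorem21 (R : realType) (p q s : nat)
    (calA : 'M[R]_(p + q + s)) (calB : 'M[R]_(p + q + s, q + s))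
    (calD : 'M[R]_(p + q + s)) (g : 'rV[R]_q)
    (Z0 : 'cV[R]_(p + q + s)) (calF : R -> 'cV[R]_(p + q + s))
    (Bc : 'M[R]_(p + q + s, p)) (m : nat) (F1 : 'M[R]_(m, p + q))
    (P10 : 'M[R]_(p + q)) (P30 : 'M[R]_s) (a gam : R) :
  let B1 := lsubmx calB in
  let B2 := rsubmx calB in
  let T := transfo Bc calB calD in
  let L := calL Bc calB calD in
  let A := invmx T *m calA *m T in
  let B := invmx T *m calB in
  let D := T^T *m calD *m T in
  let D1 := L^T *m calD *m L in
  let D2 := B2^T *m calD *m B2 in
  let G := Gmx s g in
  let f := fun t => invmx T *m calF t in
  let z0 := invmx T *m Z0 in
  let A1 : 'M[R]_(p + q) := ulsubmx A in
  let A2 : 'M[R]_(p + q, s) := ursubmx A in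
  let f1 : R -> 'cV[R]_(p + q) := fun t => usubmx (f t) in
  let S0 := S0mx g A2 D2 in
  let A0 := A1 - S0 *m P10 in
  let P20 := P10 *m A2 *m invmx P30 in
  let h1 := h10 A0 P10 f1 in
  let h2 := fun t => invmx P30 *m A2^T *m h1 t in
  let Mu := admissible A B f z0 in
  let J := cost A B D G f z0 in
  let Jstar := min_cost A B D G f z0 in
  let v1 := u1 g B P10 P20 P30 h1 h2 in
  let v2 := u2 g P10 P20 P30 h1 h2 in
  (0 < s)%N ->
  meas_vec calF ->
  row_mx (row_mx Bc B1) B2 \in unitmx ->
  \rank calB = (q + s)%N ->
  psd_mx calD ->
  (forall k, 0 < g 0 k) ->
  0 < a -> 0 < gam ->
  (forall t : R, 0 <= t -> enorm (calF t) <= a * expR (- gam * t)) ->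
  \det D2 != 0 ->
  stabilizable A1 (row_mx (Btilde R p q) A2) ->
  D1 = F1^T *m F1 ->
  detectable A1 F1 ->
  riccati_sol A1 S0 D1 P10 ->
  pd_mx P30 -> P30 *m P30 = D2 ->
  exists2 ehat : R, 0 < ehat &
    (forall eps : R, 0 < eps <= ehat -> Mu (v1 eps) /\ Mu (v2 eps)) /\
    (forall eps_ : nat -> R, (forall k, 0 < eps_ k <= ehat) ->
       eps_ k @[k --> \oo] --> (0 : R) ->
       (J (v1 (eps_ k)) @[k --> \oo] --> Jstar) /\
       (J (v2 (eps_ k)) @[k --> \oo] --> Jstar)).
Proof.
move=> B1 B2 T L A B D D1 D2 G f z0 A1 A2 f1 S0 A0 P20 h1 h2 Mu J Jstar v1 v2.
move=> _ mF unitB _ psdD g0 _ gam0 Fa detD2 _ D1E det ric pdP30 D2E.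
have [symD D0] := psdD.
have unitD2 : D2 \in unitmx by rewrite unitmxE unitfE.
have BE := transfo_input calD unitB; have DE := transfo_weight Bc symD unitD2.
have psdD1 : psd_mx D1.
  split; first by rewrite /symmetric_mx !trmx_mul trmxK symD mulmxA.
  by move=> x; have := D0 (L *m x); rewrite /quad trmx_mul !mulmxA.
(* The transformed forcing keeps the rate [gam]; only its amplitude is multiplied by a bound on
   [T^-1]. *)
have [K K0 TK] := enorm_mulmx (invmx T).
have fa t : 0 <= t -> enorm (f t) <= K * a * expR (- gam * t).
  by move=> t0; apply: le_trans (TK _) _; rewrite -mulrA ler_wpM2l// Fa.
have mf : meas_vec f by exact: meas_vec_mull.
have := reduced_feedbacks_minimizing (dlsubmx A) (drsubmx A) (rsubmx (calH Bc calB calD)) z0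
  mf psdD1 g0 gam0 fa D1E det ric pdP30 D2E.
by rewrite /= -BE -DE submxK.
Qed.
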